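(* Let $\Gamma$ be a Kleinian group. Suppose there are $\alpha\ge0$ and two points $x,y\in M_\Gamma$ such that (i) there are constants $c_-,c_+>0$ and $t_0>0$ such that for all $t>t_0$ $$c_-\,t^{-\alpha}\le p_\Gamma(x,y,t)\le c_+\,t^{-\alpha};$$ (ii) the averaged orbital function $\rho\mapsto\tilde N_\Gamma(x,y,\rho)$ is roughly decreasing. Then there are positive constants $C_-,C_+,\rho_0$ such that for any $\rho>\rho_0$ $$\frac{C_-\,e^{2\rho}}{\rho^\alpha}\le N_\Gamma(x,y,\rho)\le\frac{C_+\,e^{2\rho}}{\rho^\alpha}.$$
   Context: A Kleinian group is a torsion-free subgroup $\Gamma$ of the group of orientation-preserving isometries of hyperbolic 3-space $\mathbb{H}^3$ acting properly and discontinuously (not assumed finitely generated here); $M_\Gamma:=\mathbb{H}^3/\Gamma$. Orbital function: $N_\Gamma(x,y,\rho):=\#\{\gamma\in\Gamma: d(\tilde x,\gamma\cdot\tilde y)\le\rho\}$, where $\tilde x,\tilde y\in\mathbb{H}^3$ are any lifts of $x,y$ (the value does not depend on the lifts). The averaged orbital function is $\tilde N_\Gamma(x,y,\rho):=N_\Gamma(x,y,\rho)/e^{2\rho}$. A function $f:\mathbb{R}_+\to\mathbb{R}_+$ is roughly decreasing if there are constants $C>0$ and $\rho_0>0$ such that $f(\rho_2)\le Cf(\rho_1)$ for all $\rho_0\le\rho_1\le\rho_2$. $p_\Gamma(x,y,t)$ is the heat kernel of $M_\Gamma$, i.e. the kernel of the semigroup solving $\Delta u+\partial_t u=0$ with $\Delta=-\operatorname{div}\nabla$.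 *)

(* Defs.v *)
From HB Require Import structures.
From mathcomp Require Import all_boot all_order all_algebra finmap lra.
From mathcomp Require Import all_classical all_reals all_analysis.

Set Implicit Arguments.
Unset Strict Implicit.
Unset Printing Implicit Defensive.

Import Order.TTheory GRing.Theory Num.Theory.
Import numFieldTopology.Exports numFieldNormedType.Exports.

Local Open Scope classical_set_scope.
Local Open Scope ring_scope.
Local Open Scope quotient_scope.

(** Hyperbolic 3-space is the hyperboloid
    [v0 ^+ 2 = 1 + v1 ^+ 2 + v2 ^+ 2 + v3 ^+ 2], [v0 > 0] of Minkowski space,
    in the global chart that forgets [v0].  So a point is a vector [x] of R^3,
    and its missing coordinate is [height x]. *)

Definition H3 (R : realType) := 'rV[R]_3.

Section HyperbolicSpace.
Context {R : realType}.
Implicit Types (x y z : H3 R) (f : H3 R -> R) (g : H3 R -> H3 R).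

Definition dotp x y : R := \sum_(i < 3) x 0 i * y 0 i.

Definition height x : R := Num.sqrt (1 + dotp x x).

Definition arcosh (c : R) : R := ln (c + Num.sqrt (c ^+ 2 - 1)).

(** [cosh d(x, y)] is minus the Lorentz product of the two points. *)
Definition hdist x y : R := arcosh (height x * height y - dotp x y).

(** Since [height * d height = \sum_i x_i dx_i], the form
    [- d height ^+ 2 + \sum_i dx_i ^+ 2] induced on the hyperboloid has this
    Gram matrix in the chart. *)
Definition metric x : 'M[R]_3 := 1%:M - (height x) ^- 2 *: (x^T *m x).

Definition vol_density x : R := Num.sqrt (\det (metric x)).

Definition partial (i : 'I_3) f x : R := 'D_(delta_mx 0 i) f x.

Definition grad f x : 'rV[R]_3 :=
  \row_i \sum_(j < 3) invmx (metric x) i j * partial j f x.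

Definition divergence (V : H3 R -> 'rV[R]_3) x : R :=
  (vol_density x)^-1 *
  \sum_(i < 3) partial i (fun z => vol_density z * V z 0 i) x.

Definition laplacian f x : R := - divergence (grad f) x.

Definition C2 f : Prop :=
  [/\ forall x, differentiable f x,
      forall i x, differentiable (partial i f) x &
      forall i j, continuous (partial j (partial i f))].

Definition isometry g : Prop :=
  (forall x y, hdist (g x) (g y) = hdist x y) /\ (forall y, exists x, g x = y).

Definition orientation_preserving g : Prop :=
  forall x, differentiable g x /\ 0 < \det ('J g x).

(** Points of R^3 as triples, to use the product Lebesgue measure. *)
Definition of_triple (v : R * R * R) : H3 R :=
  \row_(i < 3) [:: v.1.1; v.1.2; v.2]`_i.

Definition lebesgue3 :=
  ((@lebesgue_measure R \x @lebesgue_measure R) \x @lebesgue_measure R)%E.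

End HyperbolicSpace.

Record kleinian_group (R : realType) := KleinianGroup {
  kg_mem : set (H3 R -> H3 R);
  kg_id : kg_mem id;
  kg_comp : forall g h, kg_mem g -> kg_mem h -> kg_mem (g \o h);
  kg_inv : forall g, kg_mem g ->
    exists h, [/\ kg_mem h, cancel g h & cancel h g];
  kg_isometry : forall g, kg_mem g -> isometry g;
  kg_orientation : forall g, kg_mem g -> orientation_preserving g;
  kg_torsion_free : forall g n, kg_mem g -> iter n.+1 g =1 id -> g = id;
  kg_properly_discontinuous : forall K : set (H3 R), compact K ->
    finite_set [set g | kg_mem g /\ (g @` K) `&` K !=set0]
}.

Section Quotient.
Context {R : realType}.
Variable Gam : kleinian_group R.

Definition same_orbit (x y : H3 R) : bool :=
  `[< exists g, kg_mem Gam g /\ y = g x >].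

Lemma same_orbit_refl : reflexive same_orbit.
Proof. by move=> x; apply/asboolP; exists id; split => //; exact: kg_id. Qed.

Lemma same_orbit_sym : symmetric same_orbit.
Proof.
suff sub x y : same_orbit x y -> same_orbit y x.
  by move=> x y; apply/idP/idP; exact: sub.
move=> /asboolP[g [Gg ->]]; have [h [Gh gK _]] := kg_inv Gg.
by apply/asboolP; exists h; rewrite gK.
Qed.

Lemma same_orbit_trans : transitive same_orbit.
Proof.
move=> y x z /asboolP[g [Gg ->]] /asboolP[h [Gh ->]]; apply/asboolP.
by exists (h \o g); split => //; exact: kg_comp.
Qed.

Canonical same_orbit_equiv :=
  EquivRel same_orbit same_orbit_refl same_orbit_sym same_orbit_trans.

Definition M := quotient_topology {eq_quot same_orbit_equiv}.

Definition proj (z : H3 R) : M := \pi_M z.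

Definition lift (x : M) : H3 R := repr x.

Definition orbital_set (a b : H3 R) (rho : R) : set (H3 R -> H3 R) :=
  [set g | kg_mem Gam g /\ hdist a (g b) <= rho].

Lemma ball_bounded (a : H3 R) (rho : R) :
  exists B, forall z, hdist a z <= rho -> forall i, `|z 0 i| <= B.
Proof.
set s := Num.sqrt (dotp a a).
have dot_ge0 (z : H3 R) : 0 <= dotp z z.
  by apply: sumr_ge0 => i _; rewrite -expr2 sqr_ge0.
have sa : 0 < height a - s.
  by rewrite subr_gt0 /s /height ltr_sqrt ?ltrDr ?ltr01// ltr_pwDl.
exists (expR rho / (height a - s)) => z az i.
have zi : `|z 0 i| <= height z.
  rewrite -sqrtr_sqr /height ler_sqrt; last by rewrite addr_ge0.
  rewrite /dotp (bigD1 i)//= -expr2 addrCA lerDl addr_ge0//.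
  by apply: sumr_ge0 => j _; rewrite -expr2 sqr_ge0.
apply: (le_trans zi); rewrite ler_pdivlMr//.
have ce : height a * height z - dotp a z <= expR rho.
  move: az; rewrite /hdist /arcosh; set c := (_ - _ : R) => az.
  have [c0|c0] := ltP 0 (c + Num.sqrt (c ^+ 2 - 1)); last first.
    apply: (@le_trans _ _ 0); last exact: expR_ge0.
    by apply: le_trans c0; rewrite lerDl sqrtr_ge0.
  apply: (@le_trans _ _ (c + Num.sqrt (c ^+ 2 - 1))).
    by rewrite lerDl sqrtr_ge0.
  by rewrite -[leLHS]lnK ?posrE// ler_expR.
apply: le_trans ce; rewrite mulrBr [height a * _]mulrC lerD2l.
rewrite lerN2.
apply: (le_trans (ler_norm _)).
rewrite -[leRHS]ger0_norm ?mulr_ge0 ?sqrtr_ge0// -ler_sqr ?nnegrE ?normr_ge0//.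
rewrite !real_normK ?num_real// exprMn /s /height !sqr_sqrtr ?addr_ge0//.
apply: (@le_trans _ _ (dotp a a * dotp z z)); last first.
  by rewrite mulrC ler_wpM2r// lerDr.
rewrite /dotp !big_ord_recl !big_ord0 /=.
move: (a 0 _) (a 0 _) (a 0 _) (z 0 _) (z 0 _) (z 0 _) => a1 a2 a3 z1 z2 z3.
have := sqr_ge0 (a1 * z2 - a2 * z1).
have := sqr_ge0 (a1 * z3 - a3 * z1).
have := sqr_ge0 (a2 * z3 - a3 * z2).
nra.
Qed.

(** [fset_set] sends every infinite set to the empty one; this rules that
    case out in [orbital]. *)
Lemma orbital_set_finite (a b : H3 R) rho : finite_set (orbital_set a b rho).
Proof.
have [B hB] := ball_bounded a rho.
pose I i := `[- Num.max B `|b 0 i|, Num.max B `|b 0 i|]%classic.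
have KC : compact [set z : H3 R | forall i, I i (z 0 i)].
  by apply: (@rV_compact R _ I) => i; exact: segment_compact.
apply: sub_finite_set (kg_properly_discontinuous Gam KC).
move=> g [Gg abg]; split => //; exists (g b); split.
  by exists b => //= i; rewrite /I /= in_itv/= -ler_norml le_max lexx orbT.
by move=> i; rewrite /I /= in_itv/= -ler_norml le_max hB.
Qed.

Definition orbital (x y : M) (rho : R) : nat :=
  #|` fset_set (orbital_set (lift x) (lift y) rho)|%fset.

Lemma orbitalE (a b : H3 R) rho :
  orbital (proj a) (proj b) rho = #|` fset_set (orbital_set a b rho)|%fset.
Proof.
have lift_orbit (z : H3 R) : exists g, kg_mem Gam g /\ z = g (lift (proj z)).
  by apply/asboolP; have /eqmodP := reprK (proj z).
have [g [Gg ag]] := lift_orbit a; have [h [Gh bh]] := lift_orbit b.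
have [g' [Gg' gK g'K]] := kg_inv Gg; have [h' [Gh' hK h'K]] := kg_inv Gh.
rewrite /orbital; move: (lift _) (lift _) ag bh => a' b' -> -> {a b}.
set A := orbital_set _ _ _; set B := orbital_set _ _ _.
have -> : B = (fun k => g \o k \o h') @` A.
  apply/seteqP; split => [k [Gk kab]|_ [k [Gk kab] <-]]; last first.
    split; first by apply: kg_comp => //; apply: kg_comp.
    by rewrite /= hK (kg_isometry Gg).1.
  exists (g' \o k \o h); last by apply/funext => z /=; rewrite g'K h'K.
  split; first by apply: kg_comp => //; apply: kg_comp.
  by rewrite -(kg_isometry Gg).1/= g'K.
rewrite fset_set_image ?card_imfset//; last exact: orbital_set_finite.
move=> k l /(congr1 (fun f => g' \o f \o h)) kl; apply/funext => z.
by have := congr1 (fun f => f z) kl; rewrite /= !hK !gK.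
Qed.

Definition avg_orbital (x y : M) (rho : R) : R :=
  (orbital x y rho)%:R / expR (2 * rho).

(** Dirichlet domain centred at [0], the point [(1, 0, 0, 0)] of the
    hyperboloid.  Its translates cover, and overlap in null sets only. *)
Definition dirichlet_domain : set (H3 R) :=
  [set z | forall g, kg_mem Gam g -> hdist z 0 <= hdist z (g 0)].

Definition integralM (h : M -> R) : \bar R :=
  (\int[lebesgue3]_(v in of_triple @^-1` dirichlet_domain)
     (h (proj (of_triple v)) * vol_density (of_triple v))%:E)%E.

Definition Cc (f : M -> R) : Prop :=
  continuous f /\ exists2 K : set M, compact K & forall x, ~ K x -> f x = 0.

(** Smoothness and the Laplacian on [M] are read upstairs, [proj] being a local
    isometry. *)
Record cauchy_solution (f : M -> R) (u : M -> R -> R) : Prop := {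
  cs_continuous : forall x t, 0 < t ->
    {for (x, t), continuous (fun z : M * R => u z.1 z.2)};
  cs_C2 : forall t, 0 < t -> C2 (fun z => u (proj z) t);
  cs_derivable : forall x t, 0 < t -> derivable (u x) t 1;
  cs_heat : forall z t, 0 < t ->
    laplacian (fun z' => u (proj z') t) z + derive1 (u (proj z)) t = 0;
  cs_initial : forall x,
    (fun z : M * R => u z.1 z.2) @ filter_prod (nbhs x) (0 : R)^'+ --> f x
}.

(** [p] is the heat kernel: the kernel of a positive contraction semigroup
    [f |-> \int p(., y, t) f(y) dy] that solves the heat equation with initial
    value [f].  On the complete manifold [M], of curvature -1, bounded solutions
    of the Cauchy problem are unique, so these conditions determine [p x y t]
    for [t > 0]. *)
Record heat_kernel (p : M -> M -> R -> R) : Prop := {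
  hk_ge0 : forall x y t, 0 < t -> 0 <= p x y t;
  hk_continuous : forall x y t, 0 < t ->
    {for (x, y, t), continuous (fun z : M * M * R => p z.1.1 z.1.2 z.2)};
  hk_contraction : forall x t, 0 < t ->
    (integralM (fun y => p x y t) <= 1)%E;
  hk_semigroup : forall x y s t, 0 < s -> 0 < t ->
    (p x y (s + t))%:E = integralM (fun z => p x z s * p z y t);
  hk_solution : forall f, Cc f ->
    cauchy_solution f (fun x t => fine (integralM (fun y => p x y t * f y)))
}.

End Quotient.

Definition roughly_decreasing {R : realType} (f : R -> R) : Prop :=
  exists C rho0 : R, [/\ 0 < C, 0 < rho0 &
    forall rho1 rho2, rho0 <= rho1 -> rho1 <= rho2 -> f rho2 <= C * f rho1].

(* Main.v *)
Require Import Defs.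
From mathcomp Require Import all_boot all_order all_algebra finmap ring lra.
From mathcomp Require Import all_classical all_reals all_analysis.
Set Implicit Arguments.
Unset Strict Implicit.
Unset Printing Implicit Defensive.
Import Order.TTheory GRing.Theory Num.Theory.
Import numFieldTopology.Exports numFieldNormedType.Exports.
Local Open Scope classical_set_scope.
Local Open Scope ring_scope.

(** Let [K] be the sum over the orbit of [y] of the heat kernel of hyperbolic
    space, which is explicit.  The ratios of [K] at different times are those of
    [p]: start the heat flow on [M] from a truncation of [K] at a small time,
    supported near [y].  Lifted to hyperbolic space, it is compared with finite
    subsums of [K] by a maximum principle with the barrier
    [expR (3 * t) * height]; on the other hand [p x] is almost constant on the
    small support.  The unknown mass of the initial value cancels in the ratio,
    so no normalization, and no summability of [K], is needed.  Hence [K] at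
    time [t] has size [t `^ (- alpha)].

    Now [K] at time [t] is, up to constants, the sum over [k] of the averaged
    count at [k] times a Gaussian weight of mass O(1) centred at [2 * t], of
    width [sqrt t].  For [t = m / 2], the terms with [k] just below [m] and rough
    decrease bound the averaged count at [m] from above.  For
    [t = m / 2 + B * sqrt m] with [B] large, the terms with [k <= m] contribute,
    by this upper bound, a small multiple of [t `^ (- alpha)], and those with
    [k > m] at most a constant times the averaged count at [m], by rough
    decrease. *)

(** * Second-order expansions *)

Section Derivatives.
Context {R : realType}.
Implicit Types (f g : R -> R) (x a b : R).

(** The truncation is forced by the notion of heat kernel: the flow is known to solve the heat
    equation only for initial values in [Cc]. Cutting the kernel off costs at most [cutoff] per
    group element, and for a fixed support radius this is [O(tau)], hence negligible on a fixed
    finite subsum as the small time [tau] tends to 0.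

    The barrier comes from the linear coordinates of Minkowski space. Restricted to the hyperboloid
    they are eigenfunctions of [div grad] with eigenvalue 3, so [expR (3 * t) * height] solves the
    heat equation; being proper, it controls bounded functions at infinity.

    A maximum sees only second-order Taylor polynomials along lines. Working with these, instead of
    derivatives in a neighbourhood, avoids a smoothness proof for the kernel at its pole, where
    [arcosh] is singular.

    The averaged count appears because the kernel decays like [(1 + y) * expR (- y)] times a
    Gaussian factor centred at 0; recentring that factor at [2 * t] turns [expR (- y)] into
    [expR (- (2 * y))], which is exactly the normalization of the orbital function. *)

Lemma der_eq f x a b : is_derive x 1 f a -> a = b -> is_derive x 1 f b.
Proof. by move=> ? <-. Qed.

Lemma der_cst c x : is_derive x 1 (fun _ : R => c : R) 0.
Proof. exact: is_derive_cst. Qed.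

Lemma der_id x : is_derive x 1 (fun y : R => y) 1.
Proof. exact: is_derive_id. Qed.

Lemma derD f g x a b : is_derive x 1 f a -> is_derive x 1 g b ->
  is_derive x 1 (fun y => f y + g y) (a + b).
Proof. by move=> ? ?; exact: is_deriveD. Qed.

Lemma derN f x a : is_derive x 1 f a -> is_derive x 1 (fun y => - f y) (- a).
Proof. by move=> ?; exact: is_deriveN. Qed.

Lemma derM f g x a b : is_derive x 1 f a -> is_derive x 1 g b ->
  is_derive x 1 (fun y => f y * g y) (a * g x + f x * b).
Proof.
move=> df dg; have H : is_derive x 1 (f * g) (f x *: b + g x *: a).
  exact: is_deriveM.
by apply: der_eq H _; rewrite addrC /GRing.scale /= [g x * a]mulrC.
Qed.

Lemma derX f n x a : is_derive x 1 f a ->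
  is_derive x 1 (fun y => f y ^+ n) (n%:R * f x ^+ n.-1 * a).
Proof.
move=> ?; suff <- : (f ^+ n : R -> R) = (fun y => f y ^+ n) by exact: is_deriveX.
by apply/funext => y; rewrite fctE.
Qed.

Lemma derV f x a : f x != 0 -> is_derive x 1 f a ->
  is_derive x 1 (fun y => (f y)^-1) (- (f x) ^- 2 * a).
Proof.
move=> f0 df; apply: DeriveDef; first exact: derivableV.
by rewrite (deriveV f0) // derive_val.
Qed.

Lemma der_comp f g x a b : is_derive x 1 f a -> is_derive (f x) 1 g b ->
  is_derive x 1 (fun y => g (f y)) (b * a).
Proof. by move=> df dg; exact: is_derive1_comp. Qed.

Lemma der_expR f x a : is_derive x 1 f a ->
  is_derive x 1 (fun y => expR (f y)) (expR (f x) * a).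
Proof. by move=> df; apply: der_comp df _; exact: is_derive_expR. Qed.

Lemma der_ln f x a : 0 < f x -> is_derive x 1 f a ->
  is_derive x 1 (fun y => ln (f y)) ((f x)^-1 * a).
Proof. by move=> f0 df; apply: der_comp df _; exact: is_derive1_ln. Qed.

Lemma der_sqrt f x a : 0 < f x -> is_derive x 1 f a ->
  is_derive x 1 (fun y => Num.sqrt (f y)) ((2 * Num.sqrt (f x))^-1 * a).
Proof. by move=> f0 df; apply: der_comp df _; exact: is_derive1_sqrt. Qed.

Lemma der_near_eq f g x a : (\forall y \near x, f y = g y) ->
  is_derive x 1 f a -> is_derive x 1 g a.
Proof. by move=> fg; apply: near_eq_is_derive => //; rewrite oner_neq0. Qed.

Lemma der_continuous f x a : is_derive x 1 f a -> {for x, continuous f}.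
Proof. by move=> [df _]; exact/differentiable_continuous/derivable1_diffP. Qed.

Lemma der_quot f x a : is_derive x 1 f a ->
  (fun h => h^-1 * (f (x + h) - f x)) @ 0^' --> a.
Proof.
move=> [df <-]; apply: cvg_trans df; apply: near_eq_cvg.
by near=> h; rewrite /= /GRing.scale /= mulr1 [x + h]addrC.
Unshelve. all: by end_near. Qed.

(** Stands in for integration from 0: the Taylor bounds on [sinhR] and [coshR] are obtained from it
    one order at a time. *)
Lemma nonneg_of_der f g x : 0 <= x -> f 0 = 0 ->
  (forall y : R, 0 <= y -> is_derive y 1 f (g y)) ->
  (forall y : R, 0 <= y -> 0 <= g y) -> 0 <= f x.
Proof.
rewrite le_eqVlt => /predU1P[<- -> //|x0 f0 df g0].
have [||c] := @MVT R f g 0 x x0.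
- by move=> y; rewrite in_itv /= => /andP[y0 _]; apply: df; exact: ltW.
- apply: derivable_within_continuous => y; rewrite in_itv /= => /andP[y0 _].
  by have [] := df y y0.
rewrite in_itv /= f0 !subr0 => /andP[c0 _] ->.
by rewrite mulr_ge0//; [apply: g0|]; exact: ltW.
Qed.

Lemma mean_value_bound f g x s (M : R) :
  (forall y : R, `|y - x| <= `|s| -> is_derive y 1 f (g y) /\ `|g y| <= M) ->
  `|f (x + s) - f x| <= M * `|s|.
Proof.
move=> H; have [s0|s0|->] := ltgtP s 0; last by rewrite addr0 subrr !normr0 mulr0.
- have near_x y : x + s <= y -> y <= x -> `|y - x| <= `|s|.
    by move=> ? ?; rewrite (ltr0_norm s0) ler_norml; apply/andP; split; lra.
  have [|||c] := @MVT R f g (x + s) x.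
  + by rewrite gtrDl.
  + move=> y; rewrite in_itv /= => /andP[y0 y1]; apply: (H y _).1.
    by apply: near_x; exact: ltW.
  + apply: derivable_within_continuous => y; rewrite in_itv /= => /andP[y0 y1].
    by have [|[]] := H y; first exact: near_x.
  + rewrite in_itv /= => /andP[c0 c1]; rewrite distrC => ->.
    rewrite normrM opprD addNKr normrN ler_wpM2r// (H c _).2//.
    by apply: near_x; exact: ltW.
- have near_x y : x <= y -> y <= x + s -> `|y - x| <= `|s|.
    by move=> ? ?; rewrite (gtr0_norm s0) ler_norml; apply/andP; split; lra.
  have [|||c] := @MVT R f g x (x + s).
  + by rewrite ltrDl.
  + move=> y; rewrite in_itv /= => /andP[y0 y1]; apply: (H y _).1.
    by apply: near_x; exact: ltW.
  + apply: derivable_within_continuous => y; rewrite in_itv /= => /andP[y0 y1].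
    by have [|[]] := H y; first exact: near_x.
  + rewrite in_itv /= => /andP[c0 c1] ->.
    rewrite normrM addrAC subrr add0r ler_wpM2r// (H c _).2//.
    by apply: near_x; exact: ltW.
Qed.

Lemma near0_norm_lt (r : R) : 0 < r -> \forall s \near (0 : R), `|s| < r.
Proof.
move=> r0; apply/nbhs_ballP; exists r => // s.
by rewrite -ball_normE /ball_ /= sub0r normrN.
Qed.

Lemma near0_ex (P : set R) : (\forall s \near (0 : R), P s) ->
  exists2 r : R, 0 < r & forall s, `|s| < r -> P s.
Proof.
move=> /nbhs_ballP[r /= r0 H]; exists r => // s sr; apply: H.
by rewrite -ball_normE /ball_ /= sub0r normrN.
Qed.

(** [f] has the second-order Taylor polynomial [f x + a * s + b / 2 * s ^+ 2]. *)
Definition peano2 f x a b : Prop := forall e : R, 0 < e ->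
  \forall s \near (0 : R),
    `|f (x + s) - f x - a * s - b / 2 * s ^+ 2| <= e * s ^+ 2.

(** Subtracting the quadratic polynomial from [f] leaves a function with derivative
    [g y - g x - b * (y - x)], which is [o(s)] for [|y - x| <= |s|]; the mean value bound then gives
    [o(s ^+ 2)]. *)
Lemma peano2_der f g x b : (\forall y \near x, is_derive (y : R) 1 f (g y)) ->
  is_derive x 1 g b -> peano2 f x (g x) b.
Proof.
move=> df dg e e0.
have dgx : \forall h \near (0 : R), h != 0 ->
    `|b - h^-1 * (g (x + h) - g x)| <= e.
  have /cvgrPdist_le /(_ e e0) := der_quot dg.
  by rewrite near_withinE.
have /nbhs_ballP[r /= r0 hr] : \forall h \near (0 : R),
    is_derive (x + h) 1 f (g (x + h)) /\ `|g (x + h) - g x - b * h| <= e * `|h|.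
  near=> h; split.
    near: h; have : (fun h : R => x + h) @ 0 --> x.
      by rewrite -[X in _ --> X]addr0; apply: cvgD; [exact: cvg_cst|exact: cvg_id].
    by move=> H; exact: (H _ df).
  have [->|h0] := eqVneq h 0.
    by rewrite addr0 subrr sub0r mulr0 oppr0 normr0 mulr0.
  have -> : g (x + h) - g x - b * h = (h^-1 * (g (x + h) - g x) - b) * h by field.
  by rewrite normrM ler_wpM2r// distrC; move: h0; near: h.
near=> s.
have sr : `|s| < r by near: s; exact: near0_norm_lt.
pose F y := f y + (- g x) * (y - x) + (- (b / 2)) * (y - x) ^+ 2.
have -> : f (x + s) - f x - g x * s - b / 2 * s ^+ 2 = F (x + s) - F x.
  by rewrite /F; field.
have -> : e * s ^+ 2 = e * `|s| * `|s|.
  by rewrite -mulrA -normrM -expr2 ger0_norm ?sqr_ge0.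
apply: (@mean_value_bound F (fun y => g y - g x - b * (y - x))).
move=> y ys; have [] := hr (y - x).
  by rewrite -ball_normE /ball_ /= sub0r normrN (le_lt_trans ys).
rewrite addrC subrK => dfy gy; split.
  by rewrite /F; apply: der_eq; rewrite /GRing.scale /=; field.
by apply: le_trans gy _; rewrite ler_wpM2l// ltW.
Unshelve. all: by end_near. Qed.

End Derivatives.

(** * Calculus of second-order expansions *)

Section Peano.
Context {R : realType}.
Implicit Types (f g : R -> R) (x a b : R).

Lemma mul_div_succ_le (k e c : R) : 0 <= k -> 0 <= e -> 0 < c ->
  k * (e / (c * (k + 1))) <= e / c.
Proof.
move=> k0 e0 c0; have k1 : 0 < k + 1 by rewrite ltr_wpDl.
have -> : k * (e / (c * (k + 1))) = e / c * (k / (k + 1)).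
  by field; rewrite !gt_eqF.
by rewrite ler_piMr ?divr_ge0 ?(ltW c0)// ler_pdivrMr// mul1r lerDl.
Qed.

Lemma norm_half_sqr (b s : R) : `|b / 2 * s ^+ 2| = `|b| / 2 * s ^+ 2.
Proof. by rewrite normrM (ger0_norm (sqr_ge0 s)) normrM normfV (@gtr0_norm _ 2). Qed.

Lemma peano2D f g x a b a' b' : peano2 f x a b -> peano2 g x a' b' ->
  peano2 (fun y => f y + g y) x (a + a') (b + b').
Proof.
move=> fP gP e e0; have e20 : 0 < e / 2 by lra.
move: (fP _ e20) (gP _ e20); apply: filterS2 => s fs gs.
have -> : f (x + s) + g (x + s) - (f x + g x) - (a + a') * s
    - (b + b') / 2 * s ^+ 2 =
  (f (x + s) - f x - a * s - b / 2 * s ^+ 2) +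
  (g (x + s) - g x - a' * s - b' / 2 * s ^+ 2) by field.
by apply: le_trans (ler_normD _ _) _; rewrite (splitr e) mulrDl lerD.
Qed.

Lemma peano2Z k f x a b : peano2 f x a b ->
  peano2 (fun y => k * f y) x (k * a) (k * b).
Proof.
move=> fP e e0; have k0 : 0 < `|k| + 1 by rewrite ltr_pwDr.
have ek0 : 0 < e / (`|k| + 1) by rewrite divr_gt0.
move: (fP _ ek0); apply: filterS => s fs.
have -> : k * f (x + s) - k * f x - k * a * s - k * b / 2 * s ^+ 2 =
  k * (f (x + s) - f x - a * s - b / 2 * s ^+ 2) by field.
rewrite normrM; apply: le_trans (ler_wpM2l (normr_ge0 _) fs) _.
rewrite mulrA ler_wpM2r ?sqr_ge0// mulrCA ger_pMr//.
by rewrite ler_pdivrMr// mul1r lerDl.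
Qed.

Lemma peano2_affine x (p q : R) : peano2 (fun y => p + q * y) x q 0.
Proof.
move=> e e0; near=> s.
have -> : p + q * (x + s) - (p + q * x) - q * s - 0 / 2 * s ^+ 2 = 0 by ring.
by rewrite normr0 mulr_ge0 ?sqr_ge0 ?ltW.
Unshelve. all: by end_near. Qed.

Lemma peano2_max f x a b : peano2 f x a b ->
  (\forall s \near (0 : R), f (x + s) <= f x) -> a = 0 /\ b <= 0.
Proof.
move=> fP fmax.
have bound (e : R) : 0 < e -> exists2 r : R, 0 < r &
    forall s : R, `|s| < r -> a * s <= (e - b / 2) * s ^+ 2.
  move=> e0; have [r r0 H] := near0_ex (filterI (fP _ e0) fmax).
  exists r => // s /H[fs fxs].
  by move: fs; rewrite ler_norml => /andP[+ _]; lra.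
have a0 : a = 0.
  have [r r0 H] := bound 1 ltr01; set K : R := `|1 - b / 2| + 1.
  have K0 : 0 < K by rewrite ltr_pwDr.
  have HK s : `|s| < r -> a * s <= K * s ^+ 2.
    move=> /H /le_trans; apply; rewrite ler_wpM2r ?sqr_ge0//.
    by rewrite (le_trans (ler_norm _))// lerDl.
  apply/eqP/negP => /negP an0.
  (* At [s = Num.sg a * t] the linear term is [|a| * t], while the quadratic one is at most
     [|a| * t / 2]. *)
  pose t := Num.min (r / 2) (`|a| / (2 * K)).
  have t0 : 0 < t by rewrite lt_min !divr_gt0 ?mulr_gt0// normr_gt0.
  have tr : t < r by rewrite gt_min; apply/orP; left; lra.
  have tK : K * t <= `|a| / 2.
    have : t <= `|a| / (2 * K) by rewrite ge_min lexx orbT.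
    by rewrite ler_pdivlMr ?mulr_gt0//; lra.
  have := HK (Num.sg a * t); rewrite normrM normr_sg an0 mul1r gtr0_norm// => /(_ tr).
  rewrite mulrA [a * _]mulrC -normrEsg exprMn sqr_sg an0 mul1r expr2 mulrA.
  rewrite ler_pM2r// => aK; have := le_trans aK tK.
  have : 0 < `|a| by rewrite normr_gt0.
  lra.
split=> //; apply/ler_addgt0Pr => e e0.
have [r r0 H] := bound (e / 2) ltac:(lra).
have := H (r / 2); rewrite a0 mul0r gtr0_norm; last lra.
move=> /(_ _)/wrap[|]; first lra.
rewrite pmulr_lge0 ?exprn_gt0; lra.
Qed.

Lemma peano2_lipschitz g x a b : peano2 g x a b ->
  \forall s \near (0 : R),
    `|g (x + s) - g x| <= (`|a| + `|b| / 2 + 1) * `|s|.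
Proof.
move=> gP; near=> s; have s1 : `|s| <= 1.
  by apply: ltW; near: s; exact: near0_norm_lt.
have H : `|g (x + s) - g x - a * s - b / 2 * s ^+ 2| <= 1 * s ^+ 2.
  by near: s; exact: gP.
have -> : g (x + s) - g x =
  (g (x + s) - g x - a * s - b / 2 * s ^+ 2) + a * s + b / 2 * s ^+ 2 by ring.
have s2 : s ^+ 2 <= `|s| by rewrite -real_normK ?num_real// expr2 ler_piMl.
apply: le_trans (ler_normD _ _) _; rewrite mulrDl mulrDl [leRHS]addrAC.
rewrite norm_half_sqr.
apply: lerD; last by rewrite ler_wpM2l// divr_ge0.
apply: le_trans (ler_normD _ _) _; rewrite normrM [leRHS]addrC lerD2r.
by rewrite (le_trans H)// !mul1r.
Unshelve. all: by end_near. Qed.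

(** With [h = g (x + s) - g x], the error splits into the remainder of [F] at [h], [F1] times the
    remainder of [g], and [F2 / 2 * (h ^+ 2 - a ^+ 2 * s ^+ 2)]; each part receives a third of
    [e]. *)
Lemma peano2_comp (F g : R -> R) x F1 F2 a b :
  peano2 F (g x) F1 F2 -> peano2 g x a b ->
  peano2 (fun y => F (g y)) x (F1 * a) (F2 * a ^+ 2 + F1 * b).
Proof.
move=> FP gP e e0; pose K := `|a| + `|b| / 2 + 1.
have K0 : 0 < K by rewrite ltr_pwDr// addr_ge0// divr_ge0.
pose e1 := e / (3 * (`|F1| + 1)).
have e10 : 0 < e1 by rewrite divr_gt0// mulr_gt0// ltr_pwDr.
pose e2 := e / (3 * K ^+ 2).
have e20 : 0 < e2 by rewrite divr_gt0// mulr_gt0// exprn_gt0.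
have [r r0 Fr] := near0_ex (FP _ e20).
pose L := `|F2| / 2 * (`|b| / 2 + 1) * (2 * K) + 1.
have L0 : 0 < L.
  by rewrite ltr_pwDr// !mulr_ge0// ?ltW// addr_ge0// divr_ge0.
near=> s.
have gs : `|g (x + s) - g x| <= K * `|s| by near: s; exact: peano2_lipschitz.
have sr : `|s| < r / K by near: s; apply: near0_norm_lt; rewrite divr_gt0.
have sL : `|s| < e / (3 * L).
  by near: s; apply: near0_norm_lt; rewrite divr_gt0// mulr_gt0.
have g1 : `|g (x + s) - g x - a * s - b / 2 * s ^+ 2| <= 1 * s ^+ 2.
  by near: s; exact: gP.
have ge1 : `|g (x + s) - g x - a * s - b / 2 * s ^+ 2| <= e1 * s ^+ 2.
  by near: s; exact: gP.
set h := g (x + s) - g x in gs g1 ge1 *.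
have := Fr h; rewrite [g x + h]addrC subrK => /(_ _)/wrap[|Fh].
  by rewrite (le_lt_trans gs)// mulrC -ltr_pdivlMr.
have -> : F (g (x + s)) - F (g x) - F1 * a * s -
    (F2 * a ^+ 2 + F1 * b) / 2 * s ^+ 2 =
  (F (g (x + s)) - F (g x) - F1 * h - F2 / 2 * h ^+ 2) +
  F1 * (h - a * s - b / 2 * s ^+ 2) +
  F2 / 2 * ((h - a * s) * (h + a * s)) by field.
have s20 : 0 <= s ^+ 2 := sqr_ge0 s.
have -> : e * s ^+ 2 = e / 3 * s ^+ 2 + e / 3 * s ^+ 2 + e / 3 * s ^+ 2 by field.
apply: le_trans (ler_normD _ _) _; apply: lerD.
  apply: le_trans (ler_normD _ _) _; apply: lerD.
    apply: (le_trans Fh); have -> : e / 3 * s ^+ 2 = e2 * (K * `|s|) ^+ 2.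
      by rewrite exprMn real_normK ?num_real// /e2; field; rewrite gt_eqF.
    rewrite ler_pM2l// -[h ^+ 2]real_normK ?num_real//.
    by rewrite ler_sqr ?nnegrE// mulr_ge0// ltW.
  rewrite normrM; apply: le_trans (ler_wpM2l (normr_ge0 _) ge1) _.
  by rewrite mulrA ler_wpM2r// mul_div_succ_le// ltW.
rewrite !normrM.
have h1 : `|h - a * s| <= (`|b| / 2 + 1) * s ^+ 2.
  have -> : h - a * s = (h - a * s - b / 2 * s ^+ 2) + b / 2 * s ^+ 2 by ring.
  apply: le_trans (ler_normD _ _) _; rewrite mulrDl addrC lerD//.
  by rewrite norm_half_sqr.
have h2 : `|h + a * s| <= 2 * K * `|s|.
  apply: le_trans (ler_normD _ _) _; rewrite normrM.
  have : `|a| * `|s| <= K * `|s|.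
    by rewrite ler_wpM2r// /K -addrA lerDl addr_ge0// divr_ge0.
  lra.
have -> : `|F2| * `|2^-1| = `|F2| / 2 by rewrite normfV [ `|2|]gtr0_norm.
apply: (@le_trans _ _ (`|F2| / 2 * ((`|b| / 2 + 1) * s ^+ 2 * (2 * K * `|s|)))).
  by rewrite ler_wpM2l ?divr_ge0// ler_pM.
have -> : `|F2| / 2 * ((`|b| / 2 + 1) * s ^+ 2 * (2 * K * `|s|)) =
  (L - 1) * `|s| * s ^+ 2 by rewrite /L; ring.
rewrite ler_wpM2r//; apply: (@le_trans _ _ (L * `|s|)).
  by rewrite ler_wpM2r// gerDl.
by rewrite mulrC -ler_pdivlMr// -mulrA -invfM ltW.
Unshelve. all: by end_near. Qed.

(** Made for the pole of the kernel. At a minimum of [g] the increment of [g] is nonnegative and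
    [O(s ^+ 2)], so a one-sided first-order expansion of [F] already yields a second-order one of
    the composite. *)
Lemma peano2_comp_right (F g : R -> R) x F1 b :
  (forall e : R, 0 < e -> \forall h \near (0 : R), 0 <= h ->
    `|F (g x + h) - F (g x) - F1 * h| <= e * h) ->
  (forall y, g x <= g y) -> peano2 g x 0 b ->
  peano2 (fun y => F (g y)) x 0 (F1 * b).
Proof.
move=> FP gmin gP e e0; pose K := `|b| / 2 + 1.
have K0 : 0 < K by rewrite ltr_pwDr// divr_ge0.
pose e1 := e / (2 * (`|F1| + 1)).
have e10 : 0 < e1 by rewrite divr_gt0// mulr_gt0// ltr_pwDr.
pose e2 := e / (2 * K).
have e20 : 0 < e2 by rewrite divr_gt0// mulr_gt0.
have [r r0 Fr] := near0_ex (FP _ e20).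
near=> s.
have s1 : `|s| <= 1.
  by apply: ltW; near: s; exact: near0_norm_lt.
have sr : `|s| < r / K by near: s; apply: near0_norm_lt; rewrite divr_gt0.
have g1 : `|g (x + s) - g x - 0 * s - b / 2 * s ^+ 2| <= 1 * s ^+ 2.
  by near: s; exact: gP.
have ge1 : `|g (x + s) - g x - 0 * s - b / 2 * s ^+ 2| <= e1 * s ^+ 2.
  by near: s; exact: gP.
have h0 : 0 <= g (x + s) - g x by rewrite subr_ge0.
set h := g (x + s) - g x in g1 ge1 h0 *.
have s20 : 0 <= s ^+ 2 := sqr_ge0 s.
have hK : h <= K * s ^+ 2.
  move: g1; rewrite ler_norml => /andP[_]; rewrite mul0r subr0 mul1r lerBlDr.
  move=> /le_trans; apply; rewrite /K mulrDl mul1r addrC lerD2r ler_wpM2r//.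
  by rewrite ler_wpM2r ?invr_ge0// ler_norm.
have s2 : s ^+ 2 <= `|s| by rewrite -real_normK ?num_real// expr2 ler_piMl.
have := Fr h; rewrite [g x + h]addrC subrK => /(_ _ h0)/wrap[|Fh].
  rewrite ger0_norm// (le_lt_trans hK)// mulrC -ltr_pdivlMr//.
  exact: le_lt_trans sr.
have -> : F (g (x + s)) - F (g x) - 0 * s - F1 * b / 2 * s ^+ 2 =
  (F (g (x + s)) - F (g x) - F1 * h) +
  F1 * (h - 0 * s - b / 2 * s ^+ 2) by field.
rewrite (splitr e) mulrDl; apply: le_trans (ler_normD _ _) _; apply: lerD.
  apply: (le_trans Fh); have -> : e / 2 * s ^+ 2 = e2 * (K * s ^+ 2).
    by rewrite /e2; field; rewrite gt_eqF.
  by rewrite ler_pM2l.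
rewrite normrM; apply: le_trans (ler_wpM2l (normr_ge0 _) ge1) _.
by rewrite mulrA ler_wpM2r// mul_div_succ_le// ltW.
Unshelve. all: by end_near. Qed.

End Peano.

(** * The Laplacian in the chart *)

Section Geometry.
Context {R : realType}.
Implicit Types (z w d : H3 R) (f : H3 R -> R).

Definition chp z w : R := height z * height w - dotp z w.

Lemma dotp3 z w : dotp z w =
  z 0 0 * w 0 0 + z 0 1 * w 0 1 + z 0 (inord 2) * w 0 (inord 2).
Proof.
rewrite /dotp !big_ord_recl big_ord0 addr0 addrA.
by congr (_ * _ + _ * _ + _ * _); congr (_ _ _); apply/val_inj; rewrite /= ?inordK.
Qed.

Lemma dotp_ge0 z : 0 <= dotp z z.
Proof. by apply: sumr_ge0 => i _; rewrite -expr2 sqr_ge0. Qed.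

Lemma dotpC z w : dotp z w = dotp w z.
Proof. by apply: eq_bigr => i _; rewrite mulrC. Qed.

Lemma dotpDl z z' w : dotp (z + z') w = dotp z w + dotp z' w.
Proof. by rewrite /dotp -big_split; apply: eq_bigr => i _; rewrite mxE mulrDl. Qed.

Lemma dotpZl s z w : dotp (s *: z) w = s * dotp z w.
Proof. by rewrite /dotp mulr_sumr; apply: eq_bigr => i _; rewrite mxE mulrA. Qed.

Lemma dotpDr z w w' : dotp z (w + w') = dotp z w + dotp z w'.
Proof. by rewrite !(dotpC z) dotpDl. Qed.

Lemma dotpZr s z w : dotp z (s *: w) = s * dotp z w.
Proof. by rewrite !(dotpC z) dotpZl. Qed.

Lemma dotp0l w : dotp 0 w = 0.
Proof. by rewrite -(scale0r w) dotpZl mul0r. Qed.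

Lemma dotp_delta i z : dotp (delta_mx 0 i) z = z 0 i.
Proof.
rewrite /dotp (bigD1 i)//= big1 ?addr0; first by rewrite mxE !eqxx mul1r.
by move=> j ji; rewrite mxE (negbTE ji) andbF mul0r.
Qed.

Lemma sqr_height z : height z ^+ 2 = 1 + dotp z z.
Proof. by rewrite sqr_sqrtr// addr_ge0 ?dotp_ge0. Qed.

Lemma height_ge1 z : 1 <= height z.
Proof. by rewrite -[leLHS]sqrtr1 ler_sqrt ?lerDl ?dotp_ge0// addr_ge0 ?dotp_ge0. Qed.

Lemma height_gt0 z : 0 < height z.
Proof. exact: lt_le_trans (height_ge1 z). Qed.

Lemma height_neq0 z : height z != 0.
Proof. by rewrite gt_eqF// height_gt0. Qed.

Lemma height0 : height (0 : H3 R) = 1.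
Proof. by rewrite /height dotp0l addr0 sqrtr1. Qed.

Lemma chp0 z : chp z 0 = height z.
Proof. by rewrite /chp height0 mulr1 dotpC dotp0l subr0. Qed.

Lemma chpC z w : chp z w = chp w z.
Proof. by rewrite /chp mulrC dotpC. Qed.

Lemma cauchy_schwarz z w : dotp z w ^+ 2 <= dotp z z * dotp w w.
Proof.
rewrite !dotp3; set a1 := z 0 0; set a2 := z 0 1; set a3 := z 0 _.
set b1 := w 0 0; set b2 := w 0 1; set b3 := w 0 _.
have := sqr_ge0 (a1 * b2 - a2 * b1).
have := sqr_ge0 (a1 * b3 - a3 * b1).
have := sqr_ge0 (a2 * b3 - a3 * b2).
nra.
Qed.

(** Reversed Cauchy-Schwarz on the hyperboloid: [(height z * height w) ^+ 2 - (1 + dotp z w) ^+ 2]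
    is the squared Euclidean norm of [z - w] plus the defect in [cauchy_schwarz]. *)
Lemma chp_ge1 z w : 1 <= chp z w.
Proof.
rewrite /chp lerBrDr.
have [|w0] := leP (1 + dotp z w) 0.
  by move=> /le_trans; apply; rewrite mulr_ge0// ltW// height_gt0.
rewrite -ler_sqr ?nnegrE; [|exact: ltW|by rewrite mulr_ge0// ltW// height_gt0].
rewrite exprMn !sqr_height.
have := cauchy_schwarz z w.
have : 0 <= dotp (z + -1 *: w) (z + -1 *: w) by exact: dotp_ge0.
rewrite !(dotpDl, dotpDr, dotpZl, dotpZr) [dotp w z]dotpC.
nra.
Qed.

Lemma sqr_height_line z d s :
  1 + dotp (z + s *: d) (z + s *: d) =
  1 + (dotp z z + 2 * dotp z d * s + dotp d d * s ^+ 2).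
Proof.
by rewrite !(dotpDl, dotpDr, dotpZl, dotpZr) [dotp d z]dotpC; ring.
Qed.

Lemma der_height z d (s : R) : is_derive s 1 (fun s => height (z + s *: d))
  ((dotp z d + dotp d d * s) / height (z + s *: d)).
Proof.
rewrite /height; under eq_fun do rewrite sqr_height_line.
have A0 (u : R) : 0 < 1 + (dotp z z + 2 * dotp z d * u + dotp d d * u ^+ 2).
  by rewrite -sqr_height_line ltr_pwDl// dotp_ge0.
rewrite sqr_height_line; apply: der_eq; first exact: der_sqrt.
by rewrite /GRing.scale /=; field; rewrite gt_eqF// sqrtr_gt0.
Qed.

Lemma peano2_height z d : peano2 (fun s => height (z + s *: d)) 0
  (dotp z d / height z) (dotp d d / height z - (dotp z d) ^+ 2 / height z ^+ 3).
Proof.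
pose g s := (dotp z d + dotp d d * s) / height (z + s *: d).
have -> : dotp z d / height z = g 0 by rewrite /g mulr0 scale0r !addr0.
apply: peano2_der; first by near=> s; exact: der_height.
rewrite /g; apply: der_eq.
  apply: derM; last by apply: derV (der_height _ _ _); exact: height_neq0.
by rewrite /= scale0r addr0 /GRing.scale /=; field; exact: height_neq0.
Unshelve. all: by end_near. Qed.

Definition chp1 w z d := height w * (dotp z d / height z) - dotp d w.

Definition chp2 w z d :=
  height w * (dotp d d / height z - (dotp z d) ^+ 2 / height z ^+ 3).

Lemma peano2_chp w z d :
  peano2 (fun s => chp (z + s *: d) w) 0 (chp1 w z d) (chp2 w z d).
Proof.
have -> : (fun s => chp (z + s *: d) w) = (fun s =>
    height w * height (z + s *: d) + (- dotp z w + (- dotp d w) * s)).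
  by apply/funext => s; rewrite /chp dotpDl dotpZl; ring.
rewrite /chp2 -[X in peano2 _ _ _ X]addr0.
by apply: peano2D; [exact/peano2Z/peano2_height|exact: peano2_affine].
Qed.

(** [lap_at f z l]: along every line through [z], [f] has a second-order Taylor
    polynomial, and the coefficients combine to the value [l] of [div grad f] at
    [z]; in the chart,
    [div grad f = \sum_i d_i d_i f + \sum_(i, j) z_i z_j d_i d_j f
                  + 3 \sum_i z_i d_i f]. *)
Definition lap_at f z (l : R) := exists a b : H3 R -> R,
  (forall d, peano2 (fun s => f (z + s *: d)) 0 (a d) (b d)) /\
  l = \sum_(i < 3) b (delta_mx 0 i) + b z + 3 * a z.

Lemma lap_atD f g z l m : lap_at f z l -> lap_at g z m ->
  lap_at (fun y => f y + g y) z (l + m).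
Proof.
move=> [a [b [fP ->]]] [a' [b' [gP ->]]].
exists (fun d => a d + a' d), (fun d => b d + b' d); split.
  by move=> d; exact: peano2D.
by rewrite big_split /=; ring.
Qed.

Lemma lap_atZ k f z l : lap_at f z l -> lap_at (fun y => k * f y) z (k * l).
Proof.
move=> [a [b [fP ->]]].
exists (fun d => k * a d), (fun d => k * b d); split.
  by move=> d; exact: peano2Z.
by rewrite -mulr_sumr; ring.
Qed.

Lemma lap_at_cst k z : lap_at (fun=> k) z 0.
Proof.
exists (fun=> 0), (fun=> 0); split; last by rewrite big1// mulr0 !addr0.
by move=> d; have := @peano2_affine R 0 k 0; under eq_fun do rewrite mul0r addr0.
Qed.

Lemma lap_at_sum (I : Type) (r : seq I) (F : I -> H3 R -> R) z (l : I -> R) :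
  (forall i, lap_at (F i) z (l i)) ->
  lap_at (fun y => \sum_(i <- r) F i y) z (\sum_(i <- r) l i).
Proof.
move=> H; elim: r => [|i r IH].
  rewrite big_nil; under eq_fun do rewrite big_nil; exact: lap_at_cst.
by rewrite big_cons; under eq_fun do rewrite big_cons; exact: lap_atD.
Qed.

(** [chp] is linear in the Minkowski coordinates of [z], which are eigenfunctions of [div grad] on
    the hyperboloid. *)
Lemma chp2_sum w z :
  \sum_(i < 3) chp2 w z (delta_mx 0 i) + chp2 w z z + 3 * chp1 w z z =
  3 * chp z w.
Proof.
rewrite /chp1 /chp2 /chp !big_ord_recl big_ord0 !dotp_delta.
rewrite !(dotpC z (delta_mx _ _)) !dotp_delta !mxE !eqxx /=.
have : height z ^+ 2 = 1 + (z 0 ord0 * z 0 ord0 +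
    (z 0 (lift ord0 ord0) * z 0 (lift ord0 ord0) +
     (z 0 (lift ord0 (lift ord0 ord0)) * z 0 (lift ord0 (lift ord0 ord0)) + 0))).
  by rewrite sqr_height /dotp !big_ord_recl big_ord0.
have -> : dotp z z = height z ^+ 2 - 1 by rewrite sqr_height; ring.
move: (height_neq0 z); move: (height z) (height w) (dotp z w) => h hw p.
move: (z 0 _) (z 0 _) (z 0 _) => x3 x2 x1 h0 hE.
have -> : x3 ^+ 2 = h ^+ 2 - 1 - x1 ^+ 2 - x2 ^+ 2 by rewrite hE; ring.
by field.
Qed.

(** The left side is the squared gradient of [chp] for the inverse metric; the right side is the
    squared hyperbolic sine of the distance, as the distance has unit gradient. *)
Lemma chp1_sum w z :
  \sum_(i < 3) chp1 w z (delta_mx 0 i) ^+ 2 + chp1 w z z ^+ 2 =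
  chp z w ^+ 2 - 1.
Proof.
rewrite /chp1 /chp !big_ord_recl big_ord0 !dotp_delta.
rewrite !(dotpC z (delta_mx _ _)) !dotp_delta.
have : height z ^+ 2 = 1 + (z 0 ord0 * z 0 ord0 +
    (z 0 (lift ord0 ord0) * z 0 (lift ord0 ord0) +
     (z 0 (lift ord0 (lift ord0 ord0)) * z 0 (lift ord0 (lift ord0 ord0)) + 0))).
  by rewrite sqr_height /dotp !big_ord_recl big_ord0.
have : height w ^+ 2 = 1 + (w 0 ord0 * w 0 ord0 +
    (w 0 (lift ord0 ord0) * w 0 (lift ord0 ord0) +
     (w 0 (lift ord0 (lift ord0 ord0)) * w 0 (lift ord0 (lift ord0 ord0)) + 0))).
  by rewrite sqr_height /dotp !big_ord_recl big_ord0.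
have -> : dotp z z = height z ^+ 2 - 1 by rewrite sqr_height; ring.
have -> : dotp z w = z 0 ord0 * w 0 ord0 +
    (z 0 (lift ord0 ord0) * w 0 (lift ord0 ord0) +
     (z 0 (lift ord0 (lift ord0 ord0)) * w 0 (lift ord0 (lift ord0 ord0)) + 0)).
  by rewrite /dotp !big_ord_recl big_ord0.
move: (height_neq0 z); move: (height z) (height w) => h hw.
move: (z 0 _) (z 0 _) (z 0 _) (w 0 _) (w 0 _) (w 0 _).
move=> x3 x2 x1 y3 y2 y1 h0 hwE hE.
set p := x1 * y1 + _.
have -> : (hw * (x1 / h) - y1) ^+ 2 +
    ((hw * (x2 / h) - y2) ^+ 2 + ((hw * (x3 / h) - y3) ^+ 2 + 0)) =
  (hw / h) ^+ 2 * (x1 * x1 + (x2 * x2 + (x3 * x3 + 0))) - 2 * (hw / h) * p +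
  (y1 * y1 + (y2 * y2 + (y3 * y3 + 0))) by rewrite /p; field.
have -> : x1 * x1 + (x2 * x2 + (x3 * x3 + 0)) = h ^+ 2 - 1 by rewrite hE; ring.
have -> : y1 * y1 + (y2 * y2 + (y3 * y3 + 0)) = hw ^+ 2 - 1 by rewrite hwE; ring.
by field.
Qed.

Lemma lap_at_radial (F : R -> R) w z F1 F2 : peano2 F (chp z w) F1 F2 ->
  lap_at (fun y => F (chp y w)) z
    ((chp z w ^+ 2 - 1) * F2 + 3 * chp z w * F1).
Proof.
move=> FP; exists (fun d => F1 * chp1 w z d),
  (fun d => F2 * chp1 w z d ^+ 2 + F1 * chp2 w z d); split.
  move=> d; apply: (peano2_comp (g := fun s => chp (z + s *: d) w)).
    by rewrite scale0r addr0.
  exact: peano2_chp.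
have -> : \sum_(i < 3) (F2 * chp1 w z (delta_mx 0 i) ^+ 2 +
    F1 * chp2 w z (delta_mx 0 i)) =
  F2 * \sum_(i < 3) chp1 w z (delta_mx 0 i) ^+ 2 +
  F1 * \sum_(i < 3) chp2 w z (delta_mx 0 i).
  by rewrite big_split /= !mulr_sumr.
by rewrite -chp1_sum -chp2_sum; ring.
Qed.

(** At the pole [chp] has its minimum 1, so its first-order coefficients vanish and the second-order
    term of [F] drops out of the radial formula. Only values of [F] to the right of 1 are
    involved. *)
Lemma lap_at_radial_center (F : R -> R) w z F1 : chp z w = 1 ->
  (forall e : R, 0 < e -> \forall h \near (0 : R), 0 <= h ->
    `|F (1 + h) - F 1 - F1 * h| <= e * h) ->
  lap_at (fun y => F (chp y w)) z (3 * F1).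
Proof.
move=> c1 FP.
have g0 d : chp1 w z d = 0.
  have /(peano2Z (-1)) /peano2_max := peano2_chp w z d => -[].
    near=> s; rewrite !mulN1r lerN2 scale0r addr0 c1; exact: chp_ge1.
  lra.
exists (fun=> 0), (fun d => F1 * chp2 w z d); split.
  move=> d; apply: (peano2_comp_right (g := fun s => chp (z + s *: d) w)).
  - by rewrite scale0r addr0 c1.
  - by move=> y; rewrite scale0r addr0 c1 chp_ge1.
  - by have := peano2_chp w z d; rewrite g0.
have := chp2_sum w z; rewrite c1 g0 !mulr0 mulr1 addr0 => <-.
have -> : \sum_(i < 3) F1 * chp2 w z (delta_mx 0 i) =
  F1 * \sum_(i < 3) chp2 w z (delta_mx 0 i) by rewrite mulr_sumr.
ring.
Unshelve. all: by end_near. Qed.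

Lemma lap_at_height z : lap_at (@height R) z (3 * height z).
Proof.
have := @lap_at_radial id 0 z 1 0.
under [X in lap_at X]eq_fun do rewrite chp0.
rewrite chp0 mulr0 add0r mulr1; apply.
by have := @peano2_affine R (height z) 0 1; under eq_fun do rewrite add0r mul1r.
Qed.

(** This is where ellipticity enters: at a maximum the first-order coefficients vanish, and the
    second-order ones, all at most 0, are added with weight 1. *)
Lemma lap_at_max f z l : lap_at f z l ->
  (forall d, \forall s \near (0 : R), f (z + s *: d) <= f z) -> l <= 0.
Proof.
move=> [a [b [fP ->]]] fmax.
have H d : a d = 0 /\ b d <= 0.
  apply: peano2_max (fP d) _; move: (fmax d); apply: filterS => s.
  by rewrite add0r scale0r addr0.
rewrite (H z).1 mulr0 addr0 -oppr_ge0 opprD addr_ge0 ?oppr_ge0 ?(H z).2//.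
by apply: sumr_le0 => i _; exact: (H _).2.
Qed.

End Geometry.

(** * Agreement of the chart formula with the defined Laplacian *)

Section Laplacian.
Context {R : realType}.
Implicit Types (z w d : H3 R) (f : H3 R -> R).

Lemma mul_tr_row z : z *m z^T = (dotp z z)%:M.
Proof.
apply/matrixP => i j; rewrite !ord1 !mxE eqxx mulr1n; apply: eq_bigr => k _.
by rewrite mxE.
Qed.

(** The Sherman-Morrison formula for a rank-one perturbation of the identity, with
    [dotp z z = height z ^+ 2 - 1]. *)
Lemma invmx_metric z : invmx (metric z) = 1%:M + z^T *m z.
Proof.
have H : metric z *m (1%:M + z^T *m z) = 1%:M.
  rewrite /metric mulmxDr mulmx1 mulmxBl mul1mx -scalemxAl mulmxA.
  rewrite -[z^T *m z *m z^T]mulmxA mul_tr_row mul_mx_scalar.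
  rewrite -scalemxAl scalerA; set m := z^T *m z.
  have -> : dotp z z = height z ^+ 2 - 1 by rewrite sqr_height; ring.
  rewrite mulrBr mulr1 mulVf ?expf_neq0 ?height_neq0// scalerBl scale1r.
  by rewrite opprB [X in _ + X]addrC subrK subrK.
have [m1 m2] := mulmx1_unit H.
by rewrite -[RHS](mulKmx m1) H mulmx1.
Qed.

Lemma det_metric z : \det (metric z) = (height z) ^- 2.
Proof.
pose x n : R := z 0 (inord n).
have xE i : z ord0 i = x (nat_of_ord i) by rewrite /x inord_val.
have hE : height z ^+ 2 = 1 + x 0 ^+ 2 + x 1 ^+ 2 + x 2 ^+ 2.
  by rewrite sqr_height /dotp !big_ord_recl big_ord0 !xE /bump /=; ring.
rewrite /metric (expand_det_row _ ord0) !big_ord_recl big_ord0.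
rewrite /cofactor !(expand_det_row _ ord0) !big_ord_recl !big_ord0 /cofactor.
rewrite !det_mx11 !mxE /= !big_ord_recl !big_ord0 !mxE !xE /bump /=.
move: (height_neq0 z) hE; move: (height z) (x 0) (x 1) (x 2) => h a b c h0 hE.
rewrite !add0n !addn0 !expr0 !expr1 !addn1 -signr_odd /= expr0.
transitivity (1 - h ^- 2 * (a ^+ 2 + b ^+ 2 + c ^+ 2)); first by ring.
have -> : a ^+ 2 + b ^+ 2 + c ^+ 2 = h ^+ 2 - 1 by rewrite hE; ring.
by field.
Qed.

Lemma der_line f z d (s : R) : differentiable f (z + s *: d) ->
  is_derive s 1 (fun s => f (z + s *: d))
    (\sum_(j < 3) d 0 j * partial j f (z + s *: d)).
Proof.
move=> df.
have dl : differentiable (fun s : R => z + s *: d) s by [].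
have l1 : 'D_1 (fun s : R => z + s *: d) s = d.
  have : is_derive s 1 (fun s : R => z + s *: d) (0 + 1 *: d).
    apply: is_deriveD; rewrite scale1r.
    have H : (fun h : R => h^-1 *: ((h *: (1 : R) + s) *: d - s *: d)) @ 0^' --> d.
      apply: cvg_near_cst; near=> h; have h0 : h != 0 by near: h; exact: nbhs_dnbhs_neq.
      by rewrite scalerDl addrK [h%:A]mulr1 scalerA mulVf// scale1r.
    by apply: DeriveDef; [exact: cvgP H|exact: cvg_lim H].
  by move=> H; rewrite derive_val add0r scale1r.
have dfl : differentiable (f \o (fun s : R => z + s *: d)) s.
  exact: differentiable_comp.
apply: DeriveDef; first exact: diff_derivable.
have -> : 'D_1 (f \o (fun s : R => z + s *: d)) s = 'd f (z + s *: d) d.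
  by rewrite deriveE// diff_comp//= -(deriveE _ dl) l1.
move: df; move: (z + s *: d) => y df.
rewrite {1}(row_sum_delta d) linear_sum; apply: eq_bigr => j _.
by rewrite linearZ /= /partial deriveE.
Unshelve. all: by end_near. Qed.

Lemma der_of_line (F : H3 R -> R) z d (l : R) :
  is_derive (0 : R) 1 (fun s : R => F (z + s *: d)) l -> is_derive z d F l.
Proof.
move=> /der_quot H.
have H' : (fun h => h^-1 *: (F (h *: d + z) - F z)) @ 0^' --> l.
  apply: cvg_trans H; apply: near_eq_cvg; near=> h.
  by rewrite add0r scale0r addr0 [z + _]addrC.
by apply: DeriveDef; [exact: cvgP H'|exact: cvg_lim H'].
Unshelve. all: by end_near. Qed.

(** Here [vol_density] is the inverse of [height], the gradient has components [d_i f + z_i * S]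
    with [S = \sum_j z_j d_j f], and the product rule does the rest. The sign is due to the
    convention that [laplacian] is [- div grad]. *)
Lemma lap_at_C2 f z : C2 f -> lap_at f z (- laplacian f z).
Proof.
move=> [f1 f2 f3]; pose P j := partial j f z; pose Q i j := partial i (partial j f) z.
exists (fun d => \sum_(j < 3) d 0 j * P j),
  (fun d => \sum_(j < 3) d 0 j * \sum_(i < 3) d 0 i * Q i j); split.
  move=> d; have := @peano2_der R (fun s => f (z + s *: d))
    (fun s => \sum_(j < 3) d 0 j * partial j f (z + s *: d)) 0.
  rewrite scale0r addr0; apply.
    by near=> s; exact: der_line.
  have H j : is_derive (0 : R) 1 (fun s => d 0 j * partial j f (z + s *: d))
      (d 0 j * \sum_(i < 3) d 0 i * Q i j).
    have := derM (der_cst (d 0 j) (0 : R)) (der_line (f2 j (z + 0 *: d))).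
    by rewrite mul0r add0r scale0r addr0.
  have := is_derive_sum H; rewrite /=.
  have -> : \sum_(i < 3) (fun s => d 0 i * partial i f (z + s *: d)) =
    (fun s => \sum_(j < 3) d 0 j * partial j f (z + s *: d)).
    by apply/funext => s; rewrite fct_sumE.
  by [].
have volE y : vol_density y = (height y)^-1 :> R.
  by rewrite /vol_density det_metric -exprVn sqrtr_sqr ger0_norm// invr_ge0 ltW// height_gt0.
have gradE y i : grad f y 0 i =
    partial i f y + y 0 i * \sum_(j < 3) y 0 j * partial j f y.
  rewrite mxE invmx_metric mulr_sumr -[partial i f y]mul1r.
  rewrite (bigD1 i)//= [in RHS](bigD1 i)//=.
  rewrite !mxE eqxx mulr1n big_ord1 !mxE mulrDl -addrA mulrA; congr (_ + (_ + _)).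
  apply: eq_bigr => j ji; rewrite !mxE eq_sym (negbTE ji) mulr0n add0r.
  by rewrite big_ord1 !mxE mulrA.
pose S := \sum_(j < 3) z 0 j * P j; pose h := height z.
have sum_delta (i : 'I_3) (F : 'I_3 -> R) :
    \sum_(k < 3) (delta_mx 0 i : H3 R) 0 k * F k = F i.
  rewrite (bigD1 i)//= big1 ?addr0; first by rewrite mxE !eqxx mul1r.
  by move=> k ki; rewrite mxE (negbTE ki) andbF mul0r.
(* Product rule along the [i]-th axis; [- h ^- 2 * (z 0 i / h)] is the derivative of the inverse
   height. *)
have divE i : partial i (fun y => vol_density y * grad f y 0 i) z =
    - h ^- 2 * (z 0 i / h) * (P i + z 0 i * S) +
    h^-1 * (Q i i + (S + z 0 i * (P i + \sum_(j < 3) z 0 j * Q i j))).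
  pose e : H3 R := delta_mx 0 i.
  have dP j : is_derive (0 : R) 1 (fun s : R => partial j f (z + s *: e)) (Q i j).
    have := der_line (f2 j (z + 0 *: e)).
    by rewrite sum_delta scale0r addr0.
  have dz j : is_derive (0 : R) 1 (fun s : R => (z + s *: e) 0 j) (e 0 j).
    have -> : (fun s : R => (z + s *: e) 0 j) = (fun s => z 0 j + s * e 0 j).
      by apply/funext => s; rewrite !mxE.
    by apply: der_eq; rewrite /GRing.scale /=; ring.
  have dS : is_derive (0 : R) 1
      (fun s : R => \sum_(j < 3) (z + s *: e) 0 j * partial j f (z + s *: e))
      (P i + \sum_(j < 3) z 0 j * Q i j).
    have -> : P i + \sum_(j < 3) z 0 j * Q i j =
        \sum_(j < 3) (e 0 j * P j + z 0 j * Q i j).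
      by rewrite big_split /= sum_delta.
    have H j : is_derive (0 : R) 1
        (fun s : R => (z + s *: e) 0 j * partial j f (z + s *: e))
        (e 0 j * P j + z 0 j * Q i j).
      by have := derM (dz j) (dP j); rewrite !scale0r !addr0.
    have := is_derive_sum H.
    have -> : \sum_(j < 3) (fun s : R => (z + s *: e) 0 j * partial j f (z + s *: e))
      = (fun s : R => \sum_(j < 3) (z + s *: e) 0 j * partial j f (z + s *: e)).
      by apply/funext => s; rewrite fct_sumE.
    by [].
  suff : is_derive z e (fun y => vol_density y * grad f y 0 i)
    (- h ^- 2 * (z 0 i / h) * (P i + z 0 i * S) +
    h^-1 * (Q i i + (S + z 0 i * (P i + \sum_(j < 3) z 0 j * Q i j)))).
    by move=> [].
  apply: der_of_line; under eq_fun do rewrite volE gradE.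
  have dh := der_height z e 0.
  have hn0 : height (z + 0 *: e) != 0 := height_neq0 _.
  have := derM (derV (f := fun s : R => height (z + s *: e)) hn0 dh) (derD (dP i) (derM (dz i) dS)).
  rewrite !scale0r !addr0 -/S -/h mulr0 addr0 dotpC dotp_delta.
  by rewrite mxE !eqxx mul1r.
rewrite /laplacian opprK /divergence volE invrK.
under eq_bigr do rewrite divE.
have hE : h ^+ 2 = 1 + \sum_(j < 3) z 0 j * z 0 j by exact: sqr_height.
have -> : \sum_(i < 3) \sum_(j < 3) (delta_mx 0 i : H3 R) 0 j *
    (\sum_(k < 3) (delta_mx 0 i : H3 R) 0 k * Q k j) = \sum_(i < 3) Q i i.
  by apply: eq_bigr => i _; rewrite sum_delta sum_delta.
have -> : \sum_(j < 3) z 0 j * (\sum_(i < 3) z 0 i * Q i j) =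
    \sum_(i < 3) z 0 i * (\sum_(j < 3) z 0 j * Q i j).
  transitivity (\sum_(j < 3) \sum_(i < 3) z 0 j * (z 0 i * Q i j)).
    by apply: eq_bigr => j _; rewrite mulr_sumr.
  rewrite exchange_big; apply: eq_bigr => i _; rewrite [RHS]mulr_sumr.
  by apply: eq_bigr => j _; rewrite mulrCA.
have alg (T : R) (x p q W : 'I_3 -> R) : h * \sum_(i < 3)
    (- h ^- 2 * (x i / h) * (p i + x i * T) +
     h^-1 * (q i + (T + x i * (p i + W i)))) =
  - h ^- 2 * (\sum_(j < 3) x j * p j + (\sum_(j < 3) x j * x j) * T) +
  \sum_(i < 3) q i + 3 * T + \sum_(j < 3) x j * p j + \sum_(i < 3) x i * W i.
  have h0 : h != 0 := height_neq0 z.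
  rewrite !big_ord_recl !big_ord0.
  move: (x _) (x _) (x _) (p _) (p _) (p _) (q _) (q _) (q _) (W _) (W _) (W _).
  by move=> *; field.
rewrite (alg S (fun i => z 0 i) P (fun i => Q i i)) => {alg}.
rewrite -/S; have -> : \sum_(j < 3) z 0 j * z 0 j = h ^+ 2 - 1 by rewrite hE; ring.
have h0 : h != 0 := height_neq0 z.
by field.
Unshelve. all: by end_near. Qed.

End Laplacian.

(** * The heat kernel of hyperbolic space *)

Section Kernel.
Context {R : realType}.
Implicit Types (r t c h : R).

Definition sinhR r : R := (expR r - expR (- r)) / 2.
Definition coshR r : R := (expR r + expR (- r)) / 2.

Lemma der_sinh r : is_derive r 1 sinhR (coshR r).
Proof. by rewrite /sinhR /coshR; apply: der_eq; rewrite /GRing.scale /=; field. Qed.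

Lemma der_cosh r : is_derive r 1 coshR (sinhR r).
Proof. by rewrite /sinhR /coshR; apply: der_eq; rewrite /GRing.scale /=; field. Qed.

Lemma sinh0 : sinhR 0 = 0.
Proof. by rewrite /sinhR oppr0 subrr mul0r. Qed.

Lemma cosh0 : coshR 0 = 1.
Proof. by rewrite /coshR oppr0 expR0; field. Qed.

Lemma cosh_gt0 r : 0 < coshR r.
Proof. by rewrite /coshR divr_gt0// addr_gt0// expR_gt0. Qed.

Lemma sinh_ge0 r : 0 <= r -> 0 <= sinhR r.
Proof.
move=> r0; apply: (@nonneg_of_der _ sinhR coshR) => //; first exact: sinh0.
- by move=> y _; exact: der_sinh.
- by move=> y _; rewrite ltW// cosh_gt0.
Qed.

Lemma cosh_ge1 r : 0 <= r -> 1 <= coshR r.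
Proof.
move=> r0; rewrite -subr_ge0.
apply: (@nonneg_of_der _ (fun y => coshR y - 1) sinhR) => //.
- by rewrite cosh0 subrr.
- by move=> y _; have := der_cosh y => ?; apply: der_eq; rewrite subr0.
- by move=> y; exact: sinh_ge0.
Qed.

Lemma le_sinh r : 0 <= r -> r <= sinhR r.
Proof.
move=> r0; rewrite -subr_ge0.
apply: (@nonneg_of_der _ (fun y => sinhR y - y) (fun y => coshR y - 1)) => //.
- by rewrite sinh0 subrr.
- by move=> y _; have := der_sinh y => ?; apply: der_eq.
- by move=> y y0; rewrite subr_ge0 cosh_ge1.
Qed.

Lemma sinh_gt0 r : 0 < r -> 0 < sinhR r.
Proof. by move=> r0; rewrite (lt_le_trans r0)// le_sinh// ltW. Qed.

Lemma sinh_le r : 0 <= r -> sinhR r <= r * coshR r.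
Proof.
move=> r0; rewrite -subr_ge0.
apply: (@nonneg_of_der _ (fun y => y * coshR y - sinhR y) (fun y => y * sinhR y)) => //.
- by rewrite sinh0 mul0r subrr.
- move=> y _; have := der_sinh y; have := der_cosh y => ? ?.
  by apply: der_eq; rewrite /GRing.scale /=; ring.
- by move=> y y0; rewrite mulr_ge0// sinh_ge0.
Qed.

Lemma cosh_ge r : 0 <= r -> 1 + r ^+ 2 / 2 <= coshR r.
Proof.
move=> r0; rewrite -subr_ge0.
apply: (@nonneg_of_der _ (fun y => coshR y - (1 + y ^+ 2 / 2)) (fun y => sinhR y - y)) => //.
- by rewrite cosh0 expr0n /=; ring.
- move=> y _; have := der_cosh y => ?.
  by apply: der_eq; rewrite /GRing.scale /=; field.
- by move=> y y0; rewrite subr_ge0 le_sinh.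
Qed.

(** An upper Taylor bound valid for every [r]: the remainder carries the factor [coshR r], which
    becomes [1 + h] in the expansion at the pole. *)
Lemma cosh_le r : 0 <= r -> coshR r <= 1 + r ^+ 2 / 2 * coshR r.
Proof.
move=> r0; rewrite -subr_ge0.
apply: (@nonneg_of_der _ (fun y => 1 + y ^+ 2 / 2 * coshR y - coshR y)
  (fun y => y * coshR y + y ^+ 2 / 2 * sinhR y - sinhR y)) => //.
- by rewrite cosh0 expr0n /=; ring.
- move=> y _; have := der_cosh y => ?.
  by apply: der_eq; rewrite /GRing.scale /=; field.
- move=> y y0; have := sinh_le y0; have := sinh_ge0 y0; have := sqr_ge0 y; nra.
Qed.

Lemma sinh_ge_cube r : 0 <= r -> r + r ^+ 3 / 6 <= sinhR r.
Proof.
move=> r0; rewrite -subr_ge0.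
apply: (@nonneg_of_der _ (fun y => sinhR y - (y + y ^+ 3 / 6))
  (fun y => coshR y - (1 + y ^+ 2 / 2))) => //.
- by rewrite sinh0 expr0n /=; ring.
- move=> y _; have := der_sinh y => ?.
  by apply: der_eq; rewrite /GRing.scale /=; field.
- by move=> y y0; rewrite subr_ge0 cosh_ge.
Qed.

Lemma sinh_le_cube r : 0 <= r -> sinhR r <= r + r ^+ 3 / 6 * coshR r.
Proof.
move=> r0; rewrite -subr_ge0.
apply: (@nonneg_of_der _ (fun y => y + y ^+ 3 / 6 * coshR y - sinhR y)
  (fun y => 1 + y ^+ 2 / 2 * coshR y + y ^+ 3 / 6 * sinhR y - coshR y)) => //.
- by rewrite sinh0 expr0n /=; ring.
- move=> y _; have := der_cosh y; have := der_sinh y => ? ?.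
  by apply: der_eq; rewrite /GRing.scale /=; field.
- move=> y y0; have := cosh_le y0; have := sinh_ge0 y0.
  have : 0 <= y ^+ 3 by rewrite exprn_ge0.
  nra.
Qed.

Lemma expR_arcosh c : 1 <= c -> expR (arcosh c) = c + Num.sqrt (c ^+ 2 - 1).
Proof. by move=> c1; rewrite lnK// posrE ltr_pwDl ?sqrtr_ge0//; lra. Qed.

Lemma sqr_sub1_ge0 c : 1 <= c -> 0 <= c ^+ 2 - 1.
Proof. by move=> c1; rewrite subr_ge0 exprn_ege1. Qed.

Lemma cosh_arcosh c : 1 <= c -> coshR (arcosh c) = c.
Proof.
move=> c1; rewrite /coshR expRN expR_arcosh//.
have := sqr_sqrtr (sqr_sub1_ge0 c1); have := sqrtr_ge0 (c ^+ 2 - 1).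
move: (Num.sqrt _) => s s0 s2.
have n0 : c + s != 0 by rewrite gt_eqF// ltr_pwDl//; lra.
have -> : (c + s)^-1 = c - s by apply: (mulIf n0); rewrite mulVf//; nra.
by field.
Qed.

Lemma arcosh_ge0 c : 1 <= c -> 0 <= arcosh c.
Proof. by move=> c1; rewrite ln_ge0// (le_trans c1)// lerDl sqrtr_ge0. Qed.

Lemma sinh_arcosh c : 1 <= c -> sinhR (arcosh c) = Num.sqrt (c ^+ 2 - 1).
Proof.
move=> c1; have := cosh_arcosh c1; have := expR_arcosh c1.
rewrite /coshR /sinhR; lra.
Qed.

Lemma arcosh1 : arcosh (1 : R) = 0.
Proof. by rewrite /arcosh expr1n subrr sqrtr0 addr0 ln1. Qed.

Lemma arcosh_gt0 c : 1 < c -> 0 < arcosh c.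
Proof.
move=> c1; rewrite lt_neqAle arcosh_ge0 ?ltW// andbT eq_sym; apply/eqP => a0.
by have := cosh_arcosh (ltW c1); rewrite a0 cosh0; lra.
Qed.

Definition sinhc_inv r : R := if r == 0 then 1 else r / sinhR r.

(** [(4 * pi) `^ (3 / 2)] times the heat kernel of H3 at distance [r]. *)
Definition hyp_kernel r t : R :=
  sinhc_inv r * expR (- (3 / 2) * ln t - t - r ^+ 2 / (4 * t)).

Lemma sinhc_inv_gt0 r : 0 <= r -> 0 < sinhc_inv r.
Proof.
rewrite le_eqVlt /sinhc_inv => /predU1P[<-|r0]; first by rewrite eqxx.
by rewrite gt_eqF// divr_gt0// sinh_gt0.
Qed.

Lemma sinhc_inv_le1 r : 0 <= r -> sinhc_inv r <= 1.
Proof.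
rewrite le_eqVlt /sinhc_inv => /predU1P[<-|r0]; first by rewrite eqxx.
by rewrite gt_eqF// ler_pdivrMr ?sinh_gt0// mul1r le_sinh// ltW.
Qed.

Lemma hyp_kernel_gt0 r t : 0 <= r -> 0 < hyp_kernel r t.
Proof. by move=> r0; rewrite mulr_gt0 ?expR_gt0 ?sinhc_inv_gt0. Qed.

Lemma hyp_kernel_le r t : 0 <= r ->
  hyp_kernel r t <= expR (- (3 / 2) * ln t - t - r ^+ 2 / (4 * t)).
Proof. by move=> r0; rewrite ger_pMl ?expR_gt0// sinhc_inv_le1. Qed.

(** Multiplied by [sinhR r], the claim becomes [(1 + r) / 4 * (1 - expR (- r) ^+ 2) <= r]; the
    bracket is at most [2 * r], which serves for [r <= 1], and at most 1, which serves beyond. *)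
Lemma sinhc_inv_ge r : 0 <= r -> (1 + r) * expR (- r) / 2 <= sinhc_inv r.
Proof.
rewrite le_eqVlt /sinhc_inv => /predU1P[<-|r0].
  by rewrite eqxx addr0 oppr0 expR0; lra.
rewrite gt_eqF// ler_pdivlMr ?sinh_gt0// /sinhR.
have e1 : expR r * expR (- r) = 1 by rewrite -expRD subrr expR0.
have e2 : 1 - 2 * r <= expR (- r) ^+ 2.
  rewrite -expRM_natl; apply: le_trans (expR_ge1Dx _); lra.
have e0 : 0 <= expR (- r) ^+ 2 by rewrite exprn_ge0// expR_ge0.
have -> : (1 + r) * expR (- r) / 2 * ((expR r - expR (- r)) / 2) =
  (1 + r) / 4 * (expR r * expR (- r) - expR (- r) ^+ 2) by field.
rewrite e1; nra.
Qed.

Lemma sinhc_inv_le r : 0 <= r -> sinhc_inv r <= 2 * ((1 + r) * expR (- r)).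
Proof.
rewrite le_eqVlt /sinhc_inv => /predU1P[<-|r0].
  by rewrite eqxx addr0 oppr0 expR0; lra.
rewrite gt_eqF// ler_pdivrMr ?sinh_gt0// /sinhR.
have e1 : expR r * expR (- r) = 1 by rewrite -expRD subrr expR0.
have e2 : (1 + 2 * r) * expR (- r) ^+ 2 <= 1.
  have : 1 + 2 * r <= expR r ^+ 2.
    by rewrite -expRM_natl; exact: expR_ge1Dx.
  have : 0 <= expR (- r) ^+ 2 by rewrite exprn_ge0// expR_ge0.
  have : expR r ^+ 2 * expR (- r) ^+ 2 = 1 by rewrite -exprMn e1 expr1n.
  nra.
have -> : 2 * ((1 + r) * expR (- r)) * ((expR r - expR (- r)) / 2) =
  (1 + r) * (expR r * expR (- r) - expR (- r) ^+ 2) by field.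
rewrite e1; have : 0 <= expR (- r) ^+ 2 by rewrite exprn_ge0// expR_ge0.
nra.
Qed.

Lemma sinhc_inv_ge_cosh r : 0 <= r -> (coshR r)^-1 <= sinhc_inv r.
Proof.
rewrite le_eqVlt /sinhc_inv => /predU1P[<-|r0].
  by rewrite eqxx cosh0 invr1.
rewrite gt_eqF// ler_pdivlMr ?sinh_gt0// mulrC ler_pdivrMr ?cosh_gt0//.
by rewrite sinh_le// ltW.
Qed.

(** The logarithmic derivative of the kernel in time. That the Laplacian produces the same factor is
    the heat equation. *)
Definition kernel_rate r t : R := - (3 / (2 * t)) - 1 + r ^+ 2 / (4 * t ^+ 2).

Lemma der_hyp_kernel r t : 0 < t ->
  is_derive t 1 (hyp_kernel r) (hyp_kernel r t * kernel_rate r t).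
Proof.
move=> t0; rewrite /hyp_kernel /kernel_rate.
have H : is_derive t 1 (fun s => - (3 / 2) * ln s - s - r ^+ 2 / (4 * s))
    (- (3 / (2 * t)) - 1 + r ^+ 2 / (4 * t ^+ 2)).
  have dl := der_ln (f := fun s : R => s) t0 (der_id t).
  have tn0 : 4 * t != 0 by rewrite gt_eqF// mulr_gt0.
  have dv := derV (f := fun s : R => 4 * s) tn0 (derM (der_cst 4 t) (der_id t)).
  by apply: der_eq; rewrite /GRing.scale /=; field; rewrite gt_eqF.
apply: der_eq (derM (der_cst (sinhc_inv r) t) (der_expR H)) _.
by rewrite mul0r add0r mulrA.
Qed.

(** The identity is the radial heat equation away from the pole, in the variable [c = coshR r]; [F1]
    and [F2] are the derivatives in [c]. *)
Lemma peano2_hyp_kernel c t : 1 < c -> 0 < t -> exists F1 F2,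
  peano2 (fun x => hyp_kernel (arcosh x) t) c F1 F2 /\
  (c ^+ 2 - 1) * F2 + 3 * c * F1 =
  hyp_kernel (arcosh c) t * kernel_rate (arcosh c) t.
Proof.
move=> c1 t0; pose s (x : R) : R := Num.sqrt (x ^+ 2 - 1).
have tn0 : t != 0 by rewrite gt_eqF.
have s0 (x : R) : 1 < x -> 0 < x ^+ 2 - 1 by move=> x1; rewrite subr_gt0 exprn_egt1.
have sp x : 1 < x -> 0 < s x by move=> x1; rewrite sqrtr_gt0 s0.
have ds (x : R) : 1 < x -> is_derive x 1 s (x / s x).
  move=> x1; have H : is_derive x 1 (fun x : R => x ^+ 2 - 1) (2 * x).
    by apply: der_eq; rewrite /GRing.scale /=; ring.
  have X : is_derive x 1 s _ :=
    der_sqrt (f := fun x : R => x ^+ 2 - 1) (s0 x x1) H; apply: der_eq X _.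
  by rewrite -/(s x); field; rewrite gt_eqF// sp.
have da (x : R) : 1 < x -> is_derive x 1 (@arcosh R) (s x)^-1.
  move=> x1; have H := derD (der_id x) (ds x x1).
  have p0 : 0 < x + s x by rewrite addr_gt0 ?sp// (lt_trans ltr01).
  have X : is_derive x 1 (@arcosh R) _ :=
    der_ln (f := fun x : R => x + s x) p0 H; apply: der_eq X _.
  by field; rewrite !gt_eqF// sp.
have dsV (x : R) : 1 < x -> is_derive x 1 (fun y => (s y)^-1) (- x / s x ^+ 3).
  move=> x1; have sn0 : s x != 0 by rewrite gt_eqF// sp.
  by apply: der_eq (derV sn0 (ds x x1)) _; field.
pose E x : R := expR (- (3 / 2) * ln t - t - arcosh x ^+ 2 / (4 * t)).
have dE (x : R) : 1 < x -> is_derive x 1 E (- E x * arcosh x / (2 * t * s x)).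
  move=> x1; have sn0 : s x != 0 by rewrite gt_eqF// sp.
  have H := der_expR (derD (der_cst (- (3 / 2) * ln t - t) x)
    (derN (derM (derX 2 (da x x1)) (der_cst (4 * t)^-1 x)))).
  have X : is_derive x 1 E _ := H.
  by apply: der_eq X _; rewrite /= -/(E x); field; rewrite tn0 sn0.
(* Written with powers of [(s x)^-1] instead of quotients, so that the second derivative [F2] comes
   from the product rule and [dsV]. *)
pose F1 x : R := E x * ((s x)^-1 ^+ 2 - arcosh x * x * (s x)^-1 ^+ 3
  - (2 * t)^-1 * (arcosh x ^+ 2 * (s x)^-1 ^+ 2)).
pose r := arcosh c; pose u := s c.
pose F2 : R := E c * (- 3 * c / u ^+ 4 - r / u ^+ 3 + 3 * r * c ^+ 2 / u ^+ 5
  - r / (t * u ^+ 3) + r ^+ 2 * c / (t * u ^+ 4)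
  - r / (2 * t * u) * ((u ^+ 2)^-1 - r * c / u ^+ 3 - r ^+ 2 / (2 * t * u ^+ 2))).
have u0 : u != 0 by rewrite gt_eqF// sp.
exists (F1 c), F2; split; last first.
  have -> : c ^+ 2 - 1 = u ^+ 2 by rewrite sqr_sqrtr// ltW// s0.
  rewrite /hyp_kernel /sinhc_inv gt_eqF ?arcosh_gt0// sinh_arcosh ?ltW//.
  rewrite -/(s c) -/u -/(E c) -/r /F1 -/r -/u /F2 /kernel_rate; field.
  by rewrite tn0 u0.
apply: peano2_der.
  near=> x; have x1 : 1 < x by near: x; exact: lt_nbhsr.
  have sn0 : s x != 0 by rewrite gt_eqF// sp.
  apply: (der_near_eq (f := fun x => arcosh x * (s x)^-1 * E x)).
    near=> y; have y1 : 1 < y by near: y; exact: lt_nbhsr.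
    rewrite /hyp_kernel /sinhc_inv gt_eqF ?arcosh_gt0// sinh_arcosh ?ltW//.
  apply: der_eq (derM (derM (da x x1) (dsV x x1)) (dE x x1)) _.
  by rewrite /F1 /=; field; rewrite tn0 sn0.
have H := derM (dE c c1) (derD (derD (derX 2 (dsV c c1))
  (derN (derM (derM (da c c1) (der_id c)) (derX 3 (dsV c c1)))))
  (derN (derM (der_cst (2 * t)^-1 c) (derM (derX 2 (da c c1)) (derX 2 (dsV c c1)))))).
have X : is_derive c 1 F1 _ := H; apply: der_eq X _.
by rewrite /= -/u -/r /F2; field; rewrite tn0 u0.
Unshelve. all: by end_near. Qed.

(** Arithmetic core of the expansion at the pole, with [h = coshR r - 1], [ti] the inverse of [t],
    [r2 = r ^+ 2], [q] the value of [sinhc_inv r] and [B] the Gaussian factor. The quantity bounded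
    equals [q * B - 1 + h / 3 + h * ti / 2]. *)
Lemma center_estimate (h ti r2 q B : R) :
  let c := 1 + h in let y := r2 / 4 * ti in
  0 <= h -> h <= 1 -> 0 < ti -> 2 * h <= r2 * c -> r2 <= 2 * h ->
  0 <= q -> q <= 1 -> (1 - q) * 3 <= h * c -> h <= (1 - q) * (3 * c ^+ 2) ->
  0 < B -> 1 - y <= B -> (1 + y) * B <= 1 ->
  `|(h / 3 - (1 - q)) + (h * ti / 2 - (1 - B)) + (1 - q) * (1 - B)|
    <= (1 + ti + ti ^+ 2 / 4) * h ^+ 2.
Proof.
move=> c y h0 h1 ti0 r2l r2u q0 q1 A1 A2 Bp B1 B2.
have h20 : 0 <= h ^+ 2 := sqr_ge0 h.
have a1 : h / 3 - h ^+ 2 <= 1 - q.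
  move: A2 q0; rewrite /c; set u := q; clear -h0 h1 h20; nra.
have a2 : 1 - q <= h / 3 + h ^+ 2 / 3 by move: A1; rewrite /c; clear; lra.
have r20 : 0 <= r2 by move: r2l; rewrite /c; clear -h0; nra.
have y0 : 0 <= y by rewrite /y mulr_ge0 ?divr_ge0// ltW.
have ylow : h * ti / 2 - h ^+ 2 * ti / 2 <= y.
  have : h * (1 - h) * 2 <= r2.
    move: r2l; rewrite /c; clear -h0 h1 h20 r20; nra.
  rewrite /y; clear -ti0; nra.
have yup : y <= h * ti / 2 by move: r2u; rewrite /y; clear -ti0; nra.
have b2 : 1 - B <= h * ti / 2 by move: B1 yup; clear; lra.
have b1 : h * ti / 2 - h ^+ 2 * ti / 2 - h ^+ 2 * ti ^+ 2 / 4 <= 1 - B.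
  have y1 : y - y ^+ 2 <= 1 - B by move: B2 Bp y0; clear; nra.
  have y2 : y ^+ 2 <= (h * ti / 2) ^+ 2.
    by rewrite ler_sqr ?nnegrE// (le_trans y0).
  move: y1 y2 ylow; clear; lra.
have b0 : 0 <= 1 - B by move: B2 y0 Bp; clear; nra.
have ab0 : 0 <= (1 - q) * (1 - B) by rewrite mulr_ge0// subr_ge0.
have ab : (1 - q) * (1 - B) <= (h * 2 / 3) * (h * ti / 2).
  apply: ler_pM => //; first by rewrite subr_ge0.
  move: a2 h1 h0; clear; nra.
have ht : 0 <= h ^+ 2 * ti by rewrite mulr_ge0// ltW.
have ht2 : 0 <= h ^+ 2 * ti ^+ 2 by rewrite mulr_ge0// sqr_ge0.
have -> : (1 + ti + ti ^+ 2 / 4) * h ^+ 2 =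
  h ^+ 2 + h ^+ 2 * ti + h ^+ 2 * ti ^+ 2 / 4 by ring.
have {}ab : (1 - q) * (1 - B) <= h ^+ 2 * ti / 3.
  by apply: le_trans ab _; rewrite (_ : _ * _ = h ^+ 2 * ti / 3)//; field.
move: ab ab0 ht ht2 h20 a1 a2 b1 b2; set p := (1 - q) * (1 - B).
move: (h ^+ 2 * ti) (h ^+ 2 * ti ^+ 2) (h ^+ 2) (h * ti) p => *.
rewrite ler_norml; apply/andP; split; lra.
Qed.

(** Up to [O(h ^+ 2)], [r ^+ 2] is [2 * h], [1 - sinhc_inv r] is [h / 3], and the Gaussian factor
    falls short of 1 by [h / (2 * t)]. The slope carries a factor [1 / 3] because
    [lap_at_radial_center] multiplies it by 3. *)
Lemma kernel_center_expansion t : 0 < t -> forall e : R, 0 < e ->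
  \forall h \near (0 : R), 0 <= h ->
  `|hyp_kernel (arcosh (1 + h)) t - hyp_kernel (arcosh 1) t -
    hyp_kernel 0 t * kernel_rate 0 t / 3 * h| <= e * h.
Proof.
move=> t0 e e0; pose E0 : R := expR (- (3 / 2) * ln t - t).
pose ti := t^-1; pose K := 1 + ti + (4 * t ^+ 2)^-1.
have ti0 : 0 < ti by rewrite invr_gt0.
have E00 : 0 < E0 by exact: expR_gt0.
have K0 : 0 < K by rewrite !addr_gt0// invr_gt0 mulr_gt0// exprn_gt0.
near=> h => h0.
have h1 : h <= 1.
  by rewrite (le_trans (ler_norm h))// ltW//; near: h; exact: near0_norm_lt.
have he : h <= e / (E0 * K).
  rewrite (le_trans (ler_norm h))// ltW//; near: h; apply: near0_norm_lt.
  by rewrite divr_gt0// mulr_gt0.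
pose c := 1 + h; have c1 : 1 <= c by rewrite lerDl.
set r := arcosh c; have r0 : 0 <= r by exact: arcosh_ge0.
rewrite arcosh1 /hyp_kernel /kernel_rate.
have -> : sinhc_inv 0 = 1 :> R by rewrite /sinhc_inv eqxx.
rewrite !expr0n /= !mul0r !addr0 subr0 -/E0 mul1r expRD -/E0.
have -> : - (r ^+ 2 / (4 * t)) = - (r ^+ 2 / 4 * ti).
  by rewrite /ti; field; rewrite gt_eqF.
set y := r ^+ 2 / 4 * ti.
have cr : coshR r = c by exact: cosh_arcosh.
have r2l : 2 * h <= r ^+ 2 * c by have := cosh_le r0; rewrite cr /c; lra.
have r2u : r ^+ 2 <= 2 * h by have := cosh_ge r0; rewrite cr /c; lra.
have y0 : 0 <= y by rewrite mulr_ge0 ?divr_ge0 ?sqr_ge0// ltW.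
have B1 : expR (- y) >= 1 - y by have := expR_ge1Dx (- y); lra.
have B2 : (1 + y) * expR (- y) <= 1.
  rewrite expRN ler_pdivrMr ?expR_gt0// mul1r; exact: expR_ge1Dx.
have Bp : 0 < expR (- y) by exact: expR_gt0.
(* The cubic bounds on [sinhR] place [(sinhR r - r) / sinhR r] between [h / (3 * c ^+ 2)] and
   [h * c / 3]. *)
have [A1 A2] : (1 - sinhc_inv r) * 3 <= h * c /\
    h <= (1 - sinhc_inv r) * (3 * c ^+ 2).
  rewrite /sinhc_inv; have [rr|rr] := eqVneq r 0.
    have -> : h = 0 by apply/eqP; rewrite eq_le h0 andbT; move: r2l; rewrite rr expr0n mul0r; lra.
    by rewrite subrr !mul0r.
  have rp : 0 < r by rewrite lt_neqAle eq_sym rr.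
  have sp := sinh_gt0 rp.
  have -> : 1 - r / sinhR r = (sinhR r - r) / sinhR r by field; rewrite gt_eqF.
  have s1 := le_sinh r0; have := sinh_le r0; have := sinh_le_cube r0.
  have := sinh_ge_cube r0; rewrite cr => s2 s3 s4.
  split.
    rewrite mulrAC ler_pdivrMr//.
    have : r ^+ 3 <= 2 * h * sinhR r by rewrite exprSr ler_pM// sqr_ge0.
    move=> /(ler_wpM2r (le_trans ler01 c1)); lra.
  rewrite mulrAC ler_pdivlMr//.
  have c0 : 0 <= c by lra.
  have : h * sinhR r <= h * (r * c) by rewrite ler_wpM2l.
  have : 2 * h * (r * c) <= r ^+ 2 * c * (r * c) by rewrite ler_wpM2r// mulr_ge0.
  have : r ^+ 3 / 6 * (3 * c ^+ 2) <= (sinhR r - r) * (3 * c ^+ 2).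
    by rewrite ler_wpM2r ?mulr_ge0 ?sqr_ge0//; lra.
  have -> : r ^+ 2 * c * (r * c) = r ^+ 3 * c ^+ 2 by ring.
  lra.
have ti2 : (4 * t ^+ 2)^-1 = ti ^+ 2 / 4.
  by rewrite /ti; field; rewrite gt_eqF.
have := @center_estimate h ti (r ^+ 2) (sinhc_inv r) (expR (- y)).
rewrite -/c -/y => /(_ h0 h1 ti0 r2l r2u (ltW (sinhc_inv_gt0 r0)))
  /(_ (sinhc_inv_le1 r0) A1 A2 Bp B1 B2).
set q := sinhc_inv r; set B := expR (- y) => D.
have -> : q * (E0 * B) - E0 - E0 * (- (3 / (2 * t)) - 1) / 3 * h =
    E0 * ((h / 3 - (1 - q)) + (h * ti / 2 - (1 - B)) + (1 - q) * (1 - B)).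
  by rewrite /ti; field; rewrite gt_eqF.
rewrite normrM gtr0_norm//.
apply: (@le_trans _ _ (E0 * (K * h * h))).
  by rewrite ler_pM2l// -[K * h * h]mulrA -expr2 /K ti2.
rewrite !mulrA ler_wpM2r//; move: he; rewrite ler_pdivlMr ?mulr_gt0//.
by rewrite mulrC.
Unshelve. all: by end_near. Qed.

Lemma lap_at_hyp_kernel (z w : H3 R) t : 0 < t ->
  lap_at (fun y => hyp_kernel (hdist y w) t) z
    (hyp_kernel (hdist z w) t * kernel_rate (hdist z w) t).
Proof.
move=> t0; have := chp_ge1 z w; rewrite le_eqVlt => /predU1P[c1|c1]; last first.
  have [F1 [F2 [FP <-]]] := peano2_hyp_kernel c1 t0.
  exact: lap_at_radial FP.
have -> : hdist z w = 0 by rewrite -arcosh1 c1.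
have -> : hyp_kernel 0 t * kernel_rate 0 t =
  3 * (hyp_kernel 0 t * kernel_rate 0 t / 3) by field.
apply: (lap_at_radial_center (F := fun x => hyp_kernel (arcosh x) t)) => //.
exact: kernel_center_expansion.
Qed.

End Kernel.

(** * Maximum principle *)

Section MaximumPrinciple.
Context {R : realType}.
Implicit Types (z w d : H3 R).

Lemma continuous_add (T : topologicalType) (f g : T -> R) :
  continuous f -> continuous g -> continuous (fun x => f x + g x).
Proof. by move=> cf cg x; apply: cvgD; [exact: cf|exact: cg]. Qed.

Lemma continuous_mul (T : topologicalType) (f g : T -> R) :
  continuous f -> continuous g -> continuous (fun x => f x * g x).
Proof. by move=> cf cg x; apply: cvgM; [exact: cf|exact: cg]. Qed.

Lemma continuous_opp (T : topologicalType) (f : T -> R) :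
  continuous f -> continuous (fun x => - f x).
Proof. by move=> cf x; apply: cvgN; exact: cf. Qed.

Lemma continuous_cst (T : topologicalType) (k : R) : continuous (fun _ : T => k).
Proof. by move=> x; exact: cvg_cst. Qed.

Lemma continuous_compose (T U V : topologicalType) (f : T -> U) (g : U -> V) :
  continuous f -> continuous g -> continuous (fun x => g (f x)).
Proof. by move=> cf cg x; apply: continuous_comp; [exact: cf|exact: cg]. Qed.

Lemma continuous_fst (T U : topologicalType) : continuous (fun p : T * U => p.1).
Proof. by move=> p; exact: cvg_fst. Qed.

Lemma continuous_snd (T U : topologicalType) : continuous (fun p : T * U => p.2).
Proof. by move=> p; exact: cvg_snd. Qed.

Lemma continuous_dotp (T : topologicalType) (f g : T -> H3 R) :
  continuous f -> continuous g -> continuous (fun x => dotp (f x) (g x)).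
Proof.
move=> cf cg; under eq_fun do rewrite dotp3.
have c (h : T -> H3 R) (i : 'I_3) : continuous h -> continuous (fun x => h x 0 i).
  move=> ch; apply: (continuous_compose (g := fun v : H3 R => v 0 i)) => //.
  exact: coord_continuous.
by do 2?apply: continuous_add; apply: continuous_mul; exact: c.
Qed.

Lemma continuous_height : continuous (@height R).
Proof.
apply: (@continuous_compose _ _ _ (fun y : H3 R => 1 + dotp y y) Num.sqrt).
  apply: continuous_add; first exact: continuous_cst.
  by apply: continuous_dotp => x; exact: cvg_id.
exact: sqrt_continuous.
Qed.

Lemma le_height_compact (H : R) : compact [set z : H3 R | height z <= H].
Proof.
pose K : set (H3 R) := [set z | forall i, `[- H, H]%classic (z 0 i)].
have cK : compact K.
  by apply: (@rV_compact R 3 (fun=> `[- H, H]%classic)) => i; exact: segment_compact.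
apply: (subclosed_compact _ cK).
  apply: (@closed_comp _ _ (@height R) [set x | x <= H]).
    by move=> z _; exact: continuous_height.
  exact: closed_le.
move=> z /= zH i; rewrite /= in_itv /= -ler_norml (le_trans _ zH)//.
rewrite -sqrtr_sqr ler_sqrt ?addr_ge0 ?dotp_ge0//.
rewrite /dotp (bigD1 i)//= -expr2 addrCA lerDl addr_ge0//.
by apply: sumr_ge0 => j _; rewrite -expr2 sqr_ge0.
Qed.

(** A maximum over a time interval may sit at the final time, where only earlier times can be
    compared. *)
Lemma der_ge0_left_max (f : R -> R) (t l r : R) : is_derive t 1 f l -> 0 < r ->
  (forall s, t - r <= s -> s <= t -> f s <= f t) -> 0 <= l.
Proof.
move=> /der_quot /cvgrPdist_lt H r0 fmax; rewrite leNgt; apply/negP => l0.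
have [|e e0 He] := near0_ex (P := fun h => h != 0 ->
    `|l - h^-1 * (f (t + h) - f t)| < - l).
  by have := H (- l); rewrite oppr_gt0 near_withinE => /(_ l0).
pose h := - (Num.min r (e / 2)).
have h0 : h < 0 by rewrite oppr_lt0 lt_min r0 divr_gt0.
have := He h; rewrite ltr0_norm// opprK => /(_ _ (ltr0_neq0 h0)) /wrap[|].
  by rewrite gt_min ltr_pdivrMr//; apply/orP; right; lra.
rewrite ltr_norml => /andP[+ _].
have : f (t + h) <= f t.
  apply: fmax; last by rewrite gerDl ltW.
  by rewrite lerD2l lerN2 ge_min lexx.
rewrite -subr_le0 => fh.
have : 0 <= h^-1 * (f (t + h) - f t) by rewrite nmulr_rge0 ?invr_lt0.
lra.
Qed.

(** The barrier is at least [B] where [height z = H] and solves the heat equation. The initial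
    inequality is asked only on [height z <= H], because the finite set of group elements in the
    upper comparison depends on [H]. *)
Lemma max_principle (W : H3 R -> R -> R) (B H : R) : 0 <= B -> 0 < H ->
  continuous (fun p : H3 R * R => W p.1 p.2) ->
  (forall z, height z <= H -> W z 0 <= 0) ->
  (forall z t, 0 <= t -> W z t <= B) ->
  (forall z t, 0 < t ->
    exists2 l, lap_at (fun y => W y t) z l & is_derive t 1 (W z) l) ->
  forall z t, 0 <= t -> height z <= H ->
    W z t <= B / H * expR (3 * t) * height z.
Proof.
move=> B0 H0 cW W0 WB sol z1 t1 t10 z1H; rewrite leNgt; apply/negP => lt1.
pose barrier (p : H3 R * R) := B / H * expR (3 * p.2) * height p.1.
(* Half of the supposed excess is spent on [eps * (1 + t)]: [w] stays positive at [(z1, t1)] and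
   becomes a strict subsolution. *)
pose eps := (W z1 t1 - barrier (z1, t1)) / (2 * (1 + t1)).
have eps0 : 0 < eps by rewrite divr_gt0 ?subr_gt0// mulr_gt0// ltr_pwDl.
pose w (p : H3 R * R) := W p.1 p.2 - barrier p - eps * (1 + p.2).
have w1 : 0 < w (z1, t1).
  rewrite /w /= /eps; have : 0 < W z1 t1 - barrier (z1, t1) by rewrite subr_gt0.
  move: (_ - _) => D D0; have -> : D / (2 * (1 + t1)) * (1 + t1) = D / 2.
    by field; rewrite gt_eqF// ltr_pwDl.
  lra.
have cw : continuous w.
  have c2 : continuous (fun p : H3 R * R => p.2) := @continuous_snd _ _.
  apply: continuous_add; first apply: continuous_add => //; apply: continuous_opp.
    apply: continuous_mul; last first.
      by apply: continuous_compose continuous_height; exact: continuous_fst.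
    apply: continuous_mul; first exact: continuous_cst.
    apply: (continuous_compose (f := fun p : H3 R * R => 3 * p.2)).
      by apply: continuous_mul => //; exact: continuous_cst.
    exact: continuous_expR.
  apply: continuous_mul; first exact: continuous_cst.
  by apply: continuous_add => //; exact: continuous_cst.
pose Q : set (H3 R * R) := [set z : H3 R | height z <= H] `*` `[0 : R, t1]%classic.
have cQ : compact Q by apply: compact_setX; [exact: le_height_compact|exact: segment_compact].
have [|||[z0 t0]] := @compact_EVT_max _ R w Q.
- by exists (z1, t1); split=> //=; rewrite in_itv /= lexx t10.
- exact: cQ.
- exact: continuous_subspaceT.
rewrite inE /Q /= in_itv /= => -[z0H /andP[t00 t01]] wmax.
have wm z t : height z <= H -> 0 <= t -> t <= t1 -> w (z, t) <= w (z0, t0).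
  by move=> zH t0' tt1; apply: wmax; rewrite inE; split=> //=; rewrite in_itv /= t0'.
have w0 : 0 < w (z0, t0) by rewrite (lt_le_trans w1)// wm.
have bar0 p : 0 <= barrier p.
  by rewrite !mulr_ge0// ?expR_ge0 ?invr_ge0 ?ltW// height_gt0.
have e1 t : 0 <= t -> 0 < eps * (1 + t) by move=> ?; rewrite mulr_gt0// ltr_pwDl.
(* Positivity of the maximum excludes the bottom [t0 = 0] and then the side [height z0 = H]. *)
have t0p : 0 < t0.
  rewrite lt_neqAle t00 andbT eq_sym; apply/eqP => tE.
  have := W0 z0 z0H; have := bar0 (z0, t0); have := e1 _ t00.
  by move: w0; rewrite /w /= tE; lra.
have z0p : height z0 < H.
  rewrite lt_neqAle z0H andbT; apply/eqP => zE.
  have : B <= barrier (z0, t0).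
    rewrite /barrier /= zE mulrAC divfK ?gt_eqF// ler_peMr//.
    by rewrite -expR0 ler_expR mulr_ge0.
  have := WB z0 t0 t00; have := e1 _ t00.
  by move: w0; rewrite /w /=; lra.
have [l lapl derl] := sol z0 t0 t0p.
pose k := B / H * expR (3 * t0).
have lapw : lap_at (fun z => w (z, t0)) z0 (l + (- k * (3 * height z0) + 0)).
  have -> : (fun z => w (z, t0)) = (fun z => W z t0 +
      (- k * height z + - (eps * (1 + t0)))).
    by apply/funext => z; rewrite /w /barrier /k /=; ring.
  apply: lap_atD lapl _; apply: lap_atD; last exact: lap_at_cst.
  exact/lap_atZ/lap_at_height.
have lapw0 : l + (- k * (3 * height z0) + 0) <= 0.
  apply: lap_at_max lapw _ => d.
  have cd : (fun s : R => height (z0 + s *: d)) @ (0 : R) --> height z0.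
    have -> : height z0 = (fun s : R => height (z0 + s *: d)) 0.
      by rewrite scale0r addr0.
    exact: der_continuous (der_height z0 d 0).
  have : \forall s \near (0 : R), height (z0 + s *: d) < H.
    by move/cvgr_lt : cd; apply.
  by apply: filterS => s sH; apply: wm => //; exact: ltW.
have derw : is_derive t0 1 (fun t => w (z0, t))
    (l - B / H * (3 * expR (3 * t0)) * height z0 - eps).
  have -> : (fun t => w (z0, t)) = (fun t => W z0 t +
      (- (B / H * height z0) * expR (3 * t) + - eps * (1 + t))).
    by apply/funext => t; rewrite /w /barrier /=; ring.
  have d3 := derM (der_cst 3 t0) (der_id t0).
  have d1 := derD (der_cst 1 t0) (der_id t0).
  have := derD derl (derD (derM (der_cst (- (B / H * height z0)) t0) (der_expR d3))
    (derM (der_cst (- eps) t0) d1)).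
  by move=> /der_eq; apply; ring.
(* At the maximum the time derivative is at least 0 and [div grad] at most 0, yet the first minus
   the second is [- eps]. *)
have : 0 <= l - B / H * (3 * expR (3 * t0)) * height z0 - eps.
  apply: der_ge0_left_max derw t0p _ => s; rewrite subrr => s0 st.
  by apply: wm => //; rewrite (le_trans st).
by move: lapw0; rewrite /k; lra.
Qed.

End MaximumPrinciple.

(** * Integrals of functions not known to be measurable *)

Section IntegralComparison.
Local Open Scope ereal_scope.
Context d (T : measurableType d) (R : realType) (mu : {measure set T -> \bar R}).
Import HBNNSimple.

(** The integral of a nonnegative function is a supremum over the simple
    functions below it, so comparison needs no measurability. *)
Lemma ge0_le_integral_nomeas (D : set T) (f g : T -> \bar R) :
  (forall x, D x -> 0 <= f x) -> (forall x, D x -> f x <= g x) ->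
  \int[mu]_(x in D) f x <= \int[mu]_(x in D) g x.
Proof.
move=> f0 fg; have g0 x : D x -> 0 <= g x by move=> Dx; rewrite (le_trans (f0 x Dx)) ?fg.
rewrite !ge0_integralE//; apply: le_ereal_sup => _ [h hf <-]; exists h => //= x.
apply: le_trans (hf x) _; rewrite /patch; case: ifP => // /[!inE]; exact: fg.
Qed.

(** Dividing by [k] a simple function below [k * f] gives one below [f], so the supremum can be
    treated term by term. *)
Lemma ge0_integralZ_le (D : set T) (k : R) (f : T -> \bar R) : (0 < k)%R ->
  (forall x, D x -> 0 <= f x) ->
  \int[mu]_(x in D) (k%:E * f x) <= k%:E * \int[mu]_(x in D) f x.
Proof.
move=> k0 f0; have kf0 x : D x -> 0 <= k%:E * f x.
  by move=> Dx; apply: mule_ge0; [rewrite lee_fin ltW|exact: f0].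
rewrite !ge0_integralE//; apply: ge_ereal_sup => _ [h hf <-].
have ki0 : (0 <= k^-1)%R by rewrite invr_ge0 ltW.
have -> : sintegral mu h = k%:E * sintegral mu (scale_nnsfun h ki0).
  rewrite (_ : sintegral mu (scale_nnsfun h ki0) = k^-1%:E * sintegral mu h).
    by rewrite muleA -EFinM divff ?gt_eqF// mul1e.
  by rewrite -sintegralrM.
rewrite lee_pmul2l//; apply: ereal_sup_ubound => /=.
exists (scale_nnsfun h ki0) => //= x.
have := hf x; rewrite /patch; case: ifP => [_|_].
  move=> hx; have := lee_wpmul2l (x := k^-1%:E) _ hx; rewrite lee_fin => /(_ ki0).
  by rewrite muleA -!EFinM mulVf ?gt_eqF// mul1e.
rewrite !lee_fin => hx; by rewrite pmulr_rle0// invr_gt0.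
Qed.

End IntegralComparison.

(** * Hyperbolic distance against the topology of the chart *)

Section Continuity.
Context {R : realType}.
Implicit Types (z w : H3 R).

Lemma hdist_ge0 z w : 0 <= hdist z w.
Proof. exact/arcosh_ge0/chp_ge1. Qed.

Lemma hdistC z w : hdist z w = hdist w z.
Proof. exact: congr1 (chpC z w). Qed.

Lemma cosh_hdist z w : coshR (hdist z w) = chp z w.
Proof. exact/cosh_arcosh/chp_ge1. Qed.

Lemma hdist_le_cosh z w r : 0 <= r -> hdist z w <= r -> chp z w <= coshR r.
Proof.
move=> r0; rewrite -cosh_hdist; have d0 := hdist_ge0 z w.
rewrite -subr_ge0 => /= dr; rewrite -subr_ge0.
have := @nonneg_of_der _ (fun y => coshR (hdist z w + y) - coshR (hdist z w))
  (fun y => sinhR (hdist z w + y)) (r - hdist z w) dr.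
rewrite addr0 subrr [hdist z w + (_ - _)]addrC subrK => /(_ erefl); apply.
  move=> y y0; have := der_cosh (hdist z w + y) => H.
  have H1 := derD (der_cst (hdist z w) y) (der_id y).
  have := derD (der_comp H1 H) (der_cst (- coshR (hdist z w)) y).
  by move=> /der_eq; apply; ring.
by move=> y y0; rewrite sinh_ge0// addr_ge0.
Qed.

Lemma continuous_hdist (w : H3 R) : continuous (fun z => hdist z w).
Proof.
have cc : continuous (fun z : H3 R => chp z w).
  apply: continuous_add; first by apply: continuous_mul;
    [exact: continuous_height|exact: continuous_cst].
  apply: continuous_opp.
  have ci : continuous (fun z : H3 R => z) by move=> x; exact: cvg_id.
  have ck : continuous (fun _ : H3 R => w) by exact: cst_continuous.
  exact: continuous_dotp ci ck.
have cs : continuous (fun z : H3 R => chp z w + Num.sqrt (chp z w ^+ 2 - 1)).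
  apply: continuous_add => //.
  apply: (continuous_compose (f := fun z : H3 R => chp z w ^+ 2 - 1)).
    by apply: continuous_add; [apply: continuous_mul|exact: continuous_cst].
  exact: sqrt_continuous.
move=> z; apply: (@continuous_comp _ _ _
  (fun z : H3 R => chp z w + Num.sqrt (chp z w ^+ 2 - 1)) (@ln R)); first exact: cs.
apply: continuous_ln; rewrite ltr_pwDl ?sqrtr_ge0//.
exact: lt_le_trans (chp_ge1 z w).
Qed.

Lemma sinhRN r : sinhR (- r) = - sinhR r :> R.
Proof. by rewrite /sinhR opprK; field. Qed.

Lemma coshRN r : coshR (- r) = coshR r :> R.
Proof. by rewrite /coshR opprK; field. Qed.

Lemma sinhc_invN r : sinhc_inv (- r) = sinhc_inv r :> R.
Proof.
rewrite /sinhc_inv oppr_eq0; case: ifP => // _.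
by rewrite sinhRN invrN mulrNN.
Qed.

Lemma continuous_sinhc_inv : continuous (@sinhc_inv R).
Proof.
move=> r; have [->|r0] := eqVneq r 0; last first.
  have s0 : sinhR r != 0.
    have [rn|rp|//] := ltgtP r 0.
    - by rewrite -[r]opprK sinhRN oppr_eq0 gt_eqF// sinh_gt0// oppr_gt0.
    - by rewrite gt_eqF// sinh_gt0.
    - by move=> rp; rewrite rp eqxx in r0.
  have := derM (der_id r) (derV s0 (der_sinh r)) => /der_continuous H.
  have e : \forall y \near r, y / sinhR y = sinhc_inv y.
    near=> y; rewrite /sinhc_inv ifF//; apply/negbTE.
    by near: y; exact: (cvgr_neq0 _ _ r0).
  rewrite /continuous_at (_ : sinhc_inv r = r / sinhR r); last first.
    by rewrite /sinhc_inv (negbTE r0).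
  by apply: cvg_trans H; exact: near_eq_cvg.
have b (y : R) : (coshR y)^-1 <= sinhc_inv y <= 1.
  have [rp|/ltW rn] := leP 0 y; first by rewrite sinhc_inv_ge_cosh// sinhc_inv_le1.
  by rewrite -sinhc_invN -coshRN sinhc_inv_ge_cosh ?sinhc_inv_le1// oppr_ge0.
rewrite /continuous_at [X in _ --> X](_ : _ = 1); last by rewrite /sinhc_inv eqxx.
apply: (@squeeze_cvgr _ _ _ _ (fun r => (coshR r)^-1) (fun=> 1)).
- by near=> y; exact: b.
- rewrite (_ : 1 = (fun r : R => (coshR r)^-1) 0); last by rewrite /= cosh0 invr1.
  apply: der_continuous (derV _ (der_cosh 0)).
  by rewrite cosh0 oner_neq0.
- exact: cvg_cst.
Unshelve. all: by end_near. Qed.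

(** Does the work of the triangle inequality. With [n] the Euclidean norm of [z],
    [(height z - n) * height w <= chp z w] and [(height z - n) * (height z + n) = 1] give
    [height w <= 2 * H * expR eta], and [expR] of the distance to 0 is at most [2 * height w]. *)
Lemma height_le_hdist z w (H eta : R) : 0 <= eta -> height z <= H ->
  hdist z w <= eta -> hdist 0 w <= ln (4 * H * expR eta).
Proof.
move=> eta0 zH dz; have H0 : 0 < H := lt_le_trans (height_gt0 z) zH.
have ce : coshR eta <= expR eta.
  have : expR (- eta) <= expR eta by rewrite ler_expR; lra.
  by rewrite /coshR; lra.
have c1 : chp z w <= expR eta := le_trans (hdist_le_cosh eta0 dz) ce.
have hw : height w <= 2 * H * expR eta.
  have nz : 0 <= dotp z z := dotp_ge0 z.
  set n := Num.sqrt (dotp z z).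
  have n2 : n ^+ 2 = dotp z z by rewrite sqr_sqrtr.
  have zn : dotp z w <= n * height w.
    apply: (le_trans (ler_norm _)); rewrite -[leRHS]ger0_norm; last first.
      by rewrite mulr_ge0 ?sqrtr_ge0// ltW// height_gt0.
    rewrite -ler_sqr ?nnegrE// !real_normK ?num_real// exprMn n2 sqr_height.
    apply: le_trans (cauchy_schwarz z w) _.
    by rewrite ler_wpM2l// lerDr.
  have hn : (height z - n) * (height z + n) = 1.
    by rewrite -subr_sqr n2 sqr_height addrK.
  have n0 : 0 <= n by exact: sqrtr_ge0.
  have hz0 := height_gt0 z; have hw0 := height_gt0 w.
  have nh : n <= height z.
    rewrite -[_ <= _]ler_sqr ?nnegrE ?(ltW hz0)//.
    by rewrite n2 sqr_height lerDr.
  have : (height z - n) * height w <= expR eta.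
    by apply: le_trans c1; rewrite /chp mulrBl lerD2l lerN2.
  move=> /(ler_wpM2l (addr_ge0 (ltW hz0) n0)).
  rewrite mulrA [(_ + n) * _]mulrC hn mul1r => /le_trans; apply.
  by rewrite ler_wpM2r ?expR_ge0//; lra.
rewrite hdistC /hdist /arcosh -/(chp w 0) chp0 ler_ln ?posrE; last first.
- by rewrite !mulr_gt0// expR_gt0.
- by rewrite ltr_pwDl ?sqrtr_ge0// height_gt0.
have : Num.sqrt (height w ^+ 2 - 1) <= height w.
  rewrite -[leRHS](ger0_norm (ltW (height_gt0 w))) -sqrtr_sqr ler_sqrt ?sqr_ge0//.
  by rewrite gerBl.
lra.
Qed.

(** Hyperbolic balls are small in the chart. For [z = b + dl] and [e = chp z b - 1], the left side
    of [key] is at least [dotp dl dl] by Cauchy-Schwarz, while every term on the right carries a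
    factor [e]. *)
Lemma hdist_nbhs (b : H3 R) (V : set (H3 R)) : nbhs b V ->
  exists2 eta : R, 0 < eta & forall z, hdist z b <= eta -> V z.
Proof.
move=> /nbhs_ballP[r /= r0 rV]; set h := height b.
have h0 : 0 < h by exact: height_gt0.
pose e1 := Num.min (2^-1) (r ^+ 2 / (16 * h ^+ 2)).
have e10 : 0 < e1.
  by rewrite lt_min invr_gt0 ltr0n divr_gt0 ?exprn_gt0// mulr_gt0 ?exprn_gt0.
have : \forall eta \near (0 : R), coshR eta < 1 + e1.
  have /cvgr_lt : coshR x @[x --> (0 : R)] --> (1 : R).
    by rewrite -[X in _ --> X]cosh0; exact: der_continuous (der_cosh 0).
  by apply; rewrite ltrDl.
move=> /near0_ex[eta eta0 He]; exists (eta / 2); first exact: divr_gt0.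
move=> z dz; apply: rV.
have : chp z b < 1 + e1.
  apply: le_lt_trans (hdist_le_cosh _ dz) _; first by rewrite divr_ge0// ltW.
  by apply: He; rewrite gtr0_norm ?divr_gt0//; lra.
have [dl zE] : exists dl : H3 R, z = b + dl by exists (z - b); rewrite addrC subrK.
set e := chp z b - 1; move=> ee1.
have e0 : 0 <= e by rewrite subr_ge0 chp_ge1.
have {}ee1 : e < e1 by rewrite /e; lra.
have ehalf : e <= 2^-1 by rewrite (le_trans (ltW ee1))// ge_min lexx.
have er : e * (16 * h ^+ 2) < r ^+ 2.
  rewrite -ltr_pdivlMr ?mulr_gt0 ?exprn_gt0//; apply: (lt_le_trans ee1).
  by rewrite ge_min lexx orbT.
have h2 : h ^+ 2 = 1 + dotp b b by exact: sqr_height.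
have zz : dotp z z = dotp b b + 2 * dotp b dl + dotp dl dl.
  by rewrite zE !(dotpDl, dotpDr) [dotp dl b]dotpC; ring.
have zb : dotp z b = dotp b b + dotp b dl by rewrite zE dotpDl [dotp dl b]dotpC.
have hz2 : height z ^+ 2 = 1 + dotp z z by exact: sqr_height.
have hh : height z * h = 1 + e + dotp z b by rewrite /e /chp -/h; ring.
have key : h ^+ 2 * dotp dl dl - dotp b dl ^+ 2 =
    e ^+ 2 + 2 * h ^+ 2 * e + 2 * e * dotp b dl.
  have : (height z * h) ^+ 2 = height z ^+ 2 * h ^+ 2 by rewrite exprMn.
  rewrite hh hz2 zz zb h2; lra.
have cs := cauchy_schwarz b dl.
have dl2 : dotp dl dl < r ^+ 2.
  have : 0 <= dotp (b + -1 *: dl) (b + -1 *: dl) by exact: dotp_ge0.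
  rewrite !(dotpDl, dotpDr, dotpZl, dotpZr) [dotp dl b]dotpC => bd.
  have d0 := dotp_ge0 dl; have b0 := dotp_ge0 b.
  move: key cs bd h2 er e0 ehalf d0 b0; clear.
  move: (dotp b dl) (dotp dl dl) (dotp b b) (h ^+ 2) (r ^+ 2) e => p q n k rr e.
  move=> key cs bd kn er e0 e2 q0 n0; rewrite kn in key er => {k kn}.
  have pq : 2 * (e * p) <= e * (n + q) by rewrite mulrCA ler_wpM2l//; lra.
  have eq : e * q <= q / 2 by rewrite [leRHS]mulrC ler_wpM2r.
  have ee : e ^+ 2 <= e / 2 by rewrite expr2 ler_wpM2l.
  have en : 0 <= e * n by rewrite mulr_ge0.
  lra.
split=> // i j; rewrite !ord1 -ball_normE /ball_ /= distrC zE !mxE addrAC subrr add0r.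
rewrite -ltr_sqr ?nnegrE ?(ltW r0)// real_normK ?num_real//.
apply: le_lt_trans dl2; rewrite /dotp (bigD1 j)//= -expr2 lerDl.
by apply: sumr_ge0 => k _; rewrite -expr2 sqr_ge0.
Qed.

End Continuity.

(** * Orbit sums of the kernel *)

Section KernelSums.
Context {R : realType}.
Implicit Types (z w b : H3 R) (F : seq (H3 R -> H3 R)).

Definition kernel_sum F b z (t : R) : R :=
  \sum_(g <- F) hyp_kernel (hdist z (g b)) t.

Lemma kernel_sum_ge0 F b z t : 0 <= kernel_sum F b z t.
Proof. by apply: sumr_ge0 => g _; rewrite ltW// hyp_kernel_gt0// hdist_ge0. Qed.

Lemma lap_at_kernel_sum F b z t : 0 < t ->
  exists2 l, lap_at (fun y => kernel_sum F b y t) z l &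
    is_derive t 1 (kernel_sum F b z) l.
Proof.
move=> t0; exists (\sum_(g <- F) hyp_kernel (hdist z (g b)) t * kernel_rate (hdist z (g b)) t).
  by apply: lap_at_sum => g; exact: lap_at_hyp_kernel.
rewrite /kernel_sum; elim: F => [|g F IH].
  by rewrite big_nil; under eq_fun do rewrite big_nil; exact: der_cst.
rewrite big_cons; under eq_fun do rewrite big_cons.
exact: derD (der_hyp_kernel _ t0) IH.
Qed.

Lemma continuous_kernel (T : topologicalType) (f : T -> H3 R) (s : T -> R) w :
  continuous f -> continuous s -> (forall x, 0 < s x) ->
  continuous (fun x => hyp_kernel (hdist (f x) w) (s x)).
Proof.
move=> cf cs s0; have ch : continuous (fun x => hdist (f x) w).
  exact: continuous_compose cf (@continuous_hdist R w).
apply: continuous_mul; first exact: continuous_compose ch (@continuous_sinhc_inv R).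
apply: (continuous_compose (g := @expR R)); last exact: continuous_expR.
apply: continuous_add; first apply: continuous_add.
- apply: continuous_mul; first exact: continuous_cst.
  move=> x; apply: (@continuous_comp _ _ _ s (@ln R)); first exact: cs.
  exact: continuous_ln.
- exact: continuous_opp.
- apply: continuous_opp; apply: continuous_mul; first exact: continuous_mul.
  move=> x; apply: cvgV; first by rewrite gt_eqF// mulr_gt0.
  by have := continuous_mul (@continuous_cst R T 4) cs; exact.
Qed.

Lemma continuous_sum_seq (T : topologicalType) (I : Type) (r : seq I) (G : I -> T -> R) :
  (forall i, continuous (G i)) -> continuous (fun x => \sum_(i <- r) G i x).
Proof.
move=> cG; elim: r => [|i r IH].
  by under eq_fun do rewrite big_nil; exact: continuous_cst.
by under eq_fun do rewrite big_cons; exact: continuous_add.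
Qed.

Lemma continuous_maxr0 : continuous (fun t : R => Num.max t 0).
Proof.
have -> : (fun t : R => Num.max t 0) = (fun t => (t + `|t|) / 2).
  apply/funext => t; rewrite maxEle; case: leP => t0.
    by rewrite ler0_norm//; ring.
  by rewrite gtr0_norm//; field.
apply: continuous_mul; last exact: continuous_cst.
apply: continuous_add => [x|]; first exact: cvg_id.
by move=> x; exact: norm_continuous.
Qed.

(** The shift [tau] and the truncation of [t] make the sum continuous on all of
    [H3 R * R]. *)
Lemma continuous_kernel_sum F b (tau : R) : 0 < tau ->
  continuous (fun q : H3 R * R => kernel_sum F b q.1 (Num.max q.2 0 + tau)).
Proof.
move=> tau0; apply: continuous_sum_seq => g; apply: continuous_kernel.
- exact: continuous_fst.
- apply: continuous_add; last exact: continuous_cst.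
  by apply: continuous_compose continuous_maxr0; exact: continuous_snd.
- by move=> q; rewrite ltr_wpDl// le_max lexx orbT.
Qed.

Lemma shifted_kernel_sum F b z t (tau : R) : 0 < t -> 0 < tau ->
  exists2 l, lap_at (fun y => kernel_sum F b y (Num.max t 0 + tau)) z l &
    is_derive t 1 (fun s => kernel_sum F b z (Num.max s 0 + tau)) l.
Proof.
move=> t0 tau0; have tt : 0 < t + tau by rewrite addr_gt0.
have [l lapl derl] := lap_at_kernel_sum F b z tt.
exists l; first by rewrite max_l// ltW.
apply: (der_near_eq (f := fun s => kernel_sum F b z (s + tau))).
  near=> s; rewrite max_l// ltW//; near: s; exact: lt_nbhsr.
have := der_comp (derD (der_id t) (der_cst tau t)) derl.
by rewrite addr0 mulr1.
Unshelve. all: by end_near. Qed.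

Lemma kernel_peak_le (r t : R) : 0 <= r -> 0 < t ->
  hyp_kernel r t <= expR (- (3 / 2) * ln t - t).
Proof.
move=> r0 t0; apply: le_trans (hyp_kernel_le _ r0) _.
by rewrite ler_expR gerBl divr_ge0 ?sqr_ge0// ltW// mulr_gt0.
Qed.

Lemma kernel_sum_le F b z t : 0 < t ->
  kernel_sum F b z t <= (size F)%:R * expR (- (3 / 2) * ln t - t).
Proof.
move=> t0; rewrite /kernel_sum; elim: F => [|g F IH]; first by rewrite big_nil mul0r.
rewrite big_cons /= -nat1r mulrDl mul1r lerD//.
by apply: kernel_peak_le => //; exact: hdist_ge0.
Qed.

End KernelSums.

(** * Truncation of the kernel at a small time *)

Section Bump.
Context {R : realType}.
Implicit Types (r eta tau : R).

(** Bounds the kernel at time [tau] at distances [>= eta]. *)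
Definition cutoff eta tau : R := expR (- (3 / 2) * ln tau - tau - eta ^+ 2 / (4 * tau)).

(** Cutting off by subtraction gives a continuous function below the kernel, within [cutoff] of it,
    and zero at distances [>= eta]. *)
Definition bump eta tau r : R := Num.max (hyp_kernel r tau - cutoff eta tau) 0.

Lemma bump_ge0 eta tau r : 0 <= bump eta tau r.
Proof. by rewrite le_max lexx orbT. Qed.

Lemma bump_ge eta tau r : hyp_kernel r tau - cutoff eta tau <= bump eta tau r.
Proof. by rewrite le_max lexx. Qed.

Lemma bump_le eta tau r : 0 <= r -> bump eta tau r <= hyp_kernel r tau.
Proof.
by move=> r0; rewrite ge_max gerBl expR_ge0 ltW// hyp_kernel_gt0.
Qed.

Lemma bump_eq0 eta tau r : 0 <= eta -> eta <= r -> 0 < tau -> bump eta tau r = 0.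
Proof.
move=> eta0 er tau0; apply: max_r; rewrite subr_le0.
apply: le_trans (hyp_kernel_le _ (le_trans eta0 er)) _.
rewrite ler_expR lerD2l lerN2 ler_wpM2r ?invr_ge0 ?mulr_ge0 ?(ltW tau0)//.
by rewrite ler_sqr// nnegrE (le_trans eta0).
Qed.

(** With [y = eta ^+ 2 / (4 * tau)], [expR (- y) <= 27 / y ^+ 3] supplies [tau ^+ 3], against a
    singular factor of at most [tau^-1 ^+ 2]; 64 is [4 ^+ 3]. *)
Lemma cutoff_le eta tau : 0 < eta -> 0 < tau -> tau <= 1 ->
  cutoff eta tau <= 27 * 64 / eta ^+ 6 * tau.
Proof.
move=> eta0 tau0 tau1; rewrite /cutoff expRD.
have l1 : expR (- (3 / 2) * ln tau - tau) <= tau^-1 ^+ 2.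
  have -> : tau^-1 ^+ 2 = expR (- 2 * ln tau).
    by rewrite mulNr expRN expRM_natl lnK// exprVn.
  rewrite ler_expR; have : ln tau <= 0 by exact: ln_le0.
  lra.
pose y := eta ^+ 2 / (4 * tau).
have y0 : 0 < y by rewrite divr_gt0 ?exprn_gt0// mulr_gt0.
have l2 : expR (- y) <= 27 / y ^+ 3.
  rewrite expRN ler_pdivlMr ?exprn_gt0// mulrC ler_pdivrMr ?expR_gt0//.
  have -> : expR y = expR (y / 3) ^+ 3 by rewrite -expRM_natl; congr expR; field.
  have -> : y ^+ 3 = 27 * (y / 3) ^+ 3 by field.
  have y30 : 0 <= y / 3 by rewrite divr_ge0// ltW.
  rewrite ler_pM2l// ler_pXn2r ?nnegrE ?expR_ge0//.
  by apply: le_trans (expR_ge1Dx _); rewrite lerDr.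
apply: (@le_trans _ _ (tau^-1 ^+ 2 * (27 / y ^+ 3))).
  by apply: ler_pM => //; exact: expR_ge0.
rewrite le_eqVlt; apply/orP; left; apply/eqP; rewrite /y; field.
by rewrite !gt_eqF.
Qed.

End Bump.

(** * Periodization of the truncated kernel *)

Section PeriodicBump.
Context {R : realType} (Gam : kleinian_group R).
Variables (b : H3 R) (eta tau : R).
Hypotheses (eta0 : 0 < eta) (tau0 : 0 < tau).
Implicit Types (z : H3 R).

(** A finitary sum, which would be 0 if the support were infinite. That does not happen: proper
    discontinuity leaves finitely many [g] with [g b] within [eta] of [z]. *)
Definition periodic_bump z : R :=
  \sum_(g \in kg_mem Gam) bump eta tau (hdist z (g b)).

Lemma periodic_bumpE (A : {fset (H3 R -> H3 R)}) z :
  (forall g, g \in A -> kg_mem Gam g) ->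
  (forall g, kg_mem Gam g -> hdist z (g b) <= eta -> g \in A) ->
  periodic_bump z = \sum_(g <- A) bump eta tau (hdist z (g b)).
Proof.
move=> AG Az; rewrite /periodic_bump (fsbigE A).
- by rewrite big_seq_cond [RHS]big_seq; apply: eq_bigl => g; case gA : (g \in A) => //=;
    rewrite mem_set//; exact: AG.
- exact: fset_uniq.
- by move=> g /=; exact: AG.
- move=> g Gg gA; apply: bump_eq0; rewrite ?(ltW eta0)// leNgt.
  by apply: contra gA => /ltW; exact: Az.
Qed.

(** One finite set that carries the periodic sum for all [z] with [height z <= H]; its radius is the
    one of [height_le_hdist]. *)
Definition orbit_ball (H : R) : {fset (H3 R -> H3 R)} :=
  fset_set (orbital_set Gam 0 b (ln (4 * H * expR eta))).

Lemma orbit_ballP H g : g \in orbit_ball H ->  kg_mem Gam g.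
Proof.
rewrite in_fset_set; last exact: orbital_set_finite.
by rewrite inE => -[].
Qed.

Lemma periodic_bump_local H z : height z <= H ->
  periodic_bump z = \sum_(g <- orbit_ball H) bump eta tau (hdist z (g b)).
Proof.
move=> zH; apply: periodic_bumpE => [g|g Gg zg]; first exact: orbit_ballP.
rewrite in_fset_set; last exact: orbital_set_finite.
by rewrite inE; split => //; exact: height_le_hdist (ltW eta0) zH zg.
Qed.

Lemma continuous_bump (T : topologicalType) (f : T -> H3 R) w :
  continuous f -> continuous (fun x => bump eta tau (hdist (f x) w)).
Proof.
move=> cf; apply: (continuous_compose (g := fun t : R => Num.max t 0)
  (f := fun x => hyp_kernel (hdist (f x) w) tau - cutoff eta tau)); last first.
  exact: continuous_maxr0.
apply: continuous_add; last exact: continuous_cst.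
by apply: (continuous_kernel (s := fun=> tau)) => //; exact: continuous_cst.
Qed.

Lemma continuous_periodic_bump : continuous periodic_bump.
Proof.
move=> z; pose H := height z + 1.
have e : \forall y \near z,
    \sum_(g <- orbit_ball H) bump eta tau (hdist y (g b)) = periodic_bump y.
  have : \forall y \near z, height y < H.
    have /cvgr_lt : height y @[y --> z] --> height z by exact: continuous_height.
    by apply; rewrite ltrDl.
  by apply: filterS => y /ltW yH; rewrite (periodic_bump_local yH).
rewrite /continuous_at (@periodic_bump_local H); last by rewrite lerDl.
apply: cvg_trans (near_eq_cvg e) _.
have : continuous (fun y => \sum_(g <- orbit_ball H) bump eta tau (hdist y (g b))).
  by apply: continuous_sum_seq => g; apply: continuous_bump => x; exact: cvg_id.
exact.
Qed.

Lemma periodic_bump_inv k z : kg_mem Gam k -> periodic_bump (k z) = periodic_bump z.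
Proof.
move=> Gk; have [k' [Gk' kK k'K]] := kg_inv Gk.
have bij : set_bij (kg_mem Gam) (kg_mem Gam) (fun g => k \o g).
  split.
  - by move=> g Gg; exact: kg_comp.
  - move=> g h _ _ /(congr1 (fun f => k' \o f)) gh; apply/funext => y.
    by have := congr1 (@^~ y) gh; rewrite /= !kK.
  - move=> g Gg; exists (k' \o g); first exact: kg_comp.
    by apply/funext => y /=; rewrite k'K.
rewrite /periodic_bump; transitivity (\sum_(g \in kg_mem Gam)
    bump eta tau (hdist (k z) ((k \o g) b))).
  pose T : choiceType := (H3 R -> H3 R)%type.
  pose f (g : T) := bump eta tau (hdist (k z) (g b)).
  exact: (@reindex_fsbig R 0 +%R T T (fun g => k \o g) _ _ f bij).
by apply: eq_fsbigr => g _; rewrite /= (kg_isometry Gk).1.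
Qed.

Definition bump_on_M (x : M Gam) : R := periodic_bump (Defs.lift x).

Lemma lift_proj z : exists2 g, kg_mem Gam g & z = g (Defs.lift (Defs.proj Gam z)).
Proof.
have : same_orbit Gam (Defs.lift (Defs.proj Gam z)) z by have /eqmodP := reprK (Defs.proj Gam z).
by move=> /asboolP[g [Gg zE]]; exists g.
Qed.

Lemma proj_orbit g z : kg_mem Gam g -> Defs.proj Gam (g z) = Defs.proj Gam z.
Proof.
move=> Gg; rewrite /Defs.proj; apply/esym/eqmodP/asboolP.
by exists g.
Qed.

Lemma bump_on_M_proj z : bump_on_M (Defs.proj Gam z) = periodic_bump z.
Proof. by rewrite /bump_on_M; have [g Gg {2}->] := lift_proj z; rewrite periodic_bump_inv. Qed.

Lemma bump_on_M_ge0 x : 0 <= bump_on_M x.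
Proof.
rewrite /bump_on_M (@periodic_bump_local (height (Defs.lift x)))//.
by apply: sumr_ge0 => g _; exact: bump_ge0.
Qed.

Lemma bump_on_M_supp x : bump_on_M x <> 0 ->
  exists2 z, hdist z b <= eta & x = Defs.proj Gam z.
Proof.
move=> fx; apply: contrapT => H; apply: fx.
rewrite /bump_on_M /periodic_bump fsbig1// => g Gg; apply: bump_eq0; rewrite ?(ltW eta0)//.
rewrite leNgt; apply/negP => /ltW zg; apply: H.
have [g' [Gg' gK g'K]] := kg_inv Gg; exists (g' (Defs.lift x)).
  by rewrite -[b]gK (kg_isometry Gg').1.
by rewrite proj_orbit// /Defs.proj reprK.
Qed.

Definition bump_height : R := coshR (ln (4 * height b * expR eta)).

Lemma bump_height_le z : hdist z b <= eta -> height z <= bump_height.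
Proof.
move=> zb; have bz : hdist b z <= eta by rewrite hdistC.
have := height_le_hdist (ltW eta0) (lexx (height b)) bz; rewrite hdistC => z0.
by rewrite -chp0; apply: hdist_le_cosh => //; exact: le_trans (hdist_ge0 _ _) z0.
Qed.

Lemma bump_on_M_Cc : Cc bump_on_M.
Proof.
split.
  apply/quotient_continuous.
  rewrite (_ : _ \o _ = periodic_bump); first exact: continuous_periodic_bump.
  by apply/funext => z; exact: bump_on_M_proj.
exists (Defs.proj Gam @` [set z | height z <= bump_height]).
  apply: continuous_compact; last exact: le_height_compact.
  exact/continuous_subspaceT/pi_continuous.
move=> x Kx; apply: contrapT => /bump_on_M_supp[z zb xz]; apply: Kx.
by exists z => //=; exact: bump_height_le.
Qed.

(** Where the function is nonzero, invariance allows a representative within [eta] of [b], and there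
    a single finite sum bounds it. *)
Lemma bump_on_M_bounded : exists2 B : R, 0 < B & forall x, bump_on_M x <= B.
Proof.
pose A := orbit_ball bump_height.
exists ((size A)%:R * expR (- (3 / 2) * ln tau - tau) + 1).
  by rewrite ltr_wpDl// mulr_ge0// expR_ge0.
move=> x; have [->|/bump_on_M_supp[z zb ->]] := pselect (bump_on_M x = 0).
  by rewrite addr_ge0// mulr_ge0// expR_ge0.
rewrite bump_on_M_proj (periodic_bump_local (bump_height_le zb)).
apply: (@le_trans _ _ (kernel_sum A b z tau)).
  by apply: ler_sum => g _; apply: bump_le; exact: hdist_ge0.
by apply: le_trans (kernel_sum_le _ _ _ tau0) _; rewrite lerDl.
Qed.

Lemma bump_on_M_le H z : height z <= H ->
  bump_on_M (Defs.proj Gam z) <= kernel_sum (orbit_ball H) b z tau.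
Proof.
move=> zH; rewrite bump_on_M_proj (periodic_bump_local zH).
by apply: ler_sum => g _; apply: bump_le; exact: hdist_ge0.
Qed.

(** Each element of [F] loses at most [cutoff] by truncation, and the other terms of the periodic
    sum are nonnegative. *)
Lemma bump_on_M_ge (F : {fset (H3 R -> H3 R)}) z : (forall g, g \in F -> kg_mem Gam g) ->
  kernel_sum F b z tau - (size F)%:R * cutoff eta tau <= bump_on_M (Defs.proj Gam z).
Proof.
move=> FG; rewrite bump_on_M_proj.
pose A := (F `|` orbit_ball (height z))%fset.
have -> : periodic_bump z = \sum_(g <- A) bump eta tau (hdist z (g b)).
  apply: periodic_bumpE => g.
    by rewrite inE => /orP[/FG//|]; exact: orbit_ballP.
  move=> Gg zg; rewrite inE; apply/orP; right.
  rewrite in_fset_set; last exact: orbital_set_finite.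
  by rewrite inE; split => //; exact: height_le_hdist (ltW eta0) (lexx _) zg.
have -> : \sum_(g <- A) bump eta tau (hdist z (g b)) =
    \sum_(g <- F) bump eta tau (hdist z (g b)) +
    \sum_(g <- A | g \notin F) bump eta tau (hdist z (g b)).
  rewrite (bigID (fun g => g \in F)) /= -big_filter; congr (_ + _).
  apply: perm_big; apply: uniq_perm; rewrite ?filter_uniq ?fset_uniq// => g.
  by rewrite mem_filter inE; case: (g \in F).
apply: (@le_trans _ _ (\sum_(g <- F) bump eta tau (hdist z (g b)))); last first.
  by rewrite lerDl; apply: sumr_ge0 => g _; exact: bump_ge0.
rewrite /kernel_sum; elim: (F : seq _) => [|g s IH]; first by rewrite !big_nil mul0r subrr.
rewrite !big_cons /= -nat1r mulrDl mul1r opprD addrACA lerD//; exact: bump_ge.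
Qed.

End PeriodicBump.

(** * Comparison with the heat kernel of the quotient *)

Section Comparison.
Context {R : realType} (Gam : kleinian_group R).
Local Notation M := (Defs.M Gam).
Local Notation proj := (Defs.proj Gam).

Lemma integralM_ge0 (h : M -> R) : (forall x, 0 <= h x) -> (0 <= integralM h)%E.
Proof.
move=> h0; apply: integral_ge0 => v _.
by rewrite lee_fin mulr_ge0// sqrtr_ge0.
Qed.

Lemma integralM_le (h k : M -> R) : (forall x, 0 <= h x) -> (forall x, h x <= k x) ->
  (integralM h <= integralM k)%E.
Proof.
move=> h0 hk; apply: ge0_le_integral_nomeas => v _; rewrite lee_fin.
  by rewrite mulr_ge0// sqrtr_ge0.
by rewrite ler_wpM2r// sqrtr_ge0.
Qed.

Lemma integralM_scale_le (c : R) (h : M -> R) : 0 < c -> (forall x, 0 <= h x) ->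
  (integralM (fun x => c * h x)%R <= c%:E * integralM h)%E.
Proof.
move=> c0 h0; rewrite /integralM.
apply: le_trans (ge0_integralZ_le _ c0 _); last first.
  by move=> v _; rewrite lee_fin mulr_ge0// sqrtr_ge0.
apply: ge0_le_integral_nomeas => v _.
  by rewrite lee_fin !mulr_ge0// ?sqrtr_ge0 ?ltW.
by rewrite -EFinM mulrA.
Qed.

(** Extending by the initial value to [t <= 0] provides the continuity on all of [H3 R * R] that
    [max_principle] asks for; the two pieces fit at [t = 0] by [cs_initial]. *)
Lemma lifted_solution (f : M -> R) (u : M -> R -> R) : continuous f ->
  cauchy_solution f u ->
  let U z t := if t <= 0 then f (proj z) else u (proj z) t in
  continuous (fun q : H3 R * R => U q.1 q.2) /\
  forall z t, 0 < t ->
    exists2 l, lap_at (fun y => U y t) z l & is_derive t 1 (U z) l.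
Proof.
move=> cf cs U; have cp : continuous proj by exact: pi_continuous.
have cpp : continuous (fun q : H3 R * R => proj q.1).
  exact: continuous_compose (@continuous_fst _ _) cp.
have cfp : continuous (fun q : H3 R * R => f (proj q.1)).
  exact: continuous_compose cpp cf.
have csnd (q0 : H3 R * R) : (fun q : H3 R * R => q.2) @ q0 --> q0.2 by exact: cvg_snd.
split => [[z t]|z t t0]; last first.
  have tn y : U y t = u (proj y) t by rewrite /U leNgt t0.
  exists (- laplacian (fun y => u (proj y) t) z).
    under [X in lap_at X]eq_fun do rewrite tn.
    exact/lap_at_C2/(cs_C2 cs).
  have := cs_heat cs z t0 => /eqP; rewrite addrC addr_eq0 => /eqP <-.
  apply: (der_near_eq (f := u (proj z))).
    near=> s; rewrite /U leNgt ifF//; apply/negbTE; rewrite negbK.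
    by near: s; exact: lt_nbhsr.
  apply: DeriveDef; first exact: cs_derivable cs _ _ t0.
  by rewrite derive1E.
have [t0|t0|->] := ltgtP t 0.
- have e : \forall q \near (z, t), f (proj q.1) = U q.1 q.2.
    have : \forall q \near (z, t), q.2 < 0.
      by have /cvgr_lt := csnd (z, t); apply.
    by apply: filterS => q /ltW q0; rewrite /U q0.
  rewrite /continuous_at /= [X in _ --> X](_ : _ = f (proj z)); last by rewrite /U (ltW t0).
  by apply: cvg_trans (near_eq_cvg e) _; exact: (cfp (z, t)).
- have e : \forall q \near (z, t), u (proj q.1) q.2 = U q.1 q.2.
    have : \forall q \near (z, t), 0 < q.2.
      by have /cvgr_gt := csnd (z, t); apply.
    by apply: filterS => q q0; rewrite /U leNgt q0.
  rewrite /continuous_at /= [X in _ --> X](_ : _ = u (proj z) t); last by rewrite /U leNgt t0.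
  apply: cvg_trans (near_eq_cvg e) _.
  have := @cs_continuous _ _ _ _ cs (proj z) t t0.
  apply: (@continuous_comp _ _ _ (fun q : H3 R * R => (proj q.1, q.2))
    (fun q : M * R => u q.1 q.2) (z, t)).
  exact: (cvg_pair (cpp (z, t)) (csnd (z, t))).
- rewrite /continuous_at /= [X in _ --> X](_ : _ = f (proj z)); last by rewrite /U lexx.
  apply/cvgrPdist_lt => e e0.
  have /cvgrPdist_lt /(_ e e0) [[A B] [/= nA nB] AB] := @cs_initial _ _ _ _ cs (proj z).
  have /cvgrPdist_lt /(_ e e0) H1 := cfp (z, 0).
  have H2 : \forall q \near (z, 0 : R), A (proj q.1).
    exact: (cpp (z, 0) _ nA).
  have H3' : \forall q \near (z, 0 : R), 0 < q.2 -> B q.2.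
    exact: (csnd (z, 0) _ nB).
  move: H1 H2 H3'; apply: filterS3 => q q1 q2 q3; rewrite /U; have [//|q0] := leP q.2 0.
  by apply: (AB (proj q.1, q.2)); split => //=; exact: q3.
Unshelve. all: by end_near. Qed.

Variables (p : M -> M -> R -> R) (hp : heat_kernel p).

Definition heat_flow (f : M -> R) (x : M) (t : R) : R :=
  fine (integralM (fun y => p x y t * f y)).

(** Contraction makes the integral finite, so [fine] does not fall back on its default value. *)
Lemma heat_flow_bounds (f : M -> R) (B : R) x (t : R) : 0 < B ->
  (forall y, 0 <= f y <= B) -> 0 < t ->
  integralM (fun y => p x y t * f y) \is a fin_num /\ 0 <= heat_flow f x t <= B.
Proof.
move=> B0 fB t0; have p0 y : 0 <= p x y t by exact: (hk_ge0 hp).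
have pf0 y : 0 <= p x y t * f y by rewrite mulr_ge0//; have /andP[] := fB y.
have I0 := integralM_ge0 pf0.
have IB : (integralM (fun y => p x y t * f y)%R <= B%:E)%E.
  apply: (@le_trans _ _ (integralM (fun y => B * p x y t))).
    apply: integralM_le => // y; rewrite mulrC ler_wpM2r//.
    by have /andP[] := fB y.
  apply: le_trans (integralM_scale_le B0 p0) _.
  rewrite -[leRHS]mule1 lee_pmul2l//; exact: hk_contraction hp _ _ t0.
have If : integralM (fun y => p x y t * f y) \is a fin_num.
  by rewrite ge0_fin_numE// (le_lt_trans IB)// ltry.
split=> //; rewrite /heat_flow fine_ge0//=.
by rewrite -lee_fin fineK.
Qed.

(** One initial value is compared at two times. Domination of [p] is asked on the support of [f]
    only; on a small support, [lam] can be taken close to the ratio of [p] at its centre. *)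
Lemma heat_flow_le (f : M -> R) (B lam : R) x (s t : R) : 0 < B ->
  (forall y, 0 <= f y <= B) -> 0 < s -> 0 < t -> 0 < lam ->
  (forall y, f y <> 0 -> p x y t <= lam * p x y s) ->
  heat_flow f x t <= lam * heat_flow f x s.
Proof.
move=> B0 fB s0 t0 lam0 pl.
have [Is _] := heat_flow_bounds x B0 fB s0; have [It _] := heat_flow_bounds x B0 fB t0.
have f0 y : 0 <= f y by have /andP[] := fB y.
rewrite /heat_flow -lee_fin EFinM !fineK//.
apply: (@le_trans _ _ (integralM (fun y => lam * (p x y s * f y)))); last first.
  by apply: integralM_scale_le => // y; rewrite mulr_ge0// (hk_ge0 hp).
apply: integralM_le => y; first by rewrite mulr_ge0// (hk_ge0 hp).
have [->|fy] := pselect (f y = 0); first by rewrite !mulr0.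
by rewrite mulrA ler_wpM2r// pl.
Qed.

(** Removes the barrier, whose contribution at a fixed point and time is of the form [C / H]. *)
Lemma lim_barrier_le (x S C h : R) : 0 <= C ->
  (forall H, 0 < H -> h <= H -> x <= S + C / H) -> x <= S.
Proof.
move=> C0 HC; apply/ler_addgt0Pr => e e0.
pose H := Num.max h (C / e + 1).
have H0 : 0 < H by rewrite lt_max ltr_wpDl ?orbT// divr_ge0// ltW.
apply: le_trans (HC H H0 _) _; first by rewrite le_max lexx.
rewrite lerD2l ler_pdivrMr//.
have : C / e <= H by rewrite le_max lerDl ler01 orbT.
by rewrite ler_pdivrMr// mulrC.
Qed.

Lemma lifted_heat_flow (f : M -> R) (B : R) : Cc f -> 0 < B ->
  (forall y, 0 <= f y <= B) -> exists U : H3 R -> R -> R,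
  [/\ continuous (fun q : H3 R * R => U q.1 q.2),
      forall z, U z 0 = f (proj z),
      forall z t, 0 < t -> U z t = heat_flow f (proj z) t,
      forall z t, 0 <= t -> 0 <= U z t <= B &
      forall z t, 0 < t ->
        exists2 l, lap_at (fun y => U y t) z l & is_derive t 1 (U z) l].
Proof.
move=> Cf B0 fB; have [cU lU] := lifted_solution Cf.1 (hk_solution hp Cf).
pose U z t := if t <= 0 then f (proj z) else heat_flow f (proj z) t.
have Ut z t : 0 < t -> U z t = heat_flow f (proj z) t by move=> t0; rewrite /U leNgt t0.
have U0 z : U z 0 = f (proj z) by rewrite /U lexx.
exists U; split => // z t; rewrite le_eqVlt => /predU1P[<-|t0]; first by rewrite U0.
by rewrite Ut//; have [] := heat_flow_bounds (proj z) B0 fB t0.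
Qed.

Section FlowOfBump.
Variables (a b : H3 R) (eta tau : R).
Hypotheses (eta0 : 0 < eta) (tau0 : 0 < tau).
Local Notation f := (@bump_on_M R Gam b eta tau).

(** On [height z <= H] the initial value is dominated by the subsum over [orbit_ball], a set that
    grows with [H]; hence [S] has to bound all finite subsums. *)
Lemma bump_flow_upper (t S : R) : 0 < t ->
  (forall F : {fset (H3 R -> H3 R)}, (forall g, g \in F -> kg_mem Gam g) ->
    kernel_sum F b a (t + tau) <= S) ->
  heat_flow f (proj a) t <= S.
Proof.
move=> t0 FS; have [B B0 fB] := bump_on_M_bounded Gam b eta0 tau0.
have fB' y : 0 <= f y <= B by rewrite fB bump_on_M_ge0.
have [U [cU U0 Ut UB lU]] := lifted_heat_flow (bump_on_M_Cc Gam b eta0 tau0) B0 fB'.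
apply: (@lim_barrier_le _ _ (B * expR (3 * t) * height a) (height a)).
  by rewrite !mulr_ge0 ?expR_ge0// ltW// height_gt0.
move=> H H0 aH; pose F := orbit_ball Gam b eta H.
have FG g : g \in F -> kg_mem Gam g by exact: orbit_ballP.
have := @max_principle R (fun z s => U z s +
  -1 * kernel_sum F b z (Num.max s 0 + tau)) B H (ltW B0) H0.
move=> /(_ _ _ _ _ a t (ltW t0) aH) /wrap[||||].
- apply: continuous_add => //; apply: continuous_mul; first exact: continuous_cst.
  exact: continuous_kernel_sum.
- move=> z zH; rewrite U0 mulN1r subr_le0 maxxx add0r.
  exact: bump_on_M_le.
- move=> z s s0; rewrite mulN1r lerBlDr (@le_trans _ _ B)//; last first.
    by rewrite lerDl kernel_sum_ge0.
  by have /andP[] := UB z s s0.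
- move=> z s s0; have [l1 lap1 der1] := lU z s s0.
  have [l2 lap2 der2] := shifted_kernel_sum F b z s0 tau0.
  exists (l1 + -1 * l2); first exact/lap_atD/lap_atZ.
  by apply: derD.
have -> : B * expR (3 * t) * height a / H = B / H * expR (3 * t) * height a.
  by rewrite mulrAC [B / H * _]mulrAC.
by rewrite Ut// max_l ?(ltW t0)// mulN1r lerBlDl => /le_trans; apply; rewrite lerD2r FS.
Qed.

(** Here [F] is fixed. Constants solve the heat equation, so the total truncation error
    [(size F)%:R * cutoff eta tau] is carried unchanged to time [t]. *)
Lemma bump_flow_lower (t : R) (F : {fset (H3 R -> H3 R)}) : 0 < t ->
  (forall g, g \in F -> kg_mem Gam g) ->
  kernel_sum F b a (t + tau) - (size F)%:R * cutoff eta tau <=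
    heat_flow f (proj a) t.
Proof.
move=> t0 FG; have [B B0 fB] := bump_on_M_bounded Gam b eta0 tau0.
have fB' y : 0 <= f y <= B by rewrite fB bump_on_M_ge0.
have [U [cU U0 Ut UB lU]] := lifted_heat_flow (bump_on_M_Cc Gam b eta0 tau0) B0 fB'.
(* The peak of the kernel at time [tau] without its factor [expR (- tau)]; it bounds each term at
   all later times. *)
pose D : R := (size F)%:R * expR (- (3 / 2) * ln tau).
have D0 : 0 <= D by rewrite mulr_ge0// expR_ge0.
apply: (@lim_barrier_le _ _ (D * expR (3 * t) * height a) (height a)).
  by rewrite !mulr_ge0 ?expR_ge0// ltW// height_gt0.
move=> H H0 aH; pose k : R := (size F)%:R * cutoff eta tau.
have k0 : 0 <= k by rewrite mulr_ge0// expR_ge0.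
have := @max_principle R (fun z s => kernel_sum F b z (Num.max s 0 + tau) +
  (- k + -1 * U z s)) D H D0 H0.
move=> /(_ _ _ _ _ a t (ltW t0) aH) /wrap[||||].
- apply: continuous_add; first exact: continuous_kernel_sum.
  apply: continuous_add; first exact: continuous_cst.
  by apply: continuous_mul => //; exact: continuous_cst.
- move=> z zH; rewrite U0 mulN1r maxxx add0r addrA subr_le0.
  exact: bump_on_M_ge.
- move=> z s s0; have /andP[Us0 _] := UB z s s0.
  rewrite max_l// (@le_trans _ _ (kernel_sum F b z (s + tau)))//.
    by rewrite gerDl mulN1r -opprD oppr_le0 addr_ge0.
  have st0 : 0 < s + tau by rewrite ltr_wpDl.
  apply: le_trans (kernel_sum_le _ _ _ st0) _; rewrite ler_wpM2l// ler_expR.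
  have : ln tau <= ln (s + tau) by rewrite ler_ln ?posrE// lerDr.
  lra.
- move=> z s s0; have [l1 lap1 der1] := lU z s s0.
  have [l2 lap2 der2] := shifted_kernel_sum F b z s0 tau0.
  exists (l2 + (0 + -1 * l1)).
    by apply: lap_atD => //; apply: lap_atD; [exact: lap_at_cst|exact: lap_atZ].
  by apply: derD.
rewrite Ut// max_l ?(ltW t0)// mulN1r -/k => H1.
have -> : D * expR (3 * t) * height a / H = D / H * expR (3 * t) * height a.
  by rewrite mulrAC [D / H * _]mulrAC.
lra.
Qed.

End FlowOfBump.

(** The flow of the bump is at least the [F]-subsum at time [t], up to truncation, and at most [S]
    at time [s]; on a small support the two flows compare like the values of [p]. The sums behind
    [S] are taken slightly after [s], since the bump already has age [tau]. *)
Lemma kernel_cross_bound (a b : H3 R) (s t S : R) : 0 < s -> 0 < t ->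
  0 < p (proj a) (proj b) s ->
  (forall (tau : R) (F : {fset (H3 R -> H3 R)}), 0 < tau -> tau <= 1 ->
    (forall g, g \in F -> kg_mem Gam g) -> kernel_sum F b a (s + tau) <= S) ->
  forall F : {fset (H3 R -> H3 R)}, (forall g, g \in F -> kg_mem Gam g) ->
  kernel_sum F b a t * p (proj a) (proj b) s <= p (proj a) (proj b) t * S.
Proof.
move=> s0 t0 ps0 FS F FG; set x := proj a; set y := proj b.
set K := kernel_sum F b a t; have K0 : 0 <= K by exact: kernel_sum_ge0.
have pt0 : 0 <= p x y t by exact: (hk_ge0 hp).
have S0 : 0 <= S by apply: le_trans (FS 1 F _ _ FG); rewrite ?kernel_sum_ge0.
have close (r e : R) : 0 < r -> 0 < e -> exists2 eta : R, 0 < eta &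
    forall z, hdist z b <= eta -> `|p x y r - p x (proj z) r| < e.
  move=> r0 e0; apply: hdist_nbhs.
  have cz : (fun z : H3 R => (x, proj z, r)) @ b --> (x, y, r).
    have c1 : (fun _ : H3 R => x) @ b --> x by exact: (@cst_continuous (H3 R) M x b).
    have c2 : proj @ b --> y by exact: pi_continuous.
    have c3 : (fun _ : H3 R => r) @ b --> r by exact: (@cst_continuous (H3 R) R r b).
    exact: cvg_pair (cvg_pair c1 c2) c3.
  have /cvgrPdist_lt := cvg_comp _ _ cz (@hk_continuous _ _ _ hp x y r r0).
  by apply.
(* When the product is expanded, the errors amount to at most [e * D]. *)
suff main (e : R) : 0 < e -> e < p x y s -> (K - e) * (p x y s - e) <= (p x y t + e) * S.
  apply/ler_addgt0Pr => d d0; pose D := K + p x y s + S.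
  have D0 : 0 < D by rewrite ltr_wpDr// ltr_wpDl.
  pose e := Num.min (p x y s / 2) (d / D).
  have e0 : 0 < e by rewrite lt_min !divr_gt0.
  have ep : e < p x y s by rewrite gt_min ltr_pdivrMr//; apply/orP; left; rewrite ltr_pMr// ltr1n.
  have ed : e * D <= d by rewrite -ler_pdivlMr// ge_min lexx orbT.
  have := main e e0 ep; move: ed; rewrite /D; have := sqr_ge0 e; lra.
move=> e0 es; have [eta1 eta10 H1] := close s e s0 e0.
have [eta2 eta20 H2] := close t e t0 e0.
pose eta := Num.min eta1 eta2; have eta0 : 0 < eta by rewrite lt_min eta10.
(* [eta] is fixed before [tau]: [cutoff] is then [O(tau)], and continuity in time of the finite sum
   absorbs the shift by [tau]. *)
have [tau [tau0 tau1 tauK tauc]] : exists tau : R, [/\ 0 < tau, tau <= 1,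
    K - e / 2 <= kernel_sum F b a (t + tau) &
    (size F)%:R * cutoff eta tau <= e / 2].
  have e20 : 0 < e / 2 by rewrite divr_gt0.
  have [l _ /der_continuous cK] := lap_at_kernel_sum F b a t0.
  have sh : (fun h : R => t + h) @ (0 : R) --> t.
    by rewrite -[X in _ --> X]addr0; apply: cvgD; [exact: cvg_cst|exact: cvg_id].
  have /cvgrPdist_le /(_ _ e20) /near0_ex[r r0 Hr] := cvg_comp _ _ sh cK.
  pose C : R := (size F)%:R * (27 * 64 / eta ^+ 6).
  have C0 : 0 <= C by rewrite mulr_ge0// divr_ge0// exprn_ge0// ltW.
  pose tau := Num.min (r / 2) (Num.min 1 (e / 2 / (C + 1))).
  have C1 : 0 < C + 1 by rewrite ltr_wpDl.
  have tau0 : 0 < tau by rewrite !lt_min ltr01 !divr_gt0.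
  have tau1 : tau <= 1 by rewrite !ge_min lexx orbT.
  have taur : tau < r by rewrite gt_min ltr_pdivrMr//; apply/orP; left; rewrite ltr_pMr// ltr1n.
  have tauC : tau * (C + 1) <= e / 2 by rewrite -ler_pdivlMr// !ge_min lexx !orbT.
  exists tau; split => //.
    have := Hr tau; rewrite gtr0_norm// => /(_ taur) /=.
    by rewrite -/K ler_norml => /andP[_]; lra.
  apply: (@le_trans _ _ (C * tau)).
    by have := ler_wpM2l (ler0n R (size F)) (cutoff_le eta0 tau0 tau1); rewrite mulrA.
  by apply: le_trans tauC; rewrite mulrC ler_pM2l// lerDl.
have [B B0 fB] := bump_on_M_bounded Gam b eta0 tau0.
pose f (z : M) := bump_on_M b eta tau z.
have fB' z : 0 <= f z <= B by rewrite /f fB bump_on_M_ge0.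
(* Within [eta] of [b], [p] is below [p x y t + e] at time [t] and above [p x y s - e] at time
   [s]. *)
pose lam := (p x y t + e) / (p x y s - e).
have ps : 0 < p x y s - e by rewrite subr_gt0.
have lam0 : 0 < lam by rewrite divr_gt0// ltr_wpDl.
have : heat_flow f x t <= lam * heat_flow f x s.
  apply: (heat_flow_le B0 fB' s0 t0 lam0) => z /(bump_on_M_supp eta0 tau0)[w wb ->].
  have /H1 : hdist w b <= eta1 by rewrite (le_trans wb)// ge_min lexx.
  have /H2 : hdist w b <= eta2 by rewrite (le_trans wb)// ge_min lexx orbT.
  rewrite !ltr_norml => /andP[h1 h2] /andP[h3 h4].
  rewrite /lam mulrAC ler_pdivlMr//; apply: ler_pM => //; [exact: (hk_ge0 hp)|exact: ltW|lra|lra].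
have up : heat_flow f x s <= S.
  by apply: bump_flow_upper => // F' F'G; exact: FS.
have low := @bump_flow_lower a b eta tau eta0 tau0 t F t0 FG.
move=> fl; have Kl : K - e <= lam * S.
  have := ler_wpM2l (ltW lam0) up; lra.
have := ler_wpM2r (ltW ps) Kl.
by rewrite /lam mulrAC divfK ?gt_eqF.
Qed.

End Comparison.

(** * From the heat kernel to the orbital function *)

Section Sums.
Context {R : realType}.
Implicit Types (x a t lam : R).

Lemma one_sub_expRN lam : 0 < lam -> lam / (1 + lam) <= 1 - expR (- lam).
Proof.
move=> l0; have l1 : 0 < 1 + lam by rewrite ltr_wpDl.
rewrite ler_pdivrMr// expRN.
have : (expR lam)^-1 * (1 + lam) <= 1.
  by rewrite mulrC ler_pdivrMr ?expR_gt0// mul1r expR_ge1Dx.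
lra.
Qed.

Lemma sum_expRN_dist lam x n : 0 < lam ->
  \sum_(k < n) expR (- (lam * `|k%:R - x|)) <= 2 * ((1 + lam) / lam).
Proof.
move=> l0; set L := (1 + lam) / lam.
have L0 : 0 < L by rewrite divr_gt0// ltr_wpDl.
(* telescoping majorants for the terms right and left of [x] *)
pose psi (y : R) := Num.min 1 (expR (- (lam * (y - x)))).
pose phi (y : R) := Num.min 1 (expR (lam * (y - x))).
have psi_anti (y : R) : psi (y + 1) <= psi y.
  rewrite /psi le_min ge_min lexx /= ge_min ler_expR lerN2 ler_pM2l//.
  by rewrite lerD2r lerDl ler01 orbT.
have phi_mono (y : R) : phi (y - 1) <= phi y.
  rewrite /phi le_min ge_min lexx /= ge_min ler_expR ler_pM2l//.
  by rewrite lerD2r gerDl lerN10 orbT.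
have term (y : R) : expR (- (lam * `|y - x|)) <=
    L * ((psi y - psi (y + 1)) + (phi y - phi (y - 1))).
  have e1 : 1 <= L * (1 - expR (- lam)).
    have := ler_wpM2l (ltW L0) (one_sub_expRN l0).
    by rewrite {1}/L mulrA divfK ?gt_eqF// divff// gt_eqF// ltr_wpDl.
  have [xy|yx] := leP x y.
    rewrite ger0_norm ?subr_ge0//; set E := expR _.
    apply: (@le_trans _ _ (L * (psi y - psi (y + 1)))); last first.
      by rewrite ler_pM2l// lerDl subr_ge0.
    have E1 : E <= 1 by rewrite -expR0 ler_expR oppr_le0 mulr_ge0 ?subr_ge0// ltW.
    have -> : psi y = E by apply: min_r.
    have E2 : expR (- (lam * (y + 1 - x))) = E * expR (- lam).
      by rewrite -expRD; congr expR; ring.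
    have E0 : 0 < E by exact: expR_gt0.
    have -> : psi (y + 1) = E * expR (- lam).
      rewrite /psi E2; apply: min_r; rewrite (le_trans _ E1)// ger_pMr//.
      by rewrite -expR0 ler_expR oppr_le0 ltW.
    have := ler_wpM2l (ltW E0) e1; rewrite mulr1 => /le_trans; apply.
    by rewrite le_eqVlt; apply/orP; left; apply/eqP; ring.
  rewrite ltr0_norm ?subr_lt0//.
  have -> : - (lam * - (y - x)) = lam * (y - x) by ring.
  set E := expR _.
  apply: (@le_trans _ _ (L * (phi y - phi (y - 1)))); last first.
    by rewrite ler_pM2l// lerDr subr_ge0.
  have E1 : E <= 1.
    by rewrite -expR0 ler_expR pmulr_rle0// subr_le0 ltW.
  have -> : phi y = E by apply: min_r.
  have E2 : expR (lam * (y - 1 - x)) = E * expR (- lam).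
    by rewrite -expRD; congr expR; ring.
  have E0 : 0 < E by exact: expR_gt0.
  have -> : phi (y - 1) = E * expR (- lam).
    rewrite /phi E2; apply: min_r; rewrite (le_trans _ E1)// ger_pMr//.
    by rewrite -expR0 ler_expR oppr_le0 ltW.
  have := ler_wpM2l (ltW E0) e1; rewrite mulr1 => /le_trans; apply.
  by rewrite le_eqVlt; apply/orP; left; apply/eqP; ring.
have tel : \sum_(k < n) ((psi k%:R - psi (k%:R + 1)) + (phi k%:R - phi (k%:R - 1)))
    = (psi 0 - psi n%:R) + (phi (n%:R - 1) - phi (- 1)).
  elim: n => [|n IH]; first by rewrite big_ord0 sub0r; ring.
  by rewrite big_ord_recr /= IH -natr1 addrK; ring.
apply: le_trans (ler_sum _ (fun (k : 'I_n) _ => term k%:R)) _.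
rewrite -mulr_sumr tel [leRHS]mulrC ler_pM2l//.
have p1 : psi 0 <= 1 by rewrite ge_min lexx.
have p2 : 0 <= psi n%:R by rewrite le_min ler01 expR_ge0.
have p3 : phi (n%:R - 1) <= 1 by rewrite ge_min lexx.
have p4 : 0 <= phi (- 1) by rewrite le_min ler01 expR_ge0.
lra.
Qed.

Definition gauss a x y : R := expR (- ((y - x) / (2 * a)) ^+ 2).

Lemma expR_quarter : expR (4^-1) <= 4 / 3 :> R.
Proof.
have := expR_ge1Dx (- 4^-1 : R); rewrite expRN.
have e0 : 0 < expR (4^-1) :> R by exact: expR_gt0.
rewrite -(ler_pM2r e0) mulVf ?gt_eqF//; lra.
Qed.

(** For [u = |y - x| / (2 * a)], [u ^+ 2 >= u - 1 / 4]. The exponential on the right is summed by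
    [sum_expRN_dist]. *)
Lemma gauss_le a x y : 0 < a ->
  gauss a x y <= 4 / 3 * expR (- ((2 * a)^-1 * `|y - x|)).
Proof.
move=> a0; apply: (@le_trans _ _ (expR 4^-1 * expR (- ((2 * a)^-1 * `|y - x|)))).
  rewrite -expRD ler_expR.
  have -> : ((y - x) / (2 * a)) ^+ 2 = (`|y - x| / (2 * a)) ^+ 2.
    by rewrite !exprMn real_normK ?num_real.
  rewrite [_^-1 * _]mulrC; move: (_ / (2 * a)) => u.
  have := sqr_ge0 (u - 2^-1); rewrite sqrrB; nra.
by rewrite ler_wpM2r ?expR_ge0 ?expR_quarter.
Qed.

Lemma sum_gauss a x n : 1 <= a -> \sum_(k < n) gauss a x k%:R <= 8 * a.
Proof.
move=> a1; have a0 : 0 < a by rewrite (lt_le_trans ltr01).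
apply: le_trans (ler_sum _ (fun (k : 'I_n) _ => gauss_le x k%:R a0)) _.
rewrite -mulr_sumr.
have l0 : 0 < (2 * a)^-1 by rewrite invr_gt0 mulr_gt0.
have := sum_expRN_dist x n l0; set s := \sum_(k < n) _ => sl.
have e : (1 + (2 * a)^-1) / (2 * a)^-1 = 2 * a + 1 by field; rewrite gt_eqF.
by rewrite e in sl; lra.
Qed.

(** Half of the exponential decay absorbs the factor [|y - x|], and the other half is summed. *)
Lemma sum_dist_gauss a x n : 1 <= a ->
  \sum_(k < n) `|k%:R - x| * gauss a x k%:R <= 54 * a ^+ 2.
Proof.
move=> a1; have a0 : 0 < a by rewrite (lt_le_trans ltr01).
have term y : `|y - x| * gauss a x y <= 16 / 3 * a * expR (- ((4 * a)^-1 * `|y - x|)).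
  set d := `|y - x|; have d0 : 0 <= d by exact: normr_ge0.
  apply: le_trans (ler_wpM2l d0 (gauss_le x y a0)) _; rewrite -/d.
  have -> : expR (- ((2 * a)^-1 * d)) = expR (- ((4 * a)^-1 * d)) ^+ 2.
    by rewrite -expRM_natl; congr expR; field; rewrite gt_eqF.
  set E := expR _; have E0 : 0 < E by exact: expR_gt0.
  have : d * E <= 4 * a.
    rewrite /E expRN ler_pdivrMr ?expR_gt0//.
    have a40 : 0 < 4 * a by rewrite mulr_gt0.
    have := expR_ge1Dx ((4 * a)^-1 * d); rewrite -(ler_pM2l a40) => /(le_trans _); apply.
    have -> : 4 * a * (1 + (4 * a)^-1 * d) = 4 * a + d by field; rewrite gt_eqF.
    by rewrite lerDr ltW.
  move=> /(ler_wpM2r (ltW E0)); lra.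
apply: le_trans (ler_sum _ (fun (k : 'I_n) _ => term k%:R)) _.
rewrite -mulr_sumr.
have l0 : 0 < (4 * a)^-1 by rewrite invr_gt0 mulr_gt0.
have := sum_expRN_dist x n l0; set s := \sum_(k < n) _ => sl.
have e : (1 + (4 * a)^-1) / (4 * a)^-1 = 4 * a + 1 by field; rewrite gt_eqF.
rewrite e in sl; have := ler_wpM2l (ltW a0) sl.
have := ler_wpM2l (ltW a0) a1; lra.
Qed.

(** Up to a constant, [e ^ (2 * y)] times the kernel at distance [y] and time
    [t]; the Gaussian shape comes from completing the square. *)
Definition weight t y : R := (y + 2) * (Num.sqrt t ^- 3 * gauss (Num.sqrt t) (2 * t) y).

Lemma weight_ge0 t y : 0 <= y -> 0 <= weight t y.
Proof.
by move=> y0; rewrite !mulr_ge0 ?addr_ge0 ?invr_ge0 ?exprn_ge0 ?sqrtr_ge0 ?expR_ge0.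
Qed.

(** For [t >= 1], [y + 2 <= |y - 2 * t| + 4 * t]; with [a = Num.sqrt t] the two sums give at most
    [54 * a ^+ 2 + 32 * a ^+ 3 <= 86 * a ^+ 3]. *)
Lemma sum_weight t n : 1 <= t -> \sum_(k < n) weight t k%:R <= 86.
Proof.
move=> t1; set a := Num.sqrt t.
have a1 : 1 <= a by rewrite -sqrtr1 ler_sqrt// (le_trans ler01).
have a0 : 0 < a by rewrite (lt_le_trans ltr01).
have ta : t = a ^+ 2 by rewrite sqr_sqrtr// (le_trans ler01).
have ai0 : 0 < a ^- 3 by rewrite invr_gt0 exprn_gt0.
have term (k : 'I_n) : weight t k%:R <= a ^- 3 *
    (`|k%:R - 2 * t| * gauss a (2 * t) k%:R + 4 * a ^+ 2 * gauss a (2 * t) k%:R).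
  rewrite /weight -/a mulrCA ler_pM2l// -mulrDl ler_wpM2r ?expR_ge0//.
  have := ler_norm (k%:R - 2 * t); rewrite -ta; lra.
apply: le_trans (ler_sum _ (fun k _ => term k)) _.
rewrite -mulr_sumr big_split /= -mulr_sumr mulrC ler_pdivrMr ?exprn_gt0//.
have := sum_dist_gauss (2 * t) n a1; have := sum_gauss (2 * t) n a1.
set s1 := \sum_(k < n) _; set s2 := \sum_(k < n) _ => h1 h2.
have a20 : 0 <= a ^+ 2 by rewrite sqr_ge0.
have := ler_wpM2l a20 h1.
have := ler_wpM2l a20 a1.
rewrite !exprS expr0; nra.
Qed.

End Sums.

(** * Kernel sums against orbit counts *)

Section Counting.
Context {R : realType}.
Implicit Types (r t y : R).

(** Completion of the square: [((y - 2 * t) / (2 * Num.sqrt t)) ^+ 2 = y ^+ 2 / (4 * t) - y + t]. *)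
Lemma kernel_weightE t y : 0 < t ->
  expR (- y) * expR (- (3 / 2) * ln t - t - y ^+ 2 / (4 * t)) =
  expR (- (2 * y)) * (Num.sqrt t ^- 3 * gauss (Num.sqrt t) (2 * t) y).
Proof.
move=> t0; set a := Num.sqrt t; have a0 : 0 < a by rewrite sqrtr_gt0.
have ta : t = a ^+ 2 by rewrite sqr_sqrtr// ltW.
have -> : a ^- 3 = expR (- (3 / 2) * ln t).
  have -> : - (3 / 2) * ln t = - (3%:R * ln a).
    by rewrite ta lnXn// mulr2n; field.
  by rewrite expRN expRM_natl lnK.
rewrite /gauss -!expRD; congr expR; rewrite ta; field.
by rewrite gt_eqF.
Qed.

Lemma hyp_kernel_weight_le r t : 0 <= r -> 0 < t ->
  hyp_kernel r t <= 2 * expR (- (2 * (Num.truncn r)%:R)) * weight t (Num.truncn r)%:R.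
Proof.
move=> r0 t0; set k := (Num.truncn r)%:R.
have /andP[kr rk] := truncn_itv r0; rewrite -/k in kr; rewrite -natr1 -/k in rk.
have k0 : 0 <= k by exact: ler0n.
rewrite /weight -mulrA [_ * ((k + 2) * _)]mulrCA -kernel_weightE//.
apply: (@le_trans _ _ (2 * ((1 + r) * expR (- r)) *
    expR (- (3 / 2) * ln t - t - r ^+ 2 / (4 * t)))).
  by rewrite ler_wpM2r ?expR_ge0// sinhc_inv_le.
set E := expR (_ - r ^+ 2 / _).
have -> : 2 * ((1 + r) * expR (- r)) * E = 2 * ((1 + r) * (expR (- r) * E)).
  by ring.
rewrite ler_pM2l//; apply: ler_pM.
- by rewrite addr_ge0.
- by rewrite mulr_ge0 ?expR_ge0.
- lra.
apply: ler_pM; rewrite ?expR_ge0// ler_expR; first by rewrite lerN2.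
rewrite lerD2l lerN2 ler_wpM2r ?invr_ge0 ?mulr_ge0 ?(ltW t0)//.
by rewrite ler_sqr ?nnegrE.
Qed.

(** An orbit point at distance [r] is counted at every radius [k >= r]. The factor
    [expR (- (2 * k%:R))] makes this repeated counting harmless: the sum over [k] is comparable to
    its first terms. *)
Lemma hyp_kernel_weight_ge r t (m : nat) : 0 <= r -> 0 < t ->
  \sum_(k < m) (r <= k%:R)%R%:R * (expR (- (2 * k%:R)) *
    ((1 + k%:R) * (Num.sqrt t ^- 3 * gauss (Num.sqrt t) (2 * t) k%:R))) <=
  24 * hyp_kernel r t.
Proof.
move=> r0 t0; pose E y : R := expR (- (3 / 2) * ln t - t - y ^+ 2 / (4 * t)).
set c := (1 + r) * expR (- r) * E r.
have c0 : 0 <= c by rewrite !mulr_ge0 ?expR_ge0// addr_ge0.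
have term (k : 'I_m) : (r <= k%:R)%R%:R * (expR (- (2 * k%:R)) *
    ((1 + k%:R) * (Num.sqrt t ^- 3 * gauss (Num.sqrt t) (2 * t) k%:R))) <=
    2 * c * expR (- (2^-1 * `|k%:R - r|)).
  have [rk|] := boolP (r <= k%:R); last first.
    by move=> _; rewrite mul0r mulr_ge0 ?expR_ge0// mulr_ge0.
  rewrite mul1r mulrCA -kernel_weightE// -/(E k%:R) ger0_norm ?subr_ge0//.
  set u : R := k%:R - r; have u0 : 0 <= u by rewrite subr_ge0.
  have -> : k%:R = r + u :> R by rewrite addrC subrK.
  have Ele : E (r + u) <= E r.
    rewrite ler_expR lerD2l lerN2 ler_wpM2r ?invr_ge0 ?mulr_ge0 ?(ltW t0)//.
    rewrite -subr_ge0.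
    have -> : (r + u) ^+ 2 - r ^+ 2 = u * (2 * r + u) by ring.
    by rewrite mulr_ge0// addr_ge0// mulr_ge0.
  (* Moving out from [r] to [r + u] costs at most this factor, whose sum over [k] is bounded. *)
  have ue : (1 + u) * expR (- u) <= 2 * expR (- (2^-1 * u)).
    have -> : expR (- u) = expR (- (2^-1 * u)) ^+ 2.
      by rewrite -expRM_natl; congr expR; field.
    set e := expR _; have e0 : 0 < e by exact: expR_gt0.
    have : (1 + 2^-1 * u) * e <= 1.
      by rewrite /e expRN ler_pdivrMr ?expR_gt0// mul1r expR_ge1Dx.
    move=> /(ler_wpM2r (ltW e0)); nra.
  have -> : - (r + u) = - r + - u by ring.
  rewrite expRD.
  apply: (@le_trans _ _ ((1 + r) * (1 + u) * (expR (- r) * expR (- u) * E r))).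
    have ee0 : 0 <= expR (- r) * expR (- u).
      by apply: mulr_ge0; exact: expR_ge0.
    apply: ler_pM.
    - by rewrite addr_ge0// addr_ge0.
    - by apply: mulr_ge0 => //; exact: expR_ge0.
    - by have := mulr_ge0 r0 u0; lra.
    - exact: ler_wpM2l.
  have := ler_wpM2l c0 ue; rewrite /c; lra.
apply: le_trans (ler_sum _ (fun k _ => term k)) _; rewrite -mulr_sumr.
have l0 : 0 < 2^-1 :> R by rewrite invr_gt0.
have := sum_expRN_dist r m l0; set s := \sum_(k < m) _ => sl.
have e6 : 2 * ((1 + 2^-1) / 2^-1) = 6 :> R by field.
rewrite e6 in sl.
have : c <= 2 * hyp_kernel r t.
  rewrite /hyp_kernel mulrA ler_wpM2r ?expR_ge0//.
  by have := sinhc_inv_ge r0; lra.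
have := ler_wpM2l c0 sl; lra.
Qed.

Variables (Gam : kleinian_group R) (a b : H3 R).

Definition orbit_count r : R := (#|` fset_set (orbital_set Gam a b r)|%fset)%:R.

Lemma mem_orbital g r : (g \in fset_set (orbital_set Gam a b r)) =
  `[< kg_mem Gam g /\ hdist a (g b) <= r >].
Proof.
rewrite in_fset_set; last exact: orbital_set_finite.
by apply/idP/asboolP; rewrite inE.
Qed.

Lemma sum_mem (F A : {fset (H3 R -> H3 R)}) :
  \sum_(g <- F) (g \in A)%:R = (count (fun g => g \in A) F)%:R :> R.
Proof.
elim: (F : seq _) => [|g s IH]; first by rewrite big_nil.
by rewrite big_cons /= IH natrD.
Qed.

(** Each [g] is charged to the shell of distances from [k] to [k + 1], whose elements are among
    those counted at radius [k.+1]; [J] lies beyond all shells that [F] meets. *)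
Lemma kernel_sum_le_count (F : {fset (H3 R -> H3 R)}) t : 0 < t ->
  (forall g, g \in F -> kg_mem Gam g) ->
  exists J : nat, kernel_sum F b a t <=
    \sum_(k < J) orbit_count k.+1%:R * (2 * expR (- (2 * k%:R)) * weight t k%:R).
Proof.
move=> t0 FG; pose J := (\max_(g <- F) (Num.truncn (hdist a (g b))).+1)%N.
exists J; have wk0 (k : nat) : 0 <= 2 * expR (- (2 * k%:R)) * weight t k%:R.
  by rewrite !mulr_ge0 ?expR_ge0 ?weight_ge0.
pose A (k : nat) := fset_set (orbital_set Gam a b k.+1%:R).
apply: (@le_trans _ _ (\sum_(g <- F) \sum_(k < J)
    (g \in A k)%:R * (2 * expR (- (2 * k%:R)) * weight t k%:R))).
  rewrite /kernel_sum big_seq [leRHS]big_seq; apply: ler_sum => g gF.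
  set d := hdist a (g b); have d0 : 0 <= d by exact: hdist_ge0.
  have kJ : (Num.truncn d < J)%N by rewrite /J (big_fsetD1 g)//= leq_max leqnn.
  rewrite (bigD1 (Ordinal kJ))//= /A mem_orbital.
  have -> : `[< kg_mem Gam g /\ hdist a (g b) <= (Num.truncn d).+1%:R >] = true.
    by apply/asboolP; split; [exact: FG|exact/ltW/truncnS_gt].
  rewrite mul1r; apply: le_trans (hyp_kernel_weight_le d0 t0) _.
  by rewrite lerDl; apply: sumr_ge0 => k _; rewrite mulr_ge0.
rewrite exchange_big /=; apply: ler_sum => k _.
rewrite -mulr_suml ler_wpM2r// sum_mem ler_nat -size_filter.
apply: uniq_leq_size; first by rewrite filter_uniq// fset_uniq.
by move=> g; rewrite mem_filter => /andP[].
Qed.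

(** Everything counted at a radius [k <= m] lies in the ball of radius [m]; exchanging the sums
    leaves, for each [g], the sum in [hyp_kernel_weight_ge]. *)
Lemma count_le_kernel_sum (m : nat) t : 0 < t ->
  \sum_(k < m.+1) orbit_count k%:R * (expR (- (2 * k%:R)) *
    ((1 + k%:R) * (Num.sqrt t ^- 3 * gauss (Num.sqrt t) (2 * t) k%:R))) <=
  24 * kernel_sum (fset_set (orbital_set Gam a b m%:R)) b a t.
Proof.
move=> t0; set F := fset_set _.
pose c (k : nat) : R := expR (- (2 * k%:R)) *
    ((1 + k%:R) * (Num.sqrt t ^- 3 * gauss (Num.sqrt t) (2 * t) k%:R)).
have c0 k : 0 <= c k.
  by rewrite !mulr_ge0 ?expR_ge0 ?invr_ge0 ?exprn_ge0 ?sqrtr_ge0 ?addr_ge0.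
apply: (@le_trans _ _ (\sum_(g <- F) \sum_(k < m.+1) (hdist a (g b) <= k%:R)%R%:R * c k)).
  rewrite exchange_big /=; apply: ler_sum => k _; rewrite -mulr_suml ler_wpM2r//; first exact: c0.
  pose A := fset_set (orbital_set Gam a b k%:R).
  have -> : \sum_(g <- F) (hdist a (g b) <= k%:R)%R%:R = \sum_(g <- F) (g \in A)%:R :> R.
    rewrite big_seq [RHS]big_seq; apply: eq_bigr => g gF; congr (_%:R).
    move: gF; rewrite !mem_orbital => /asboolP[Gg _].
    by congr nat_of_bool; apply/idP/asboolP => [//|[]].
  rewrite sum_mem ler_nat -size_filter; apply: uniq_leq_size; first exact: fset_uniq.
  move=> g gA; rewrite mem_filter gA /=; move: gA; rewrite !mem_orbital.
  move=> /asboolP[Gg gk]; apply/asboolP; split => //; rewrite (le_trans gk)//.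
  by rewrite ler_nat -ltnS.
rewrite /kernel_sum mulr_sumr; apply: ler_sum => g _.
by apply: hyp_kernel_weight_ge => //; exact: hdist_ge0.
Qed.

End Counting.

(** * Roughly decreasing sequences under Gaussian averages *)

Section Growth.
Context {R : realType}.
Implicit Types (alpha C D x t : R) (n : nat -> R).

Lemma ln_le_sub1 x : 0 < x -> ln x <= x - 1.
Proof.
move=> x0; rewrite -ler_expR lnK//.
by have := expR_ge1Dx (x - 1); rewrite addrCA subrr addr0.
Qed.

(** [ln] lies below its tangent at [b / c]; taking [b = beta + 1] keeps that point positive when
    [beta = 0]. *)
Lemma powR_expR_bound (beta c : R) : 0 <= beta -> 0 < c ->
  exists2 C, 0 < C & forall x, 1 <= x -> x `^ beta <= C * expR (c * x).
Proof.
move=> b0 c0; pose b := beta + 1; have bp : 0 < b by rewrite ltr_wpDl.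
exists (expR (b * ln (b / c))); first exact: expR_gt0.
move=> x x1; have x0 : 0 < x by rewrite (lt_le_trans ltr01).
rewrite /powR gt_eqF// -expRD ler_expR.
have lx : 0 <= ln x by exact: ln_ge0.
have bc : 0 < b / c by rewrite divr_gt0.
have y0 : 0 < x / (b / c) by rewrite divr_gt0.
have xE : ln x = ln (b / c) + ln (x / (b / c)).
  by rewrite -lnM ?posrE// [b / c * _]mulrC divfK// gt_eqF.
have := ler_wpM2l (ltW bp) (ln_le_sub1 y0).
have -> : b * (x / (b / c) - 1) = c * x - b by field; rewrite !gt_eqF.
have : beta * ln x <= b * ln x by rewrite ler_wpM2r// /b lerDl.
rewrite xE !mulrDr; lra.
Qed.

Lemma le_powRN alpha x y : 0 <= alpha -> 0 < x -> x <= y ->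
  y `^ (- alpha) <= x `^ (- alpha).
Proof.
move=> a0 x0 xy; have y0 := lt_le_trans x0 xy.
rewrite !powRN lef_pV2 ?posrE ?powR_gt0//.
by apply: ge0_ler_powR => //; rewrite nnegrE ltW.
Qed.

Lemma powR_half alpha x : 0 < x ->
  (x / 2) `^ (- alpha) = 2 `^ alpha * x `^ (- alpha).
Proof.
by move=> x0; rewrite powRM ?invr_ge0 ?(ltW x0)// -powR_inv1// -powRrM mulrC mulN1r opprK.
Qed.

(** At [t = m / 2] the Gaussian is centred at [m], and each of about [sqrt m] terms just below [m]
    is at least [n m / (4 * C * sqrt m)]. The condition [4 <= m] gives [2 * sqrt m <= m], and
    [k0.*2 <= m] keeps these indices in the range of rough decrease. *)
Lemma upper_growth alpha C D n (k0 m1 : nat) : 0 < C -> 0 <= D ->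
  (forall k, 0 <= n k) ->
  (forall j k, (k0 <= j)%N -> (j <= k)%N -> n k <= C * n j) ->
  (forall m, (m1 <= m)%N -> let t := m%:R / 2 in
    \sum_(k < m.+1) n k * ((1 + k%:R) *
      (Num.sqrt t ^- 3 * gauss (Num.sqrt t) (2 * t) k%:R)) <= D * m%:R `^ (- alpha)) ->
  forall m, (maxn (maxn 4 m1) k0.*2 <= m)%N -> n m <= 4 * C * D * m%:R `^ (- alpha).
Proof.
move=> C0 D0 n0 rough sumD m; rewrite !geq_max => /andP[/andP[m4 mm1] mk0].
have := sumD m mm1 => /=; set t := m%:R / 2; set a := Num.sqrt t.
have m0 : 0 < m%:R :> R by rewrite ltr0n; apply: leq_trans m4.
have t0 : 0 < t by rewrite divr_gt0.
have a0 : 0 < a by rewrite sqrtr_gt0.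
have t2 : 2 * t = m%:R by rewrite /t mulrC divfK.
have a2 : a ^+ 2 = m%:R / 2 by rewrite sqr_sqrtr// ltW.
pose s : R := Num.sqrt m%:R; have s0 : 0 < s by rewrite sqrtr_gt0.
have s2 : s ^+ 2 = m%:R by rewrite sqr_sqrtr// ltW.
have tm : t <= m%:R by rewrite /t; lra.
have as_ : a <= s by rewrite ler_sqrt// ltW.
pose r := Num.truncn s; have /andP[rs sr] := truncn_itv (ltW s0).
rewrite -/r in rs sr.
have s_half : 2 * s <= m%:R.
  have : 2 <= s.
    have -> : 2 = Num.sqrt 4%:R :> R by rewrite (_ : 4%:R = 2 ^+ 2) ?sqrtr_sqr ?ger0_norm//; ring.
    by rewrite ler_sqrt// ler_nat.
  by rewrite -s2 expr2 => ?; rewrite ler_pM2r.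
have rm : (r.*2 <= m)%N.
  by rewrite -(ler_nat R) -mul2n natrM; apply: le_trans s_half; rewrite ler_pM2l.
pose F (k : nat) := n k * ((1 + k%:R) * (a ^- 3 * gauss a (2 * t) k%:R)).
have F0 k : 0 <= F k.
  by rewrite /F; apply: mulr_ge0 => //; apply: mulr_ge0; rewrite ?addr_ge0//;
    apply: mulr_ge0; rewrite ?expR_ge0// invr_ge0 exprn_ge0// ltW.
have -> : \sum_(k < m.+1) F k = \sum_(k < m.+1) F (m - k)%N.
  rewrite (reindex_inj rev_ord_inj) /=; apply: eq_bigr => k _.
  by rewrite subSS.
have rm1 : (r.+1 <= m.+1)%N by rewrite ltnS (leq_trans _ rm)// -addnn leq_addr.
(* Rough decrease gives [n m / C], the linear factor gives [m / 2], and the Gaussian is at least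
   [1 / 2], its exponent being [k ^+ 2 / (2 * m) <= 1 / 2]. *)
have term (k : 'I_r.+1) : n m / (4 * C) / s <= F (m - k)%N.
  have kr : (k <= r)%N by rewrite -ltnS.
  have km : (k <= m)%N by rewrite (leq_trans kr)// -ltnS.
  have kh : (k.*2 <= m)%N by rewrite (leq_trans _ rm)// leq_double.
  have h1 : n m / C <= n (m - k)%N.
    rewrite ler_pdivrMr// mulrC; apply: rough; last exact: leq_subr.
    rewrite leq_subRL// -leq_double doubleD (leq_trans (leq_add kh mk0))//.
    by rewrite addnn.
  have kR : k%:R <= m%:R / 2 :> R.
    by rewrite ler_pdivlMr// -natrM ler_nat muln2.
  have h2 : s ^+ 2 / 2 <= 1 + (m - k)%:R by rewrite s2 natrB//; lra.
  have h3 : s ^- 3 / 2 <= a ^- 3 * gauss a (2 * t) (m - k)%:R.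
    apply: ler_pM; rewrite ?invr_ge0 ?exprn_ge0 ?(ltW s0)//.
      by rewrite lef_pV2 ?posrE ?exprn_gt0// ler_pXn2r ?nnegrE// ltW.
    rewrite /gauss t2 natrB//.
    have e : ((m%:R - k%:R - m%:R) / (2 * a)) ^+ 2 = k%:R ^+ 2 / (2 * m%:R) :> R.
      rewrite expr_div_n exprMn a2; field.
      by rewrite !pnatr_eq0 -lt0n (leq_trans _ m4).
    rewrite e; have : k%:R ^+ 2 / (2 * m%:R) <= 2^-1 :> R.
      rewrite ler_pdivrMr ?mulr_gt0// mulKf// -s2 ler_sqr ?nnegrE ?(ltW s0)//.
      by apply: le_trans rs; rewrite ler_nat.
    have := expR_ge1Dx (- (k%:R ^+ 2 / (2 * m%:R)) : R); lra.
  have -> : n m / (4 * C) / s = n m / C * (s ^+ 2 / 2 * (s ^- 3 / 2)).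
    by field; rewrite !gt_eqF.
  apply: ler_pM => //.
  - by rewrite divr_ge0// ltW.
  - by rewrite mulr_ge0// divr_ge0// ?sqr_ge0// invr_ge0 exprn_ge0// ltW.
  - apply: ler_pM => //; first by rewrite divr_ge0// sqr_ge0.
    by rewrite divr_ge0// invr_ge0 exprn_ge0// ltW.
have : \sum_(k < r.+1) n m / (4 * C) / s <= \sum_(k < m.+1) F (m - k)%N.
  apply: le_trans (ler_sum _ (fun k _ => term k)) _.
  rewrite (big_ord_widen m.+1 (fun k => F (m - k)%N))//.
  rewrite [leRHS](bigID (fun k : 'I_m.+1 => (k < r.+1)%N)) /=.
  by rewrite lerDl sumr_ge0.
rewrite sumr_const card_ord -[_ *+ r.+1]mulr_natl => h h'.
have c0 : 0 <= n m / (4 * C) by rewrite divr_ge0// mulr_ge0// ltW.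
have : n m / (4 * C) <= r.+1%:R * (n m / (4 * C) / s).
  by rewrite mulrCA ler_peMr// ler_pdivlMr// mul1r ltW.
move=> /le_trans /(_ h) /le_trans /(_ h'); rewrite ler_pdivrMr ?mulr_gt0//.
by rewrite mulrC mulrA [_ * C * D]mulrC -?mulrA.
Qed.

(** For [k <= M <= 2 * t - 2 * B * Num.sqrt t] the Gaussian in the weight is at
    most [expR (- B ^+ 2)]. *)
Lemma split_sum alpha C D n (k0 : nat) : 0 <= alpha -> 0 <= C -> 0 <= D ->
  (forall k, 0 <= n k) ->
  (forall k, n k.+1 <= D * k.+1%:R `^ (- alpha)) ->
  (forall j k, (k0 <= j)%N -> (j <= k)%N -> n k <= C * n j) ->
  exists2 E : R, 0 < E & forall (B t : R) (M J : nat), 0 <= B ->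
    (maxn 2 k0 <= M)%N -> M%:R / 2 + B * Num.sqrt M%:R <= t -> t <= M%:R ->
    \sum_(k < J) n k.+1 * weight t k%:R <=
      E * expR (- B ^+ 2) * M%:R `^ (- alpha) + 86 * C * n M.
Proof.
move=> al0 C0 D0 n0 nD rough.
have i32 : 0 < 32^-1 :> R by rewrite invr_gt0.
have [E1 E10 HE1] := powR_expR_bound al0 i32.
have p20 : 0 < 2 `^ alpha :> R by exact: powR_gt0.
exists (9 * D * (8 * 2 `^ alpha + 16 * E1) + 1).
  by rewrite ltr_wpDl// !mulr_ge0// addr_ge0 ?mulr_ge0// ltW.
move=> B t M J B0; rewrite geq_max => /andP[M2 Mk0] tB tM.
set s := Num.sqrt _ in tB.
have M0 : 0 < M%:R :> R by rewrite ltr0n; apply: leq_trans M2.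
have M2R : 2 <= M%:R :> R by rewrite ler_nat.
have s0 : 0 < s by rewrite sqrtr_gt0.
have s2 : s ^+ 2 = M%:R by rewrite sqr_sqrtr// ltW.
have s1 : 1 <= s by rewrite -sqrtr1 ler_sqrt ?ltW//; lra.
have Bs : 0 <= B * s by rewrite mulr_ge0// ltW.
have t1 : 1 <= t by lra.
have t0 : 0 < t by lra.
set a := Num.sqrt t; have a0 : 0 < a by rewrite sqrtr_gt0.
have a2 : a ^+ 2 = t by rewrite sqr_sqrtr// ltW.
pose Ma := M%:R `^ (- alpha) : R; have Ma0 : 0 < Ma by exact: powR_gt0.
pose eB := expR (- B ^+ 2); have eB0 : 0 < eB by exact: expR_gt0.
pose c := 9 * D * eB * Ma / s.
have c0 : 0 <= c by rewrite /c !mulr_ge0 ?invr_ge0// ltW.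
(* By [M <= 2 * t], the square of the ratio is at most 8, below [3 ^+ 2]. *)
have a3 : a ^- 3 <= 3 * s ^- 3.
  rewrite -ler_pdivrMl// -invfM lef_pV2 ?posrE ?exprn_gt0 ?mulr_gt0 ?exprn_gt0//.
  rewrite -ler_sqr ?nnegrE ?mulr_ge0 ?exprn_ge0 ?(ltW a0) ?(ltW s0)//.
  have E (x : R) : (x ^+ 3) ^+ 2 = (x ^+ 2) ^+ 3 by ring.
  rewrite [leLHS]E s2 [leRHS]exprMn [(a ^+ 3) ^+ 2]E a2.
  have : M%:R ^+ 3 <= (2 * t) ^+ 3.
    have Mt : M%:R <= 2 * t by lra.
    by rewrite ler_pXn2r ?nnegrE ?(ltW M0)//; lra.
  have : 0 <= t ^+ 3 by rewrite exprn_ge0// ltW.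
  rewrite exprMn; lra.
(* For [k.+1 >= M / 2] the bound on [n] is already of order [M] to the power [- alpha]. Further down
   it is only a constant, and part of the Gaussian is traded for that power, leaving a Gaussian of
   double width. *)
have left (k : nat) : (k <= M)%N -> n k.+1 * weight t k%:R <=
    c * (2 `^ alpha * gauss s M%:R k%:R + E1 * gauss (2 * s) M%:R k%:R).
  move=> kM; have kMR : k%:R <= M%:R :> R by rewrite ler_nat.
  (* [2 * t - k >= 2 * B * s + (M - k)]; the cross term of the square is dropped, and [t <= M]
     compares the denominators. *)
  have g1 : gauss a (2 * t) k%:R <= eB * gauss s M%:R k%:R.
    rewrite /eB /gauss -expRD ler_expR -opprD lerN2.
    have -> : ((k%:R - 2 * t) / (2 * a)) ^+ 2 = (2 * t - k%:R) ^+ 2 / (4 * t).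
      by rewrite expr_div_n exprMn a2; congr (_ / _); ring.
    have -> : B ^+ 2 + ((k%:R - M%:R) / (2 * s)) ^+ 2 =
        ((2 * (B * s)) ^+ 2 + (M%:R - k%:R) ^+ 2) / (4 * s ^+ 2).
      by field; rewrite gt_eqF.
    rewrite s2; apply: ler_pM.
    - by rewrite addr_ge0 ?sqr_ge0.
    - by rewrite invr_ge0 mulr_ge0// ltW.
    - apply: (@le_trans _ _ ((2 * (B * s) + (M%:R - k%:R)) ^+ 2)).
        have Mk : 0 <= M%:R - k%:R :> R by rewrite subr_ge0.
        have := mulr_ge0 Bs Mk; set v : R := M%:R - k%:R; set b := B * s; lra.
      by rewrite ler_sqr ?nnegrE; lra.
    - by rewrite lef_pV2 ?posrE ?mulr_gt0// ler_pM2l.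
  have w1 : weight t k%:R <= 9 * eB / s * gauss s M%:R k%:R.
    rewrite /weight -/a.
    apply: (@le_trans _ _ ((3 * s ^+ 2) * (3 * s ^- 3 * (eB * gauss s M%:R k%:R)))).
      apply: ler_pM.
      - by rewrite addr_ge0.
      - by apply: mulr_ge0; rewrite ?expR_ge0// invr_ge0 exprn_ge0// ltW.
      - by rewrite s2; lra.
      - apply: ler_pM => //; last exact: expR_ge0.
        by rewrite invr_ge0 exprn_ge0// ltW.
    rewrite le_eqVlt; apply/orP; left; apply/eqP; field.
    by rewrite gt_eqF.
  have g0 : 0 <= gauss s M%:R k%:R by exact: expR_ge0.
  have g20 : 0 <= gauss (2 * s) M%:R k%:R by exact: expR_ge0.
  suff ng : n k.+1 * gauss s M%:R k%:R <=
      D * Ma * (2 `^ alpha * gauss s M%:R k%:R + E1 * gauss (2 * s) M%:R k%:R).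
    apply: le_trans (ler_wpM2l (n0 k.+1) w1) _.
    have es : 0 <= 9 * eB / s by rewrite divr_ge0 ?mulr_ge0// ltW.
    have := ler_wpM2l es ng; rewrite /c.
    set X := 2 `^ alpha * _ + _; move: (gauss s _ _) => G h.
    rewrite mulrCA; apply: le_trans h _.
    by rewrite le_eqVlt; apply/orP; left; apply/eqP; field; rewrite gt_eqF.
  have k10 : 0 < k.+1%:R :> R by rewrite ltr0n.
  have [hk|hk] := leP (M%:R / 2) (k.+1%:R : R).
    have : n k.+1 <= D * (2 `^ alpha * Ma).
      apply: le_trans (nD k) _; rewrite ler_wpM2l// -powR_half//.
      by apply: le_powRN => //; rewrite divr_gt0.
    move=> /(ler_wpM2r g0) /le_trans; apply.
    have : 0 <= D * Ma * (E1 * gauss (2 * s) M%:R k%:R) by rewrite !mulr_ge0// ltW.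
    lra.
  have n1 : n k.+1 <= D.
    apply: le_trans (nD k) _; rewrite ler_piMr//.
    have k1 : 1 <= k.+1%:R :> R by rewrite ler1n.
    by have := le_powRN al0 ltr01 k1; rewrite powR1.
  (* Here [M - k > M / 2], so the two exponents differ by at least [3 * M / 64], more than
     [M / 32]. *)
  have g2 : gauss s M%:R k%:R <= expR (- (32^-1 * M%:R)) * gauss (2 * s) M%:R k%:R.
    rewrite /gauss -expRD ler_expR -opprD lerN2.
    set u : R := k%:R - M%:R.
    have -> : (u / (2 * s)) ^+ 2 = u ^+ 2 / (4 * M%:R).
      by rewrite expr_div_n exprMn s2; congr (_ / (_ * _)); ring.
    have -> : (u / (2 * (2 * s))) ^+ 2 = u ^+ 2 / (16 * M%:R).
      by rewrite expr_div_n !exprMn s2; congr (_ / _); ring.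
    have u2 : M%:R ^+ 2 / 4 <= u ^+ 2.
      have -> : u ^+ 2 = (M%:R - k%:R) ^+ 2 by rewrite /u; ring.
      have -> : M%:R ^+ 2 / 4 = (M%:R / 2) ^+ 2 :> R by field.
      rewrite ler_sqr ?nnegrE; move: hk; rewrite -natr1; lra.
    rewrite -subr_ge0.
    have -> : u ^+ 2 / (4 * M%:R) - (32^-1 * M%:R + u ^+ 2 / (16 * M%:R)) =
        (6 * u ^+ 2 - M%:R ^+ 2) / (32 * M%:R).
      by field; rewrite gt_eqF.
    by rewrite divr_ge0 ?mulr_ge0 ?(ltW M0)// subr_ge0; have := sqr_ge0 u; lra.
  have e1 : expR (- (32^-1 * M%:R)) <= E1 * Ma.
    rewrite expRN /Ma powRN ler_pdivlMr ?powR_gt0// mulrC ler_pdivrMr ?expR_gt0//.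
    by apply: HE1; lra.
  apply: (@le_trans _ _ (D * (E1 * Ma * gauss (2 * s) M%:R k%:R))).
    apply: ler_pM => //; apply: le_trans g2 _; exact: ler_wpM2r.
  have : 0 <= D * Ma * (2 `^ alpha * gauss s M%:R k%:R) by rewrite !mulr_ge0// ltW.
  lra.
have term (k : 'I_J) : n k.+1 * weight t k%:R <=
    c * (2 `^ alpha * gauss s M%:R k%:R + E1 * gauss (2 * s) M%:R k%:R) +
    C * n M * weight t k%:R.
  have w0 : 0 <= weight t k%:R by exact: weight_ge0.
  have g0 : 0 <= gauss s M%:R k%:R by exact: expR_ge0.
  have g20 : 0 <= gauss (2 * s) M%:R k%:R by exact: expR_ge0.
  have [kM|Mk] := leqP k M.
    apply: le_trans (left k kM) _; rewrite lerDl.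
    by apply: mulr_ge0 => //; exact: mulr_ge0.
  apply: le_trans (_ : C * n M * weight t k%:R <= _).
    rewrite ler_wpM2r//; apply: rough => //.
    by rewrite (leq_trans (ltnW Mk)).
  rewrite lerDr; apply: mulr_ge0 => //.
  by apply: addr_ge0; apply: mulr_ge0 => //; exact: ltW.
apply: le_trans (ler_sum _ (fun k _ => term k)) _.
rewrite big_split /= -!mulr_sumr big_split /= -!mulr_sumr.
have h1 := sum_gauss M%:R J s1.
have s21 : 1 <= 2 * s by lra.
have h2 := sum_gauss M%:R J s21.
have h3 := sum_weight J t1.
apply: lerD; last first.
  have := ler_wpM2l (mulr_ge0 C0 (n0 M)) h3; lra.
apply: (@le_trans _ _ (c * (2 `^ alpha * (8 * s) + E1 * (8 * (2 * s))))).
  apply: ler_wpM2l => //; apply: lerD; rewrite ler_pM2l//.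
have -> : c * (2 `^ alpha * (8 * s) + E1 * (8 * (2 * s))) =
    9 * D * (8 * 2 `^ alpha + 16 * E1) * eB * Ma.
  by rewrite /c; field; rewrite gt_eqF.
rewrite -/eB -/Ma ler_wpM2r ?(ltW Ma0)// ler_wpM2r ?(ltW eB0)//.
by rewrite lerDl.
Qed.

End Growth.

(** * The averaged count at integer radii *)

Section AveragedCount.
Context {R : realType}.
Variables (Gam : kleinian_group R) (a b : H3 R).
Implicit Types (F : {fset (H3 R -> H3 R)}) (r t C D : R).

Lemma le_orbit_count r r' : r <= r' -> orbit_count Gam a b r <= orbit_count Gam a b r'.
Proof.
move=> rr; rewrite ler_nat; apply: uniq_leq_size; first exact: fset_uniq.
move=> g; rewrite !mem_orbital => /asboolP[Gg gr]; apply/asboolP; split => //.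
exact: le_trans gr rr.
Qed.

Definition avg_count (k : nat) : R := orbit_count Gam a b k%:R / expR (2 * k%:R).

Lemma avg_count_ge0 k : 0 <= avg_count k.
Proof. by rewrite divr_ge0 ?expR_ge0// ler0n. Qed.

Lemma avg_countE k : avg_count k * expR (2 * k%:R) = orbit_count Gam a b k%:R.
Proof. by rewrite divfK// gt_eqF// expR_gt0. Qed.

Lemma kernel_sum_le_avg F t : 0 < t -> (forall g, g \in F -> kg_mem Gam g) ->
  exists J : nat, kernel_sum F b a t <=
    2 * expR 2 * \sum_(k < J) avg_count k.+1 * weight t k%:R.
Proof.
move=> t0 FG; have [J HJ] := kernel_sum_le_count a b t0 FG.
exists J; apply: le_trans HJ _; rewrite mulr_sumr; apply: ler_sum => k _.
rewrite -avg_countE -[k.+1%:R]natr1 mulrDr mulr1 expRD expRN.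
rewrite le_eqVlt; apply/orP; left; apply/eqP; field.
by rewrite gt_eqF// expR_gt0.
Qed.

Section Rough.
Variables (C : R) (k0 : nat).
Hypotheses (C0 : 0 < C)
  (rough : forall j k, (k0 <= j)%N -> (j <= k)%N -> avg_count k <= C * avg_count j).

Lemma avg_count_bounded : exists2 B, 0 < B & forall k, avg_count k <= B.
Proof.
have o0 : 0 <= orbit_count Gam a b k0%:R by exact: ler0n.
have c0 : 0 <= C * avg_count k0 by rewrite mulr_ge0 ?avg_count_ge0// ltW.
exists (orbit_count Gam a b k0%:R + C * avg_count k0 + 1).
  by rewrite ltr_wpDl// addr_ge0.
move=> k; have [kk|kk] := leqP k0 k.
  by apply: le_trans (rough (leqnn _) kk) _; lra.
apply: (@le_trans _ _ (orbit_count Gam a b k0%:R)); last by lra.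
rewrite /avg_count ler_pdivrMr ?expR_gt0//.
apply: le_trans (_ : orbit_count Gam a b k0%:R <= _).
  by apply: le_orbit_count; rewrite ler_nat ltnW.
rewrite ler_peMr//; have := expR_ge1Dx (2 * k%:R : R).
by have := ler0n R k; lra.
Qed.

(** A first bound without decay in [t] but uniform in [F]: it supplies the [S] that
    [kernel_cross_bound] needs at a reference time. *)
Lemma kernel_sum_bounded : exists2 S, 0 < S & forall F t, 1 <= t ->
  (forall g, g \in F -> kg_mem Gam g) -> kernel_sum F b a t <= S.
Proof.
have [B B0 nB] := avg_count_bounded; have e0 : 0 < expR 2 :> R by exact: expR_gt0.
exists (2 * expR 2 * (B * 86)); first by rewrite !mulr_gt0.
move=> F t t1 FG; have t0 : 0 < t by rewrite (lt_le_trans ltr01).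
have [J HJ] := kernel_sum_le_avg t0 FG; apply: le_trans HJ _.
rewrite ler_pM2l ?mulr_gt0//.
apply: (@le_trans _ _ (\sum_(k < J) B * weight t k%:R)).
  by apply: ler_sum => k _; rewrite ler_wpM2r// weight_ge0.
by rewrite -mulr_sumr ler_pM2l// sum_weight.
Qed.

Variables (p : M Gam -> M Gam -> R -> R) (hp : heat_kernel p) (alpha : R).
Hypothesis halpha : 0 <= alpha.
Let P := p (Defs.proj Gam a) (Defs.proj Gam b).

(** [kernel_cross_bound] with the fixed reference time [s1] transfers the upper bound on [p] to all
    finite kernel sums, and [upper_growth] turns this into a bound on counts at large radii. *)
Lemma avg_count_upper t0 cp : 0 < t0 -> 0 < cp ->
    (forall t, t0 < t -> 0 < P t) -> (forall t, t0 < t -> P t <= cp * t `^ (- alpha)) ->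
  exists2 D, 0 < D & forall k, avg_count k.+1 <= D * k.+1%:R `^ (- alpha).
Proof.
move=> t00 cp0 Pp Pcp; have [S S0 KS] := kernel_sum_bounded.
pose s1 := t0 + 1; have s10 : 0 < s1 by rewrite addr_gt0.
have Ps1 : 0 < P s1 by apply: Pp; rewrite /s1 ltrDl.
pose e := S * cp / P s1; have e0 : 0 < e by rewrite divr_gt0 ?mulr_gt0.
have Kt F t : t0 < t -> (forall g, g \in F -> kg_mem Gam g) ->
    kernel_sum F b a t <= e * t `^ (- alpha).
  move=> tt FG; have t_0 : 0 < t by exact: lt_trans tt.
  have := kernel_cross_bound hp s10 t_0 Ps1 (S := S) _ FG.
  have bS (tau : R) (F' : {fset (H3 R -> H3 R)}) : 0 < tau -> tau <= 1 ->
      (forall g, g \in F' -> kg_mem Gam g) -> kernel_sum F' b a (s1 + tau) <= S.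
    by move=> tau0 _ F'G; apply: KS => //; rewrite /s1; lra.
  move=> /(_ bS) h; rewrite -(ler_pM2r Ps1); apply: le_trans h _.
  have -> : e * t `^ (- alpha) * P s1 = cp * t `^ (- alpha) * S.
    by rewrite /e; field; rewrite gt_eqF.
  by rewrite ler_pM2r// Pcp.
(* Ensures [m / 2 > t0] for [m >= m1]. *)
pose m1 := (Num.truncn (2 * t0)).+1.
pose D1 := 24 * (e * 2 `^ alpha).
have p2 : 0 < 2 `^ alpha :> R by exact: powR_gt0.
have D10 : 0 < D1 by apply: mulr_gt0 => //; exact: mulr_gt0.
have sumD m : (m1 <= m)%N -> let t := m%:R / 2 in
    \sum_(k < m.+1) avg_count k * ((1 + k%:R) *
      (Num.sqrt t ^- 3 * gauss (Num.sqrt t) (2 * t) k%:R)) <= D1 * m%:R `^ (- alpha).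
  move=> mm; pose t : R := m%:R / 2; rewrite /= -/t; have mR : 2 * t0 < m%:R.
    by apply: lt_le_trans (truncnS_gt _) _; rewrite ler_nat.
  have tt : t0 < t by rewrite /t; lra.
  have tp : 0 < t by exact: lt_trans tt.
  have := count_le_kernel_sum Gam a b m tp.
  set F := fset_set _; have FG g : g \in F -> kg_mem Gam g.
    by rewrite mem_orbital => /asboolP[].
  have := Kt F t tt FG; rewrite /t powR_half; last lra.
  rewrite -/t => h1 h2.
  have -> : D1 * m%:R `^ (- alpha) = 24 * (e * (2 `^ alpha * m%:R `^ (- alpha))).
    by rewrite /D1 !mulrA.
  apply: le_trans (_ : 24 * kernel_sum F b a t <= _); last by rewrite ler_pM2l.
  apply: le_trans h2; apply: ler_sum => k _.
  rewrite -[in leRHS]avg_countE expRN le_eqVlt; apply/orP; left; apply/eqP.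
  move: (_ ^- 3 * _) => X; field.
  by rewrite gt_eqF// expR_gt0.
clearbody D1.
have up := upper_growth C0 (ltW D10) avg_count_ge0 rough sumD.
have [B B0 nB] := avg_count_bounded.
set m2 := maxn _ _ in up.
have m20 : 0 < m2%:R :> R by rewrite ltr0n !leq_max.
have pm2 : 0 < m2%:R `^ alpha :> R by exact: powR_gt0.
(* The second summand covers the finitely many radii below [m2], where only the bound [B] is
   known. *)
exists (4 * C * D1 + B * m2%:R `^ alpha); first by rewrite addr_gt0 ?mulr_gt0.
move=> k; have kp : 0 < k.+1%:R `^ (- alpha) :> R by apply: powR_gt0; rewrite ltr0n.
have [mk|km] := leqP m2 k.+1.
  by apply: le_trans (up _ mk) _; rewrite ler_pM2r// lerDl mulr_ge0// ltW.
apply: le_trans (nB _) _; rewrite mulrDl -[leLHS]add0r; apply: lerD.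
  by rewrite !mulr_ge0// ltW.
rewrite -mulrA ler_peMr ?(ltW B0)//.
have : m2%:R `^ (- alpha) <= k.+1%:R `^ (- alpha) :> R.
  by apply: le_powRN => //; rewrite ?ltr0n// ler_nat ltnW.
by rewrite powRN -ler_pdivrMl ?invr_gt0// mulr1 => /le_trans; apply.
Qed.

(** Now the reference time [T] carries a fixed subsum and [t] varies: any common bound [S] of the
    sums just after [t] is at least of order [t] to the power [- alpha]. With the bound of
    [split_sum] as [S], the averaged count at [m] is what has to be large. *)
Lemma avg_count_lower t0 cm D : 0 < t0 -> 0 < cm -> 0 < D ->
    (forall t, t0 < t -> cm * t `^ (- alpha) <= P t) ->
    (forall k, avg_count k.+1 <= D * k.+1%:R `^ (- alpha)) ->
  exists c m0, 0 < c /\ forall m, (m0 <= m)%N -> c * m%:R `^ (- alpha) <= avg_count m.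
Proof.
move=> t00 cm0 D0 Pcm nD.
have Pp t : t0 < t -> 0 < P t.
  move=> tt; apply: lt_le_trans (Pcm _ tt); rewrite mulr_gt0// powR_gt0//.
  exact: lt_trans tt.
pose T := t0 + 1; have T0 : 0 < T by rewrite addr_gt0.
have PT : 0 < P T by apply: Pp; rewrite /T ltrDl.
(* One element is enough to make the reference sum positive. *)
pose F0 : {fset (H3 R -> H3 R)} := [fset (id : H3 R -> H3 R)]%fset.
have F0G g : g \in F0 -> kg_mem Gam g by rewrite inE => /eqP ->; exact: kg_id.
have K0 : 0 < kernel_sum F0 b a T.
  rewrite /kernel_sum big_seq_fset1 mulr_gt0 ?expR_gt0//.
  apply: lt_le_trans (sinhc_inv_ge (hdist_ge0 _ _)).
  by rewrite ?mulr_gt0 ?expR_gt0 ?invr_gt0// ltr_wpDr// hdist_ge0.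
pose c5 := kernel_sum F0 b a T * cm / P T.
have c50 : 0 < c5 by rewrite divr_gt0 ?mulr_gt0.
have lowS t S : t0 < t -> (forall (tau : R) (F : {fset (H3 R -> H3 R)}), 0 < tau -> tau <= 1 ->
    (forall g, g \in F -> kg_mem Gam g) -> kernel_sum F b a (t + tau) <= S) ->
    c5 * t `^ (- alpha) <= S.
  move=> tt HS; have tp : 0 < t by exact: lt_trans tt.
  have h := kernel_cross_bound hp tp T0 (Pp _ tt) HS F0G.
  have h2 := ler_wpM2l (ltW K0) (Pcm _ tt).
  rewrite -(ler_pM2l PT); apply: le_trans h; apply: le_trans h2.
  by rewrite /c5 le_eqVlt; apply/orP; left; apply/eqP; field; rewrite gt_eqF.
have [E E0 HE] := split_sum halpha (ltW C0) (ltW D0) avg_count_ge0 nD rough.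
pose e2 : R := 2 * expR 2; have e20 : 0 < e2 by rewrite mulr_gt0 ?expR_gt0.
(* Since [expR (B ^+ 2) >= 1 + B ^+ 2 >= B], the part of the sum with [k <= m] takes at most half of
   the lower bound. *)
pose B := 2 * e2 * E / c5 + 1.
have B1 : 1 <= B by rewrite lerDr !mulr_ge0 ?invr_ge0// ltW.
have EB : e2 * (E * expR (- B ^+ 2)) <= c5 / 2.
  rewrite expRN mulrA ler_pdivrMr ?expR_gt0//.
  have B2 : 2 * e2 * E / c5 <= expR (B ^+ 2).
    apply: le_trans (expR_ge1Dx _); apply: (@le_trans _ _ B); first by rewrite lerDl.
    by rewrite -[leLHS]add0r lerD// expr2 ler_peMr//; lra.
  have -> : e2 * E = c5 / 2 * (2 * e2 * E / c5) by field; rewrite gt_eqF.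
  by rewrite ler_pM2l// divr_gt0.
exists (c5 / 2 / (e2 * 86 * C)).
(* [16 * B ^+ 2] gives [B * sqrt m <= m / 4], [4] makes room for the shift [tau <= 1] below [m], and
   [2 * t0] gives [t > t0]. *)
exists (maxn (maxn 2 k0) (Num.truncn (4 + 2 * t0 + 16 * B ^+ 2)).+1); split.
  by rewrite !divr_gt0 ?mulr_gt0.
move=> m; rewrite geq_max => /andP[mk mm].
have mR : 4 + 2 * t0 + 16 * B ^+ 2 < m%:R.
  by apply: lt_le_trans (truncnS_gt _) _; rewrite ler_nat.
have B20 := sqr_ge0 B.
have m0 : 0 < m%:R :> R by lra.
set s : R := Num.sqrt m%:R; have s2 : s ^+ 2 = m%:R by rewrite sqr_sqrtr// ltW.
have s0 : 0 < s by rewrite sqrtr_gt0.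
have B0 : 0 <= B by lra.
have Bs : 4 * B <= s.
  by rewrite -ler_sqr ?nnegrE ?mulr_ge0 ?(ltW s0)// s2 exprMn; lra.
have Bsm : 4 * (B * s) <= m%:R by rewrite -s2 expr2 mulrA ler_pM2r.
have Bs0 : 0 <= B * s by rewrite mulr_ge0// ltW.
pose t := m%:R / 2 + B * s; have tt : t0 < t by rewrite /t; lra.
have tm : t + 1 <= m%:R by rewrite /t; lra.
have := lowS t (e2 * (E * expR (- B ^+ 2) * m%:R `^ (- alpha) + 86 * C * avg_count m)) tt.
have bS (tau : R) (F : {fset (H3 R -> H3 R)}) : 0 < tau -> tau <= 1 ->
    (forall g, g \in F -> kg_mem Gam g) -> kernel_sum F b a (t + tau) <=
    e2 * (E * expR (- B ^+ 2) * m%:R `^ (- alpha) + 86 * C * avg_count m).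
  move=> tau0 tau1 FG; have ttau : 0 < t + tau by lra.
  have [J HJ] := kernel_sum_le_avg ttau FG; apply: le_trans HJ _.
  by rewrite ler_pM2l//; apply: HE => //; rewrite -?/s -?/t; lra.
move=> /(_ bS); set Ma := m%:R `^ (- alpha).
have Ma0 : 0 < Ma by exact: powR_gt0.
have Mat : Ma <= t `^ (- alpha) by apply: le_powRN => //; lra.
have := ler_wpM2l (ltW c50) Mat; have := ler_wpM2r (ltW Ma0) EB.
move=> h1 h2 h3; rewrite mulrAC ler_pdivrMr ?mulr_gt0//; lra.
Qed.

End Rough.
End AveragedCount.

Theorem theorem1p7 (R : realType) (Gam : kleinian_group R)
  (p : M Gam -> M Gam -> R -> R) (hp : heat_kernel p)
  (alpha : R) (halpha : 0 <= alpha) (x y : M Gam)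
  (hi : exists cm cp t0 : R, [/\ 0 < cm, 0 < cp, 0 < t0 &
    forall t, t0 < t ->
      cm * t `^ (- alpha) <= p x y t /\ p x y t <= cp * t `^ (- alpha)])
  (hii : roughly_decreasing (avg_orbital x y)) :
  exists Cm Cp rho0 : R, [/\ 0 < Cm, 0 < Cp, 0 < rho0 &
    forall rho, rho0 < rho ->
      Cm * expR (2 * rho) / rho `^ alpha <= (orbital x y rho)%:R /\
      (orbital x y rho)%:R <= Cp * expR (2 * rho) / rho `^ alpha].
Proof.
have [cm [cp [t0 [cm0 cp0 t00 hP]]]] := hi.
have [C [rho0 [C0 rho00 rough]]] := hii.
pose a := Defs.lift x; pose b := Defs.lift y.
have ax : Defs.proj Gam a = x by exact: reprK.
have yb : Defs.proj Gam b = y by exact: reprK.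
rewrite -[x]ax -[y]yb in hP.
pose N := orbit_count Gam a b.
(* [orbital] counts with the very lifts [a] and [b], so this holds by computation. *)
have NE rho : (orbital x y rho)%:R = N rho by [].
pose k0 := (Num.truncn rho0).+1.
have rk0 : rho0 <= k0%:R by exact/ltW/truncnS_gt.
have roughN j k : (k0 <= j)%N -> (j <= k)%N ->
    avg_count Gam a b k <= C * avg_count Gam a b j.
  move=> kj jk; apply: rough; rewrite ?ler_nat//.
  by apply: le_trans rk0 _; rewrite ler_nat.
have Pp t : t0 < t -> 0 < p (Defs.proj Gam a) (Defs.proj Gam b) t.
  move=> tt; apply: lt_le_trans (hP _ tt).1; rewrite mulr_gt0// powR_gt0//.
  exact: lt_trans tt.
have [D D0 nD] := avg_count_upper C0 roughN hp halpha t00 cp0 Pp (fun t tt => (hP t tt).2).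
have [c [m0 [c0 nc]]] := avg_count_lower C0 roughN hp halpha t00 cm0 D0
  (fun t tt => (hP t tt).1) nD.
(* Replacing [rho] by its integer part [m] from below, or by [m.+1] from above, costs a factor
   [expR 2]. The threshold [m0.+1] makes [m0 < m], so that also [0 < m]. *)
exists (c / expR 2), (D * expR 2), (m0.+1%:R); split.
- by rewrite divr_gt0// expR_gt0.
- by rewrite mulr_gt0// expR_gt0.
- by rewrite ltr0n.
move=> rho mr; have r0 : 0 < rho by apply: lt_trans mr; rewrite ltr0n.
set m := Num.truncn rho; have /andP[mrho rhom] := truncn_itv (ltW r0).
rewrite -/m in mrho rhom.
have mm : (m0 < m)%N by rewrite -ltnS -(ltr_nat R); exact: lt_trans mr rhom.
have mp : 0 < m%:R :> R by rewrite ltr0n; apply: leq_trans mm.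
have e2 : 0 < expR 2 :> R by exact: expR_gt0.
rewrite !NE -!powRN; split.
  apply: le_trans (le_orbit_count Gam a b mrho); rewrite -avg_countE.
  have h1 := nc m (ltnW mm).
  have h2 : expR (2 * rho) / expR 2 <= expR (2 * m%:R).
    rewrite ler_pdivrMr// -expRD ler_expR; move: rhom; rewrite -natr1; lra.
  have h3 := le_powRN halpha mp mrho.
  rewrite [leLHS](_ : _ = c * rho `^ (- alpha) * (expR (2 * rho) / expR 2)); last by ring.
  apply: ler_pM => //; first by rewrite mulr_ge0 ?powR_ge0// ltW.
  by apply: le_trans h1; rewrite ler_pM2l.
apply: le_trans (le_orbit_count Gam a b (ltW rhom)) _; rewrite -avg_countE.
have h2 : expR (2 * m.+1%:R) <= expR 2 * expR (2 * rho).
  by rewrite -expRD ler_expR -natr1; lra.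
have h3 := le_powRN halpha r0 (ltW rhom).
rewrite [leRHS](_ : _ = D * rho `^ (- alpha) * (expR 2 * expR (2 * rho))); last by ring.
apply: ler_pM => //; rewrite ?avg_count_ge0 ?expR_ge0//.
by apply: le_trans (nD m) _; rewrite ler_pM2l.
Qed.
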